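(* Let $\gamma:I\to\mathbb{R}^2$ be a $C^\infty$ curve with $0\in I$. (1) $\gamma$ is $\mathcal{A}$-equivalent at $t=0$ to $Cusp_{(4,5;+7)}(t)=(t^4,t^5+t^7)$ if and only if $\gamma'(0)=\gamma''(0)=\gamma'''(0)=\mathbf{0}$, $A\neq0$ and $-77B^2+105AD+60AC>0$. (2) $\gamma$ is $\mathcal{A}$-equivalent at $t=0$ to $Cusp_{(4,5;-7)}(t)=(t^4,t^5-t^7)$ if and only if $\gamma'(0)=\gamma''(0)=\gamma'''(0)=\mathbf{0}$, $A\neq0$ and $-77B^2+105AD+60AC<0$. (3) $Cusp_{(4,5;+7)}$ and $Cusp_{(4,5;-7)}$ are not $\mathcal{A}$-equivalent at $t=0$.
   Context: $A=\det(\gamma^{(5)}(0),\gamma^{(4)}(0))$, $B=\det(\gamma^{(6)}(0),\gamma^{(4)}(0))$, $C=\det(\gamma^{(7)}(0),\gamma^{(4)}(0))$, $D=\det(\gamma^{(6)}(0),\gamma^{(5)}(0))$. $\mathcal{A}$-equivalence: existence of $C^\infty$ diffeomorphism germs $\psi$ of $(\mathbb{R},0)$ and $\Psi$ of $\mathbb{R}^2$ with $\Psi\circ\gamma_1\circ\psi^{-1}=\gamma_2$. *)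

(* Defs.v *)
From Stdlib Require Import Reals List.
From Coquelicot Require Import Coquelicot.
Open Scope R_scope.

Definition smooth1_on (U : R -> Prop) (f : R -> R) : Prop :=
  forall (n : nat) (x : R), U x -> ex_derive_n f n x.

Definition pd (b : bool) (f : R * R -> R) : R * R -> R :=
  fun p => if b then Derive (fun t => f (t, snd p)) (fst p)
           else Derive (fun t => f (fst p, t)) (snd p).

Definition iterpd (w : list bool) (f : R * R -> R) : R * R -> R :=
  fold_right pd f w.

Definition smooth2_on (U : R * R -> Prop) (f : R * R -> R) : Prop :=
  forall (w : list bool) (p : R * R), U p ->
    continuous (iterpd w f) p /\
    ex_derive (fun t => iterpd w f (t, snd p)) (fst p) /\
    ex_derive (fun t => iterpd w f (fst p, t)) (snd p).

Definition near1 (x eps : R) : R -> Prop := fun t => Rabs (t - x) < eps.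
Definition near2 (q : R * R) (eps : R) : R * R -> Prop :=
  fun p => Rabs (fst p - fst q) < eps /\ Rabs (snd p - snd q) < eps.

Definition smooth22_on (U : R * R -> Prop) (F : R * R -> R * R) : Prop :=
  smooth2_on U (fun p => fst (F p)) /\ smooth2_on U (fun p => snd (F p)).

Definition smooth_curve_germ (g : R -> R * R) : Prop :=
  exists eps, 0 < eps /\
    smooth1_on (near1 0 eps) (fun t => fst (g t)) /\
    smooth1_on (near1 0 eps) (fun t => snd (g t)).

Definition diffeo_germ1 (psi psii : R -> R) : Prop :=
  psi 0 = 0 /\ psii 0 = 0 /\
  exists eps, 0 < eps /\
    smooth1_on (near1 0 eps) psi /\ smooth1_on (near1 0 eps) psii /\
    (forall t, near1 0 eps t -> psii (psi t) = t) /\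
    (forall t, near1 0 eps t -> psi (psii t) = t).

Definition diffeo_germ2 (p q : R * R) (Psi Psii : R * R -> R * R) : Prop :=
  Psi p = q /\ Psii q = p /\
  exists eps, 0 < eps /\
    smooth22_on (near2 p eps) Psi /\ smooth22_on (near2 q eps) Psii /\
    (forall x, near2 p eps x -> Psii (Psi x) = x) /\
    (forall y, near2 q eps y -> Psi (Psii y) = y).

Definition A_equiv (g1 g2 : R -> R * R) : Prop :=
  exists (psi psii : R -> R) (Psi Psii : R * R -> R * R),
    diffeo_germ1 psi psii /\
    diffeo_germ2 (g1 0) (g2 0) Psi Psii /\
    exists eps, 0 < eps /\
      forall t, near1 0 eps t -> Psi (g1 (psii t)) = g2 t.

Definition dcurve (g : R -> R * R) (k : nat) (t : R) : R * R :=
  (Derive_n (fun s => fst (g s)) k t, Derive_n (fun s => snd (g s)) k t).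

Definition det2 (u v : R * R) : R := fst u * snd v - snd u * fst v.

Definition coefA (g : R -> R * R) : R := det2 (dcurve g 5 0) (dcurve g 4 0).
Definition coefB (g : R -> R * R) : R := det2 (dcurve g 6 0) (dcurve g 4 0).
Definition coefC (g : R -> R * R) : R := det2 (dcurve g 7 0) (dcurve g 4 0).
Definition coefD (g : R -> R * R) : R := det2 (dcurve g 6 0) (dcurve g 5 0).

Definition invariant45 (g : R -> R * R) : R :=
  -77 * (coefB g)^2 + 105 * coefA g * coefD g + 60 * coefA g * coefC g.

Definition cusp_plus (t : R) : R * R := (t ^ 4, t ^ 5 + t ^ 7).
Definition cusp_minus (t : R) : R * R := (t ^ 4, t ^ 5 - t ^ 7).

(* Main.v *)
Require Import Defs.
From Stdlib Require Import Reals Lra Lia List Factorial ClassicalEpsilon IndefiniteDescription.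
From Coquelicot Require Import Coquelicot.
Open Scope R_scope.

(** If g is A-equivalent to h(t) = (t^4, t^5 + e t^7 + O(t^8)), then g is the image of a reparametrization of h
    under a diffeomorphism germ of the plane; along h one has x ~ t^4 and y ~ t^5, so the 7-jet of g only sees
    the linear part of that germ, and the invariant of g is a positive multiple of e.

    Conversely, an affine map and the new parameter x^(1/4) bring g to (t^4, t^5 + e t^7 + O(t^8)), and a rescaling
    gives e = sg with sg = 1 or -1.  In degrees 8 and above only t^11 is not the leading monomial of a function of
    (x, y); it is removed by x -> x/(1 - d x), which moves the coefficients of t^9 and t^11 at different rates because
    e <> 0.  The remainder t^12 h(t) is exactly a smooth function of the point: by Whitney's theorem on even functions,
    applied twice, h(t) = b0(x) + t b1(x) + t^2 b2(x) + t^3 b3(x) with x = t^4, and this can be rewritten as a cubic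
    polynomial in y with coefficients smooth in x.  Extending the b_i to x < 0 uses Borel's lemma.  A shear in y,
    inverted by the implicit function theorem, then removes the remainder. *)

(** * Smooth functions of one and two variables *)

(** The finite orders in t of smooth functions of (x, y) along the cusp form the semigroup generated
    by 4 and 5. Its gaps are 1, 2, 3, 6, 7 and 11, and its conductor is 12 = (4-1)(5-1), which is
    why the last remainder starts at t^12. Gaps 1 to 3 are the vanishing derivatives. Gap 6 is
    closed by a shear x + c y matched to the change of parameter. Gap 7 carries the only invariant,
    e. Working with power series would not be enough: the remainder may have a flat part, so a
    division by t^4 among smooth functions is unavoidable.

    The sign of e is never computed along the reduction. The direct implication is proved for t^5 +
    e t^7 + t^8 z(t) with an arbitrary smooth z; applied to the intermediate normal form it ties the
    sign of e to that of the invariant. The weights -77, 105, 60 are those for which the higher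
    Taylor coefficients of the reparametrization cancel. *)

Definition has_gradient (f : R * R -> R) (p : R * R) (a b : R) : Prop :=
  differentiable_pt_lim (fun x y => f (x, y)) (fst p) (snd p) a b.

(** Class C^n at p. The partial derivatives are existential witnesses rather than [pd], because
    closure under products and composition then only has to exhibit a gradient, by induction on n;
    [of_class_pd] identifies the witnesses with [pd] afterwards. *)
Fixpoint of_class (n : nat) (f : R * R -> R) (p : R * R) : Prop :=
  match n with
  | O => continuous f p
  | S m => exists fx fy : R * R -> R, locally p (fun q : R * R => has_gradient f q (fx q) (fy q)) /\ of_class m fx p /\ of_class m fy p
  end.

Definition smooth_at (f : R * R -> R) (p : R * R) : Prop := forall n, of_class n f p.

(** One variable is treated as the first of two, so that the one-variable closure rules are
    instances of the planar ones. *)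
Definition smooth1_at (f : R -> R) (x : R) : Prop := smooth_at (fun p => f (fst p)) (x, 0).

Lemma locally_at_point (T : UniformSpace) (P : T -> Prop) (x : T) : locally x P -> P x.
Proof. exact (locally_singleton x P). Qed.

Lemma locally_near2 (p : R * R) (P : R * R -> Prop) :
  locally p P <-> exists eps, 0 < eps /\ forall q, near2 p eps q -> P q.
Proof.
  split.
  - intros [e H]. exists e. split. apply cond_pos. intros q [H1 H2]. apply H. split; assumption.
  - intros [e [He H]]. exists (mkposreal e He). intros q [H1 H2]. apply H. split; assumption.
Qed.

Lemma locally_near1 (x : R) (P : R -> Prop) :
  locally x P <-> exists eps, 0 < eps /\ forall q, near1 x eps q -> P q.
Proof.
  split.
  - intros [e H]. exists e. split. apply cond_pos. intros q H1. apply H, H1.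
  - intros [e [He H]]. exists (mkposreal e He). intros q H1. apply H, H1.
Qed.

Lemma has_gradient_ext_loc f g p a b :
  locally p (fun q => f q = g q) -> has_gradient f p a b -> has_gradient g p a b.
Proof.
  intros H. apply differentiable_pt_lim_ext. apply locally_2d_locally.
  destruct p as [x y]; simpl. revert H. apply filter_imp. intros [u v]; simpl; auto.
Qed.

Lemma of_class_ext_loc n : forall f g p,
  locally p (fun q => f q = g q) -> of_class n f p -> of_class n g p.
Proof.
  destruct n as [|n]; intros f g p H.
  - simpl. intros Hf. apply continuous_ext_loc with f; auto.
  - intros (fx & fy & H1 & H2 & H3). exists fx, fy. repeat split; auto.
    apply locally_locally in H. generalize (filter_and _ _ H H1). apply filter_imp.
    intros q [A B]. eapply has_gradient_ext_loc; eauto.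
Qed.

Lemma smooth_at_ext_loc f g p :
  locally p (fun q => f q = g q) -> smooth_at f p -> smooth_at g p.
Proof. intros H Hf n. eapply of_class_ext_loc; eauto. Qed.

Lemma has_gradient_continuous f p a b : has_gradient f p a b -> continuous f p.
Proof.
  destruct p as [x y]. intros H.
  assert (Hc : continuity_2d_pt (fun x y => f (x, y)) x y).
  { apply differentiable_continuity_pt. exists a, b. exact H. }
  apply continuity_2d_pt_filterlim in Hc. unfold continuous.
  eapply filterlim_ext; [|exact Hc]. intros [u v]; reflexivity.
Qed.

Lemma of_class_S n : forall f p, of_class (S n) f p -> of_class n f p.
Proof.
  induction n as [|n IH]; intros f p (fx & fy & H1 & H2 & H3).
  - apply locally_at_point in H1. eapply has_gradient_continuous; eauto.
  - exists fx, fy. repeat split; auto.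
Qed.

Lemma of_class_continuous n f p : of_class n f p -> continuous f p.
Proof. induction n as [|n IH]; intros H. exact H. apply IH, of_class_S, H. Qed.

Lemma has_gradient_unique f p a b : has_gradient f p a b -> pd true f p = a /\ pd false f p = b.
Proof. intros H. apply differentiable_pt_lim_unique in H. exact H. Qed.

Lemma of_class_pd n f p b : of_class (S n) f p -> of_class n (pd b f) p.
Proof.
  intros (fx & fy & H1 & H2 & H3).
  destruct b; [apply of_class_ext_loc with fx | apply of_class_ext_loc with fy]; auto;
  revert H1; apply filter_imp; intros q Hq; apply has_gradient_unique in Hq; symmetry; apply Hq.
Qed.

Lemma smooth_at_pd f p b : smooth_at f p -> smooth_at (pd b f) p.
Proof. intros H n. apply of_class_pd, H. Qed.

Lemma smooth_at_continuous f p : smooth_at f p -> continuous f p.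
Proof. intros H. exact (H O). Qed.

Lemma smooth_at_D2 f p : smooth_at f p -> has_gradient f p (pd true f p) (pd false f p).
Proof.
  intros H. destruct (H 1%nat) as (fx & fy & H1 & _). apply locally_at_point in H1.
  destruct (has_gradient_unique _ _ _ _ H1) as [E1 E2]. rewrite E1, E2. exact H1.
Qed.

Lemma has_gradient_is_derive_x f x y a b : has_gradient f (x, y) a b -> is_derive (fun t => f (t, y)) x a.
Proof.
  intros H. apply is_derive_Reals.
  replace a with (a * 1 + b * 0) by ring.
  apply (derivable_pt_lim_comp_2d (fun x y => f (x, y)) (fun t => t) (fun _ => y)).
  exact H. apply derivable_pt_lim_id. apply derivable_pt_lim_const.
Qed.

Lemma has_gradient_is_derive_y f x y a b : has_gradient f (x, y) a b -> is_derive (fun t => f (x, t)) y b.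
Proof.
  intros H. apply is_derive_Reals.
  replace b with (a * 0 + b * 1) by ring.
  apply (derivable_pt_lim_comp_2d (fun x y => f (x, y)) (fun _ => x) (fun t => t)).
  exact H. apply derivable_pt_lim_const. apply derivable_pt_lim_id.
Qed.

Lemma smooth_at_iterpd w f p : smooth_at f p -> smooth_at (iterpd w f) p.
Proof. intros H. induction w as [|b w IH]; simpl. exact H. apply smooth_at_pd, IH. Qed.

Lemma smooth_at_smooth2_on (U : R * R -> Prop) f :
  (forall p, U p -> smooth_at f p) -> smooth2_on U f.
Proof.
  intros H w p Hp. pose proof (smooth_at_iterpd w f p (H p Hp)) as Hw.
  split. apply smooth_at_continuous, Hw.
  apply smooth_at_D2 in Hw. destruct p as [x y]. split.
  eexists. eapply has_gradient_is_derive_x; eauto.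
  eexists. eapply has_gradient_is_derive_y; eauto.
Qed.

Lemma between_near x u t d : Rabs (u - x) < d -> Rmin x u <= t <= Rmax x u -> Rabs (t - x) < d.
Proof.
  intros Hu Ht. apply Rabs_def2 in Hu. apply Rabs_def1; revert Ht; unfold Rmin, Rmax;
  destruct (Rle_dec x u); lra.
Qed.

(** Going from (x, y) to (x, v) and then to (u, v), the mean value theorem produces one partial
    derivative at an intermediate point of each segment; continuity at p puts each within eps/2 of
    its value at p. *)
Lemma has_gradient_of_partials f p (fx fy : R * R -> R) :
  locally p (fun q => is_derive (fun t => f (t, snd q)) (fst q) (fx q)) ->
  locally p (fun q => is_derive (fun t => f (fst q, t)) (snd q) (fy q)) ->
  continuous fx p -> continuous fy p -> has_gradient f p (fx p) (fy p).
Proof.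
  intros H1 H2 Hx Hy eps. apply locally_2d_locally.
  destruct p as [x y]; simpl fst; simpl snd.
  assert (He : 0 < eps / 2) by (apply is_pos_div_2).
  assert (Hx' : locally (x, y) (fun q => Rabs (fx q - fx (x, y)) < eps / 2)).
  { apply (Hx (fun z => Rabs (z - fx (x, y)) < eps / 2)).
    exists (mkposreal _ He). intros z Hz. exact Hz. }
  assert (Hy' : locally (x, y) (fun q => Rabs (fy q - fy (x, y)) < eps / 2)).
  { apply (Hy (fun z => Rabs (z - fy (x, y)) < eps / 2)).
    exists (mkposreal _ He). intros z Hz. exact Hz. }
  pose proof (filter_and _ _ (filter_and _ _ H1 H2) (filter_and _ _ Hx' Hy')) as HH.
  apply locally_near2 in HH. destruct HH as (d & Hd & HH). apply locally_near2. exists d. split; auto.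
  intros [u v] [Hu Hv]. simpl in Hu, Hv. simpl fst; simpl snd.
  destruct (MVT_gen (fun t => f (t, v)) x u (fun t => fx (t, v))) as (xi & Hxi & Exi).
  { intros t Ht. assert (N : near2 (x, y) d (t, v)).
    { split; simpl; auto. apply between_near with u; auto; lra. }
    exact (proj1 (proj1 (HH _ N))). }
  { intros t Ht. assert (N : near2 (x, y) d (t, v)).
    { split; simpl; auto. apply between_near with u; auto; lra. }
    pose proof (proj1 (proj1 (HH _ N))) as K. simpl in K.
    apply continuity_pt_filterlim. apply (ex_derive_continuous (fun t => f (t, v))).
    eexists; exact K. }
  destruct (MVT_gen (fun t => f (x, t)) y v (fun t => fy (x, t))) as (et & Het & Eet).
  { intros t Ht. assert (N : near2 (x, y) d (x, t)).
    { split; simpl. rewrite Rminus_diag, Rabs_R0; auto. apply between_near with v; auto; lra. }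
    exact (proj2 (proj1 (HH _ N))). }
  { intros t Ht. assert (N : near2 (x, y) d (x, t)).
    { split; simpl. rewrite Rminus_diag, Rabs_R0; auto. apply between_near with v; auto; lra. }
    pose proof (proj2 (proj1 (HH _ N))) as K. simpl in K.
    apply continuity_pt_filterlim. apply (ex_derive_continuous (fun t => f (x, t))).
    eexists; exact K. }
  assert (N1 : near2 (x, y) d (xi, v)).
  { split; simpl; auto. apply between_near with u; auto; lra. }
  assert (N2 : near2 (x, y) d (x, et)).
  { split; simpl. rewrite Rminus_diag, Rabs_R0; auto. apply between_near with v; auto; lra. }
  pose proof (proj1 (proj2 (HH _ N1))) as K1.
  pose proof (proj2 (proj2 (HH _ N2))) as K2.
  change (f (u, v) - f (x, v) = fx (xi, v) * (u - x)) in Exi.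
  change (f (x, v) - f (x, y) = fy (x, et) * (v - y)) in Eet.
  change (Rabs (f (u, v) - f (x, y) - (fx (x, y) * (u - x) + fy (x, y) * (v - y)))
    <= eps * Rmax (Rabs (u - x)) (Rabs (v - y))).
  replace (f (u, v) - f (x, y) - (fx (x, y) * (u - x) + fy (x, y) * (v - y)))
    with ((fx (xi, v) - fx (x, y)) * (u - x) + (fy (x, et) - fy (x, y)) * (v - y))
    by (replace (f (u, v) - f (x, y)) with ((f (u, v) - f (x, v)) + (f (x, v) - f (x, y))) by ring;
        rewrite Exi, Eet; ring).
  eapply Rle_trans. apply Rabs_triang. rewrite !Rabs_mult.
  pose proof (Rmax_l (Rabs (u - x)) (Rabs (v - y))).
  pose proof (Rmax_r (Rabs (u - x)) (Rabs (v - y))).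
  pose proof (Rabs_pos (u - x)). pose proof (Rabs_pos (v - y)).
  pose proof (Rabs_pos (fx (xi, v) - fx (x, y))). pose proof (Rabs_pos (fy (x, et) - fy (x, y))).
  change (Rabs (fx (xi, v) - fx (x, y)) < eps / 2) in K1.
  change (Rabs (fy (x, et) - fy (x, y)) < eps / 2) in K2.
  apply Rle_trans with (eps / 2 * Rmax (Rabs (u - x)) (Rabs (v - y)) +
     eps / 2 * Rmax (Rabs (u - x)) (Rabs (v - y))); [|lra].
  apply Rplus_le_compat; apply Rmult_le_compat; lra.
Qed.

Lemma smooth2_on_smooth_at U f : smooth2_on U f ->
  forall p, locally p U -> smooth_at f p.
Proof.
  (* The empty word is generalized to an arbitrary [w], so that the induction hypothesis also covers
     the words [b :: w] that name its partial derivatives. *)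
  intros H p Hp n. change f with (iterpd nil f). generalize (@nil bool) as w. revert p Hp.
  induction n as [|n IH]; intros p Hp w.
  - apply locally_at_point in Hp. apply (H w p Hp).
  - exists (iterpd (true :: w) f), (iterpd (false :: w) f). split; [|split; apply IH; auto].
    apply locally_locally in Hp. revert Hp. apply filter_imp. intros q Hq.
    apply has_gradient_of_partials.
    + revert Hq. apply filter_imp. intros r Hr. simpl. unfold pd.
      apply Derive_correct. apply (H w r Hr).
    + revert Hq. apply filter_imp. intros r Hr. simpl. unfold pd.
      apply Derive_correct. apply (H w r Hr).
    + apply locally_at_point in Hq. apply (H (true :: w) q Hq).
    + apply locally_at_point in Hq. apply (H (false :: w) q Hq).
Qed.

(** * Closure of smooth functions under algebra and composition *)

Lemma has_gradient_comp F G1 G2 p a b a1 b1 a2 b2 :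
  has_gradient F (G1 p, G2 p) a b -> has_gradient G1 p a1 b1 -> has_gradient G2 p a2 b2 ->
  has_gradient (fun q => F (G1 q, G2 q)) p (a * a1 + b * a2) (a * b1 + b * b2).
Proof.
  destruct p as [x y]. intros H H1 H2. unfold has_gradient; simpl.
  apply (differentiable_pt_lim_comp (fun u v => F (u, v)) (fun x y => G1 (x, y)) (fun x y => G2 (x, y)));
  assumption.
Qed.

Lemma continuous_pair (G1 G2 : R * R -> R) p :
  continuous G1 p -> continuous G2 p -> continuous (fun q => (G1 q, G2 q)) p.
Proof.
  intros H1 H2. unfold continuous.
  intros P [e HP]. pose proof (H1 (fun z => ball (G1 p) e z) (locally_ball _ e)) as L1.
  pose proof (H2 (fun z => ball (G2 p) e z) (locally_ball _ e)) as L2.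
  unfold filtermap in *. generalize (filter_and _ _ L1 L2). apply filter_imp.
  intros q [A B]. apply HP. split; assumption.
Qed.

Lemma of_class_const n : forall c p, of_class n (fun _ => c) p.
Proof.
  induction n as [|n IH]; intros c p.
  - apply continuous_const.
  - exists (fun _ => 0), (fun _ => 0). split; [|split; apply IH].
    apply filter_forall. intros q eps. exists eps. intros u v _ _.
    match goal with |- Rabs ?e <= _ => replace e with 0 by ring end.
    rewrite Rabs_R0. apply Rmult_le_pos. left; apply cond_pos.
    eapply Rle_trans; [apply Rabs_pos | apply Rmax_l].
Qed.

Lemma has_gradient_lin a b p : has_gradient (fun q => a * fst q + b * snd q) p a b.
Proof.
  intros eps. exists eps. intros u v _ _. simpl.
  match goal with |- Rabs ?e <= _ => replace e with 0 by ring end.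
  rewrite Rabs_R0. apply Rmult_le_pos. left; apply cond_pos.
  eapply Rle_trans; [apply Rabs_pos | apply Rmax_l].
Qed.

Lemma of_class_lin a b n p : of_class n (fun q => a * fst q + b * snd q) p.
Proof.
  destruct n as [|n].
  - eapply has_gradient_continuous, has_gradient_lin.
  - exists (fun _ => a), (fun _ => b). split; [|split; apply of_class_const].
    apply filter_forall. intros q. apply has_gradient_lin.
Qed.

Lemma has_gradient_mul p : has_gradient (fun q => fst q * snd q) p (snd p) (fst p).
Proof.
  destruct p as [x y]. simpl. intros eps. exists eps. intros u v Hu Hv. simpl.
  replace (u * v - x * y - (y * (u - x) + x * (v - y))) with ((u - x) * (v - y)) by ring.
  rewrite Rabs_mult. apply Rmult_le_compat; try apply Rabs_pos; [left; exact Hu | apply Rmax_r].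
Qed.

Lemma has_gradient_plus f g p a b c d : has_gradient f p a b -> has_gradient g p c d -> has_gradient (fun q => f q + g q) p (a + c) (b + d).
Proof.
  intros Hf Hg. replace (a + c) with (1 * a + 1 * c) by ring. replace (b + d) with (1 * b + 1 * d) by ring.
  apply has_gradient_ext_loc with (fun q => 1 * f q + 1 * g q).
  - apply filter_forall. intros q. ring.
  - apply (has_gradient_comp (fun q => 1 * fst q + 1 * snd q)); auto. apply has_gradient_lin.
Qed.

Lemma has_gradient_mult f g p a b c d : has_gradient f p a b -> has_gradient g p c d ->
  has_gradient (fun q => f q * g q) p (g p * a + f p * c) (g p * b + f p * d).
Proof.
  intros Hf Hg.
  apply (has_gradient_comp (fun q => fst q * snd q)); auto. apply (has_gradient_mul (f p, g p)).
Qed.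

Lemma of_class_plus n : forall f g p, of_class n f p -> of_class n g p -> of_class n (fun q => f q + g q) p.
Proof.
  induction n as [|n IH]; intros f g p Hf Hg.
  - apply (continuous_plus f g); assumption.
  - destruct Hf as (fx & fy & Df & Fx & Fy). destruct Hg as (gx & gy & Dg & Gx & Gy).
    exists (fun q => fx q + gx q), (fun q => fy q + gy q). split; [|split; apply IH; auto].
    generalize (filter_and _ _ Df Dg). apply filter_imp. intros q [A B]. apply has_gradient_plus; auto.
Qed.

Lemma of_class_mult n : forall f g p, of_class n f p -> of_class n g p -> of_class n (fun q => f q * g q) p.
Proof.
  induction n as [|n IH]; intros f g p Hf Hg.
  - apply (continuous_mult f g); assumption.
  - pose proof (of_class_S _ _ _ Hf) as Hf'. pose proof (of_class_S _ _ _ Hg) as Hg'.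
    destruct Hf as (fx & fy & Df & Fx & Fy). destruct Hg as (gx & gy & Dg & Gx & Gy).
    exists (fun q => g q * fx q + f q * gx q), (fun q => g q * fy q + f q * gy q).
    split; [|split; apply of_class_plus; apply IH; auto].
    generalize (filter_and _ _ Df Dg). apply filter_imp. intros q [A B]. apply has_gradient_mult; auto.
Qed.

Lemma of_class_comp n : forall F G1 G2 p, of_class n F (G1 p, G2 p) -> of_class n G1 p -> of_class n G2 p ->
  of_class n (fun q => F (G1 q, G2 q)) p.
Proof.
  induction n as [|n IH]; intros F G1 G2 p HF H1 H2.
  - simpl in *. unfold continuous.
    apply filterlim_comp with (locally (G1 p, G2 p)). apply continuous_pair; auto. exact HF.
  - pose proof (of_class_S _ _ _ H1) as H1'. pose proof (of_class_S _ _ _ H2) as H2'.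
    pose proof (of_class_continuous _ _ _ H1) as c1. pose proof (of_class_continuous _ _ _ H2) as c2.
    destruct HF as (fx & fy & Df & Fx & Fy). destruct H1 as (gx & gy & Dg & Gx & Gy).
    destruct H2 as (hx & hy & Dh & Hx & Hy).
    exists (fun q => fx (G1 q, G2 q) * gx q + fy (G1 q, G2 q) * hx q),
           (fun q => fx (G1 q, G2 q) * gy q + fy (G1 q, G2 q) * hy q).
    split; [|split; apply of_class_plus; apply of_class_mult; auto].
    pose proof (continuous_pair _ _ _ c1 c2 _ Df) as L.
    unfold filtermap in L.
    generalize (filter_and _ _ L (filter_and _ _ Dg Dh)). apply filter_imp.
    intros q (A & B & C). apply has_gradient_comp; auto.
Qed.

Section Closure.
Implicit Types (f g : R * R -> R) (p : R * R).
Lemma smooth_at_const c p : smooth_at (fun _ => c) p.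
Proof. intros n. apply of_class_const. Qed.
Lemma smooth_at_fst p : smooth_at (fun q => fst q) p.
Proof.
  apply smooth_at_ext_loc with (fun q => 1 * fst q + 0 * snd q).
  apply filter_forall. intros q. ring. intros n. apply of_class_lin.
Qed.
Lemma smooth_at_snd p : smooth_at (fun q => snd q) p.
Proof.
  apply smooth_at_ext_loc with (fun q => 0 * fst q + 1 * snd q).
  apply filter_forall. intros q. ring. intros n. apply of_class_lin.
Qed.
Lemma smooth_at_plus f g p : smooth_at f p -> smooth_at g p -> smooth_at (fun q => f q + g q) p.
Proof. intros H K n. apply of_class_plus; auto. Qed.
Lemma smooth_at_mult f g p : smooth_at f p -> smooth_at g p -> smooth_at (fun q => f q * g q) p.
Proof. intros H K n. apply of_class_mult; auto. Qed.
Lemma smooth_at_opp f p : smooth_at f p -> smooth_at (fun q => - f q) p.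
Proof.
  intros H. apply smooth_at_ext_loc with (fun q => (-1) * f q).
  apply filter_forall. intros q. ring. apply smooth_at_mult; auto. apply smooth_at_const.
Qed.
Lemma smooth_at_minus f g p : smooth_at f p -> smooth_at g p -> smooth_at (fun q => f q - g q) p.
Proof. intros H K. apply smooth_at_plus; auto. apply smooth_at_opp; auto. Qed.
Lemma smooth_at_pow f p n : smooth_at f p -> smooth_at (fun q => f q ^ n) p.
Proof.
  intros H. induction n as [|n IH]; simpl. apply smooth_at_const. apply smooth_at_mult; auto.
Qed.
Lemma smooth_at_comp F (G1 G2 : R * R -> R) p :
  smooth_at F (G1 p, G2 p) -> smooth_at G1 p -> smooth_at G2 p ->
  smooth_at (fun q => F (G1 q, G2 q)) p.
Proof. intros HF H1 H2 n. apply of_class_comp; auto. Qed.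
Lemma smooth_at_comp1 (h : R -> R) f p :
  smooth1_at h (f p) -> smooth_at f p -> smooth_at (fun q => h (f q)) p.
Proof.
  intros Hh Hf. apply (smooth_at_comp (fun q => h (fst q)) f (fun _ => 0)); auto.
  apply smooth_at_const.
Qed.
End Closure.

Section Closure1.
Implicit Types (f g : R -> R) (x : R).
Lemma smooth1_at_ext_loc f g x :
  locally x (fun t => f t = g t) -> smooth1_at f x -> smooth1_at g x.
Proof.
  intros H. apply smooth_at_ext_loc. apply locally_near1 in H. destruct H as (e & He & H).
  apply locally_near2. exists e. split; auto. intros q [Hq _]. apply H. exact Hq.
Qed.
Lemma smooth1_at_const c x : smooth1_at (fun _ => c) x.
Proof. exact (smooth_at_const c (x, 0)). Qed.
Lemma smooth1_at_id x : smooth1_at (fun t => t) x.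
Proof. exact (smooth_at_fst (x, 0)). Qed.
Lemma smooth1_at_plus f g x : smooth1_at f x -> smooth1_at g x -> smooth1_at (fun t => f t + g t) x.
Proof. exact (smooth_at_plus (fun p => f (fst p)) (fun p => g (fst p)) (x, 0)). Qed.
Lemma smooth1_at_mult f g x : smooth1_at f x -> smooth1_at g x -> smooth1_at (fun t => f t * g t) x.
Proof. exact (smooth_at_mult (fun p => f (fst p)) (fun p => g (fst p)) (x, 0)). Qed.
Lemma smooth1_at_opp f x : smooth1_at f x -> smooth1_at (fun t => - f t) x.
Proof. exact (smooth_at_opp (fun p => f (fst p)) (x, 0)). Qed.
Lemma smooth1_at_pow f x n : smooth1_at f x -> smooth1_at (fun t => f t ^ n) x.
Proof. exact (smooth_at_pow (fun p => f (fst p)) (x, 0) n). Qed.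
Lemma smooth1_at_comp f g x : smooth1_at f (g x) -> smooth1_at g x -> smooth1_at (fun t => f (g t)) x.
Proof. exact (smooth_at_comp1 f (fun p => g (fst p)) (x, 0)). Qed.
Lemma smooth1_at_curve (F : R * R -> R) f g x : smooth_at F (f x, g x) ->
  smooth1_at f x -> smooth1_at g x -> smooth1_at (fun t => F (f t, g t)) x.
Proof. exact (smooth_at_comp F (fun p => f (fst p)) (fun p => g (fst p)) (x, 0)). Qed.
End Closure1.

Lemma smooth1_at_is_derive f x : smooth1_at f x -> is_derive f x (Derive f x).
Proof.
  intros H. apply smooth_at_D2 in H. apply has_gradient_is_derive_x in H. simpl in H. exact H.
Qed.

Lemma smooth1_at_Derive f x : smooth1_at f x -> smooth1_at (Derive f) x.
Proof. intros H. exact (smooth_at_pd _ _ true H). Qed.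

Lemma smooth1_at_Derive_n f x n : smooth1_at f x -> smooth1_at (Derive_n f n) x.
Proof. intros H. induction n as [|n IH]; simpl. exact H. apply smooth1_at_Derive, IH. Qed.

Lemma smooth1_at_continuous f x : smooth1_at f x -> continuous f x.
Proof.
  intros H. apply (ex_derive_continuous f). eexists. apply smooth1_at_is_derive, H.
Qed.

Lemma smooth1_at_smooth1_on (U : R -> Prop) f :
  (forall x, U x -> smooth1_at f x) -> smooth1_on U f.
Proof.
  intros H n x Hx. destruct n as [|n]; simpl; auto.
  eexists. apply smooth1_at_is_derive, smooth1_at_Derive_n, H, Hx.
Qed.

Lemma has_gradient_fst (f : R -> R) (x y l : R) : is_derive f x l -> has_gradient (fun q => f (fst q)) (x, y) l 0.
Proof. intros H. exact (differentiable_pt_lim_proj1_0 f x y l (proj1 (is_derive_Reals f x l) H)). Qed.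

(** A sequence of functions each differentiating to the next suffices for smoothness, with no
    formula for iterated derivatives. It serves for [exp], for the integrals of Hadamard's lemma and
    for the function glued at 0 in Whitney's theorem. *)
Lemma chain_smooth1_at (U : R -> Prop) (D : nat -> R -> R) :
  (forall n x, U x -> is_derive (D n) x (D (S n) x)) ->
  forall k x, locally x U -> smooth1_at (D k) x.
Proof.
  (* The second coordinate [y] has to be free, because the induction visits neighbouring points of
     the plane. *)
  intros H k x Hx n. revert k x Hx. cut (forall k x y, locally x U -> of_class n (fun q => D k (fst q)) (x, y)).
  { intros K k x Hx. apply K, Hx. }
  induction n as [|n IH]; intros k x y Hx.
  - apply locally_at_point in Hx. eapply has_gradient_continuous, has_gradient_fst, H, Hx.
  - exists (fun q => D (S k) (fst q)), (fun _ => 0). split; [|split; [apply IH, Hx | apply of_class_const]].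
    apply locally_near1 in Hx. destruct Hx as (e & He & Hx). apply locally_near2. exists e. split; auto.
    intros [u v] [Hu _]. apply has_gradient_fst, H, Hx, Hu.
Qed.

Lemma smooth1_on_smooth1_at U f : smooth1_on U f -> forall x, locally x U -> smooth1_at f x.
Proof.
  intros H x Hx. apply (fun K => chain_smooth1_at U (Derive_n f) K O x); auto.
  intros n t Ht. simpl. apply Derive_correct. apply (H (S n) t Ht).
Qed.

Lemma of_class_inv n : forall x y, x <> 0 -> of_class n (fun q => / fst q) (x, y).
Proof.
  induction n as [|n IH]; intros x y Hx.
  - eapply has_gradient_continuous, has_gradient_fst, is_derive_inv; auto. apply (is_derive_id x).
  - exists (fun q => (-1) * (/ fst q * / fst q)), (fun _ => 0). split; [|split; [|apply of_class_const]].
    + assert (Hp : 0 < Rabs x) by (apply Rabs_pos_lt; auto).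
      apply locally_near2. exists (Rabs x). split; auto. intros [u v] [Hu _]. simpl in *.
      assert (u <> 0). { intros ->. rewrite Rminus_0_l, Rabs_Ropp in Hu. lra. }
      apply has_gradient_fst. auto_derive; auto. field; auto.
    + apply of_class_mult. apply of_class_const. apply of_class_mult; apply IH; auto.
Qed.

Lemma smooth1_at_inv x : x <> 0 -> smooth1_at (fun t => / t) x.
Proof. intros H n. apply of_class_inv, H. Qed.

Lemma smooth1_at_exp x : smooth1_at exp x.
Proof.
  apply (fun H => chain_smooth1_at (fun _ => True) (fun _ => exp) H O x).
  intros _ t _. apply is_derive_Reals, derivable_pt_lim_exp. apply filter_forall; auto.
Qed.

Lemma locally_pos x : 0 < x -> locally x (fun t => 0 < t).
Proof.
  intros H. apply locally_near1. exists x. split; auto. intros q Hq. unfold near1 in Hq.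
  apply Rabs_def2 in Hq. lra.
Qed.

Lemma smooth1_at_ln x : 0 < x -> smooth1_at ln x.
Proof.
  intros Hx [|n].
  - eapply has_gradient_continuous, has_gradient_fst, is_derive_ln, Hx.
  - exists (fun q => / fst q), (fun _ => 0). split; [|split; [apply of_class_inv; lra|apply of_class_const]].
    apply locally_near2. exists x. split; auto. intros [u v] [Hu _]. simpl in *. apply Rabs_def2 in Hu.
    apply has_gradient_fst, is_derive_ln. lra.
Qed.

Lemma smooth1_at_Rpower a x : 0 < x -> smooth1_at (fun t => Rpower t a) x.
Proof.
  intros Hx. unfold Rpower. apply (smooth1_at_comp exp). apply smooth1_at_exp.
  apply smooth1_at_mult. apply smooth1_at_const. apply smooth1_at_ln, Hx.
Qed.

Lemma smooth_at_inv f p : f p <> 0 -> smooth_at f p -> smooth_at (fun q => / f q) p.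
Proof. intros H Hf. apply (smooth_at_comp1 Rinv); auto. apply smooth1_at_inv, H. Qed.
(** * The inverse function theorem in the second variable *)

Lemma near2_center p e : 0 < e -> near2 p e p.
Proof. intros He. split; rewrite Rminus_diag, Rabs_R0; exact He. Qed.

Lemma near2_open p e q : near2 p e q -> locally q (near2 p e).
Proof.
  intros [H1 H2]. apply locally_near2.
  exists (Rmin (e - Rabs (fst q - fst p)) (e - Rabs (snd q - snd p))). split.
  - apply Rmin_glb_lt; lra.
  - intros r [A B]. pose proof (Rlt_le_trans _ _ _ A (Rmin_l _ _)).
    pose proof (Rlt_le_trans _ _ _ B (Rmin_r _ _)). split.
    + replace (fst r - fst p) with ((fst r - fst q) + (fst q - fst p)) by ring.
      eapply Rle_lt_trans; [apply Rabs_triang|lra].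
    + replace (snd r - snd p) with ((snd r - snd q) + (snd q - snd p)) by ring.
      eapply Rle_lt_trans; [apply Rabs_triang|lra].
Qed.

Lemma continuous_close f (p : R * R) e : 0 < e -> continuous f p ->
  locally p (fun q => Rabs (f q - f p) < e).
Proof.
  intros He H. apply (H (fun z => Rabs (z - f p) < e)).
  exists (mkposreal _ He). intros z Hz. exact Hz.
Qed.

Lemma of_class_div n f g p : g p <> 0 -> of_class n f p -> of_class n g p -> of_class n (fun q => f q / g q) p.
Proof.
  intros H Hf Hg. apply (of_class_mult n f (fun q => / g q)); auto.
  apply (of_class_comp n (fun q => / fst q) g (fun _ => 0)); auto. apply of_class_inv, H. apply of_class_const.
Qed.

(** Dividing the expansion of G at (x, Y p) by b gives that of Y, except that the error is measured
    by the increment of Y itself; the Lipschitz bound turns it into an error in the variables of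
    Y. *)
Lemma partial_inverse_D2 G Y (p : R * R) a b L :
  has_gradient G (fst p, Y p) a b -> 0 < b -> 0 <= L ->
  locally p (fun q => G (fst q, Y q) = snd q) ->
  locally p (fun q => Rabs (Y q - Y p) <= L * Rmax (Rabs (fst q - fst p)) (Rabs (snd q - snd p))) ->
  has_gradient Y p (- a / b) (1 / b).
Proof.
  intros HG Hb HL HE HLip eps. apply locally_2d_locally.
  (* Two losses are anticipated: the factor 1 + L from the Lipschitz bound and the final division by
     b. *)
  assert (He : 0 < eps * b / (1 + L)).
  { apply Rdiv_lt_0_compat; [|lra]. apply Rmult_lt_0_compat; [apply cond_pos|lra]. }
  destruct (HG (mkposreal _ He)) as [d Hd]. simpl in Hd.
  apply locally_near2 in HE, HLip. destruct HE as (e1 & He1 & HE). destruct HLip as (e2 & He2 & HLip).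
  destruct p as [x z]. simpl fst in *; simpl snd in *.
  apply locally_near2. exists (Rmin (Rmin e1 e2) (d / (1 + L))). split.
  { repeat apply Rmin_glb_lt; auto. apply Rdiv_lt_0_compat; [apply cond_pos|lra]. }
  intros [u w] [Hu Hw]. simpl in Hu, Hw.
  change (Rabs (Y (u, w) - Y (x, z) - (- a / b * (u - x) + 1 / b * (w - z))) <=
    eps * Rmax (Rabs (u - x)) (Rabs (w - z))).
  assert (N1 : near2 (x, z) e1 (u, w)).
  { split; simpl; eapply Rlt_le_trans; eauto; eapply Rle_trans; [apply Rmin_l|apply Rmin_l|apply Rmin_l|apply Rmin_l]. }
  assert (N2 : near2 (x, z) e2 (u, w)).
  { split; simpl; eapply Rlt_le_trans; eauto; eapply Rle_trans; [apply Rmin_l|apply Rmin_r|apply Rmin_l|apply Rmin_r]. }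
  pose proof (Rlt_le_trans _ _ _ Hu (Rmin_r _ _)) as Hu'.
  pose proof (Rlt_le_trans _ _ _ Hw (Rmin_r _ _)) as Hw'.
  pose proof (HE _ N1) as E1. pose proof (HE _ (near2_center (x, z) e1 He1)) as E0.
  pose proof (HLip _ N2) as E2. simpl in E0, E1, E2.
  set (m := Rmax (Rabs (u - x)) (Rabs (w - z))) in *.
  assert (Hm : 0 <= m) by (eapply Rle_trans; [apply Rabs_pos|apply Rmax_l]).
  assert (Hmd : m < d / (1 + L)) by (unfold m; apply Rmax_lub_lt; auto).
  assert (Hmd' : (1 + L) * m < d).
  { apply Rmult_lt_compat_l with (r := 1 + L) in Hmd; [|lra].
    replace ((1 + L) * (d / (1 + L))) with (pos d) in Hmd by (field; lra). exact Hmd. }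
  assert (HLm : 0 <= L * m) by (apply Rmult_le_pos; auto).
  specialize (Hd u (Y (u, w))).
  pose proof (Rmax_l (Rabs (u - x)) (Rabs (w - z))) as M1. fold m in M1.
  assert (A1 : Rabs (u - x) < d) by lra.
  assert (A2 : Rabs (Y (u, w) - Y (x, z)) < d) by lra.
  specialize (Hd A1 A2). rewrite E1, E0 in Hd.
  assert (B : Rmax (Rabs (u - x)) (Rabs (Y (u, w) - Y (x, z))) <= (1 + L) * m) by (apply Rmax_lub; lra).
  assert (Hd' : Rabs (w - z - (a * (u - x) + b * (Y (u, w) - Y (x, z)))) <= eps * b * m).
  { eapply Rle_trans; [exact Hd|]. replace (eps * b * m) with (eps * b / (1 + L) * ((1 + L) * m)) by (field; lra).
    apply Rmult_le_compat_l; lra. }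
  replace (Y (u, w) - Y (x, z) - (- a / b * (u - x) + 1 / b * (w - z)))
    with (- / b * (w - z - (a * (u - x) + b * (Y (u, w) - Y (x, z))))) by (field; lra).
  rewrite Rabs_mult, Rabs_Ropp, Rabs_pos_eq by (left; apply Rinv_0_lt_compat; auto).
  replace (eps * m) with (/ b * (eps * b * m)) by (field; lra).
  apply Rmult_le_compat_l; auto. left; apply Rinv_0_lt_compat; auto.
Qed.

(** Bootstrap: the gradient of Y is a rational expression in the derivatives of G at (x, Y), so
    class n of Y gives class n of its gradient, that is, class n + 1 of Y. *)
Lemma partial_inverse_smooth G Y (V : R * R -> Prop) :
  (forall q, V q -> locally q V) ->
  (forall q, V q -> smooth_at G (fst q, Y q) /\ 0 < pd false G (fst q, Y q)) ->
  (forall q, V q -> has_gradient Y q (- pd true G (fst q, Y q) / pd false G (fst q, Y q))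
                       (1 / pd false G (fst q, Y q))) ->
  forall q, V q -> smooth_at Y q.
Proof.
  intros Ho HG HD q Hq n. revert q Hq. induction n as [|n IH]; intros q Hq.
  - eapply has_gradient_continuous, HD, Hq.
  - exists (fun q => - pd true G (fst q, Y q) / pd false G (fst q, Y q)),
           (fun q => 1 / pd false G (fst q, Y q)).
    destruct (HG q Hq) as [S P].
    assert (Hpd : forall b, of_class n (fun q => pd b G (fst q, Y q)) q).
    { intros b. apply (of_class_comp n (pd b G) (fun q => fst q) Y).
      apply smooth_at_pd, S. apply smooth_at_fst. apply IH, Hq. }
    split; [|split].
    + generalize (Ho q Hq). apply filter_imp. exact HD.
    + apply (of_class_div n (fun q => - pd true G (fst q, Y q))). lra.
      2: apply Hpd.
      apply of_class_ext_loc with (fun q => (-1) * pd true G (fst q, Y q)).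
      apply filter_forall. intros r. ring.
      apply of_class_mult. apply of_class_const. apply Hpd.
    + apply (of_class_div n (fun _ => 1)). lra. apply of_class_const. apply Hpd.
Qed.

(** This inverts the map (x, y) -> (x, G(x, y)). The triangular case is enough: the one plane map of
    the reduction without an explicit inverse keeps x fixed, and the inverse function theorem on the
    line is the case of a G depending on y alone. *)
Theorem inverse_in_second_variable (G : R * R -> R) (x0 y0 : R) :
  locally (x0, y0) (smooth_at G) -> 0 < pd false G (x0, y0) ->
  exists Y : R * R -> R, Y (x0, G (x0, y0)) = y0 /\
    locally (x0, G (x0, y0)) (fun q => smooth_at Y q /\ G (fst q, Y q) = snd q) /\
    locally (x0, y0) (fun p => Y (fst p, G p) = snd p).
Proof.
  intros HG Hpos. set (p0 := (x0, y0)) in *. set (z0 := G p0).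
  set (c := pd false G p0 / 2). assert (Hc : 0 < c) by (unfold c; lra).
  set (K := Rabs (pd true G p0) + 1). assert (HK : 0 < K) by (unfold K; pose proof (Rabs_pos (pd true G p0)); lra).
  assert (HH : locally p0 (fun q => smooth_at G q /\ c <= pd false G q /\ Rabs (pd true G q) <= K)).
  { pose proof (locally_at_point _ _ _ HG) as S0.
    pose proof (continuous_close _ _ c Hc (smooth_at_continuous _ _ (smooth_at_pd _ _ false S0))) as L1.
    pose proof (continuous_close _ _ 1 Rlt_0_1 (smooth_at_continuous _ _ (smooth_at_pd _ _ true S0))) as L2.
    generalize (filter_and _ _ HG (filter_and _ _ L1 L2)). apply filter_imp.
    intros q (A & B & C). split; auto. split.
    - apply Rabs_def2 in B. unfold c in *. lra.
    - unfold K. replace (pd true G q) with ((pd true G q - pd true G p0) + pd true G p0) by ring.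
      eapply Rle_trans; [apply Rabs_triang|lra]. }
  apply locally_near2 in HH. destruct HH as (d & Hd & HH).
  assert (Hmono : forall x y y', near2 p0 d (x, y) -> near2 p0 d (x, y') ->
    y < y' -> c * (y' - y) <= G (x, y') - G (x, y)).
  { intros x y y' N N' Hy.
    assert (Nt : forall t, y <= t <= y' -> near2 p0 d (x, t)).
    { intros t Ht. destruct N as [N1 N2], N' as [N1' N2']. split; auto. simpl in *.
      apply Rabs_def2 in N2. apply Rabs_def2 in N2'. apply Rabs_def1; lra. }
    destruct (MVT_gen (fun t => G (x, t)) y y' (fun t => pd false G (x, t))) as (xi & Hxi & E).
    - intros t Ht. rewrite Rmin_left, Rmax_right in Ht by lra.
      eapply has_gradient_is_derive_y, smooth_at_D2, (HH (x, t)), Nt; lra.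
    - intros t Ht. rewrite Rmin_left, Rmax_right in Ht by lra.
      apply continuity_pt_filterlim. apply (ex_derive_continuous (fun t => G (x, t))).
      eexists. eapply has_gradient_is_derive_y, smooth_at_D2, (HH (x, t)), Nt; lra.
    - rewrite Rmin_left, Rmax_right in Hxi by lra.
      change (G (x, y') - G (x, y) = pd false G (x, xi) * (y' - y)) in E. rewrite E.
      apply Rmult_le_compat_r. lra. apply (HH (x, xi)), Nt; lra. }
  assert (Habs : forall x y y', near2 p0 d (x, y) -> near2 p0 d (x, y') ->
    c * Rabs (y' - y) <= Rabs (G (x, y') - G (x, y))).
  { intros x y y' N N'. destruct (Rtotal_order y y') as [H|[H|H]].
    - pose proof (Hmono x y y' N N' H). assert (0 < c * (y' - y)) by (apply Rmult_lt_0_compat; lra).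
      rewrite !Rabs_pos_eq; lra.
    - subst. rewrite !Rminus_diag, Rabs_R0. lra.
    - pose proof (Hmono x y' y N' N H). assert (0 < c * (y - y')) by (apply Rmult_lt_0_compat; lra).
      rewrite (Rabs_minus_sym y'), (Rabs_minus_sym (G (x, y'))). rewrite !Rabs_pos_eq; lra. }
  assert (Hlip : forall x x' y, near2 p0 d (x, y) -> near2 p0 d (x', y) ->
    Rabs (G (x', y) - G (x, y)) <= K * Rabs (x' - x)).
  { intros x x' y N N'.
    assert (Nt : forall t, Rmin x x' <= t <= Rmax x x' -> near2 p0 d (t, y)).
    { intros t Ht. destruct N as [N1 N2], N' as [N1' N2']. split; auto. simpl in *.
      apply Rabs_def2 in N1. apply Rabs_def2 in N1'. revert Ht. unfold Rmin, Rmax.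
      destruct (Rle_dec x x'); intros; apply Rabs_def1; lra. }
    destruct (MVT_gen (fun t => G (t, y)) x x' (fun t => pd true G (t, y))) as (xi & Hxi & E).
    - intros t Ht. eapply has_gradient_is_derive_x, smooth_at_D2, (HH (t, y)), Nt; lra.
    - intros t Ht. apply continuity_pt_filterlim. apply (ex_derive_continuous (fun t => G (t, y))).
      eexists. eapply has_gradient_is_derive_x, smooth_at_D2, (HH (t, y)), Nt; lra.
    - change (G (x', y) - G (x, y) = pd true G (xi, y) * (x' - x)) in E. rewrite E, Rabs_mult.
      apply Rmult_le_compat_r. apply Rabs_pos. apply (HH (xi, y)), Nt; lra. }
  set (de := d / 2). assert (Hde : 0 < de < d) by (unfold de; lra).
  (* For x and z within r of their centres, z differs from G (x, y0) by at most (K + 1) r, while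
     moving y by de changes G by at least c de. The denominator K + 2 makes the comparison strict,
     so z lies between the values of G at y0 - de and y0 + de. *)
  set (r := Rmin d (c * de / (K + 2))).
  assert (Hr : 0 < r).
  { apply Rmin_glb_lt; auto. apply Rdiv_lt_0_compat; [apply Rmult_lt_0_compat|]; lra. }
  assert (Hrd : r <= d) by apply Rmin_l.
  assert (HrK : (K + 1) * r < c * de).
  { assert (r <= c * de / (K + 2)) as H by apply Rmin_r.
    apply Rmult_le_compat_l with (r := K + 2) in H; [|lra].
    replace ((K + 2) * (c * de / (K + 2))) with (c * de) in H by (field; lra). lra. }
  set (V := near2 (x0, z0) r).
  (* The membership in V is kept inside the existential, so that a dummy y exists outside V and
     choice yields a total function. *)
  assert (Hex : forall q, exists y, V q -> Rabs (y - y0) <= de /\ G (fst q, y) = snd q).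
  { intros [x z]. destruct (excluded_middle_informative (V (x, z))) as [Hv|Hv]; [|exists 0; tauto].
    destruct Hv as [Hx Hz]. simpl in Hx, Hz.
    assert (Nt : forall t, Rabs (t - y0) <= de -> near2 p0 d (x, t)) by (intros t Ht; split; simpl; lra).
    assert (N0 : near2 p0 d (x, y0)) by (apply Nt; rewrite Rminus_diag, Rabs_R0; lra).
    pose proof (Hlip x0 x y0 (near2_center _ _ Hd) N0) as L.
    assert (K * Rabs (x - x0) <= K * r) by (apply Rmult_le_compat_l; lra).
    change (Rabs (G (x, y0) - z0) <= K * Rabs (x - x0)) in L.
    assert (Np : near2 p0 d (x, y0 + de)).
    { apply Nt. replace (y0 + de - y0) with de by ring. rewrite Rabs_pos_eq; lra. }
    assert (Nm : near2 p0 d (x, y0 - de)).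
    { apply Nt. replace (y0 - de - y0) with (- de) by ring. rewrite Rabs_Ropp, Rabs_pos_eq; lra. }
    pose proof (Hmono x y0 (y0 + de) N0 Np ltac:(lra)) as M1.
    pose proof (Hmono x (y0 - de) y0 Nm N0 ltac:(lra)) as M2.
    replace (y0 + de - y0) with de in M1 by ring. replace (y0 - (y0 - de)) with de in M2 by ring.
    apply Rabs_def2 in Hz.
    assert (L' : - (K * r) <= G (x, y0) - z0 <= K * r) by (apply Rabs_le_between; lra).
    destruct (Ranalysis5.IVT_interv (fun t => G (x, t) - z) (y0 - de) (y0 + de)) as (y & Hy & E).
    - intros t Ht. apply continuity_pt_filterlim. apply (ex_derive_continuous (fun t => G (x, t) - z)).
      assert (N : near2 p0 d (x, t)) by (apply Nt, Rabs_le; lra).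
      eexists. apply (is_derive_minus (fun t => G (x, t)) (fun _ => z)). eapply has_gradient_is_derive_y, smooth_at_D2, (HH (x, t)), N.
      apply is_derive_const.
    - lra.
    - simpl in *. lra.
    - simpl in *. lra.
    - exists y. intros _. simpl in *. split; [apply Rabs_le|]; lra. }
  destruct (functional_choice _ Hex) as [Y HY].
  assert (NY : forall q, V q -> near2 p0 d (fst q, Y q)).
  { intros q Hq. destruct (HY q Hq) as [A B]. destruct Hq as [C _]. split; simpl in *; lra. }
  assert (Hinj : forall x y y', near2 p0 d (x, y) -> near2 p0 d (x, y') -> G (x, y) = G (x, y') -> y = y').
  { intros x y y' N N' E. pose proof (Habs x y y' N N') as A. rewrite E, Rminus_diag, Rabs_R0 in A.
    pose proof (Rabs_pos (y' - y)) as B. destruct (Req_dec y y') as [|Hn]; auto.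
    assert (0 < Rabs (y' - y)) as B' by (apply Rabs_pos_lt; lra).
    pose proof (Rmult_lt_0_compat _ _ Hc B'). lra. }
  assert (HVo : forall q, V q -> locally q V) by (intros q; apply near2_open).
  assert (HV0 : V (x0, z0)) by (apply near2_center, Hr).
  assert (HYl : forall q q', V q -> V q' ->
    Rabs (Y q' - Y q) <= (K + 1) / c * Rmax (Rabs (fst q' - fst q)) (Rabs (snd q' - snd q))).
  { intros [x z] [x' z'] Hq Hq'. pose proof (NY _ Hq) as N. pose proof (NY _ Hq') as N'.
    destruct (HY _ Hq) as [_ E]. destruct (HY _ Hq') as [_ E']. simpl in *.
    assert (Nx : near2 p0 d (x, Y (x', z'))).
    { destruct N as [N1 _], N' as [_ N2]. split; simpl in *; auto. }
    pose proof (Habs _ _ _ N Nx) as A. rewrite E in A.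
    pose proof (Hlip _ _ _ N' Nx) as B. rewrite E' in B.
    set (m := Rmax _ _).
    assert (m1 : Rabs (x' - x) <= m) by apply Rmax_l.
    assert (m2 : Rabs (z' - z) <= m) by apply Rmax_r.
    assert (B' : Rabs (G (x, Y (x', z')) - z) <= (K + 1) * m).
    { replace (G (x, Y (x', z')) - z) with ((G (x, Y (x', z')) - z') + (z' - z)) by ring.
      eapply Rle_trans; [apply Rabs_triang|].
      rewrite (Rabs_minus_sym x x') in B.
      assert (K * Rabs (x' - x) <= K * m) by (apply Rmult_le_compat_l; lra). lra. }
    apply Rmult_le_reg_l with c; auto. replace (c * ((K + 1) / c * m)) with ((K + 1) * m) by (field; lra).
    lra. }
  assert (HS : forall q, V q -> smooth_at Y q).
  { apply (partial_inverse_smooth G Y V HVo).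
    - intros q Hq. destruct (HH _ (NY q Hq)) as (S & P & _). split; auto. lra.
    - intros q Hq. destruct (HH _ (NY q Hq)) as (S & P & _).
      apply (partial_inverse_D2 G Y q) with (L := (K + 1) / c).
      + apply smooth_at_D2, S.
      + lra.
      + left. apply Rdiv_lt_0_compat; lra.
      + generalize (HVo q Hq). apply filter_imp. intros q' Hq'. apply (HY q' Hq').
      + generalize (HVo q Hq). apply filter_imp. intros q' Hq'. apply HYl; auto. }
  exists Y. split; [|split].
  - destruct (HY _ HV0) as [_ E]. apply (Hinj x0). exact (NY _ HV0). apply near2_center, Hd. exact E.
  - generalize (HVo _ HV0). apply filter_imp. intros q Hq. split. apply HS, Hq. apply (HY q Hq).
  - pose proof (continuous_close _ _ r Hr (smooth_at_continuous _ _ (locally_at_point _ _ _ HG))) as L.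
    apply locally_near2 in L. destruct L as (e & He & L).
    apply locally_near2. exists (Rmin e r). split. apply Rmin_glb_lt; auto.
    intros [x y] [A B]. simpl in A, B.
    pose proof (Rlt_le_trans _ _ _ A (Rmin_l _ _)) as A1. pose proof (Rlt_le_trans _ _ _ A (Rmin_r _ _)) as A2.
    pose proof (Rlt_le_trans _ _ _ B (Rmin_l _ _)) as B1. pose proof (Rlt_le_trans _ _ _ B (Rmin_r _ _)) as B2.
    assert (Hv : V (x, G (x, y))).
    { split; simpl; auto. apply (L (x, y)). split; simpl; auto. }
    destruct (HY _ Hv) as [_ E]. simpl in E |- *. apply (Hinj x).
    exact (NY _ Hv). split; simpl; lra. exact E.
Qed.

Theorem inverse_function_1d (f : R -> R) (x0 : R) :
  locally x0 (smooth1_at f) -> 0 < Derive f x0 ->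
  exists g : R -> R, g (f x0) = x0 /\
    locally (f x0) (fun z => smooth1_at g z /\ f (g z) = z) /\
    locally x0 (fun x => g (f x) = x).
Proof.
  intros Hf Hp.
  destruct (inverse_in_second_variable (fun p => f (snd p)) 0 x0) as (Y & Y0 & Y1 & Y2).
  - apply locally_near1 in Hf. destruct Hf as (e & He & Hf). apply locally_near2. exists e. split; auto.
    intros q [_ Hq]. apply smooth_at_comp1. apply Hf, Hq. apply smooth_at_snd.
  - exact Hp.
  - simpl in *. exists (fun z => Y (0, z)). split; [exact Y0|split].
    + apply locally_near2 in Y1. destruct Y1 as (e & He & Y1). apply locally_near1. exists e. split; auto.
      intros z Hz. destruct (Y1 (0, z)) as [A B].
      { split; simpl; auto. rewrite Rminus_diag, Rabs_R0; auto. }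
      split; auto. apply (smooth1_at_curve Y (fun _ => 0) (fun t => t)). exact A.
      apply smooth1_at_const. apply smooth1_at_id.
    + apply locally_near2 in Y2. destruct Y2 as (e & He & Y2). apply locally_near1. exists e. split; auto.
      intros x Hx. apply (Y2 (0, x)). split; simpl; auto. rewrite Rminus_diag, Rabs_R0; auto.
Qed.

(** * Hadamard's lemma and jets *)

Lemma near1_0 e : 0 < e -> near1 0 e 0.
Proof. intros H. unfold near1. rewrite Rminus_diag, Rabs_R0. exact H. Qed.

Lemma near1_open x e t : near1 x e t -> locally t (near1 x e).
Proof.
  intros H. unfold near1 in *. apply locally_near1. exists (e - Rabs (t - x)). split. lra.
  intros s Hs. unfold near1 in *. replace (s - x) with ((s - t) + (t - x)) by ring.
  eapply Rle_lt_trans; [apply Rabs_triang|lra].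
Qed.

Lemma is_RInt_pow n : is_RInt (fun u => u ^ n) 0 1 (/ INR (S n)).
Proof.
  assert (HS : INR (S n) <> 0) by (apply not_0_INR; lia).
  replace (/ INR (S n)) with (minus ((fun u => u ^ S n / INR (S n)) 1) ((fun u => u ^ S n / INR (S n)) 0)).
  - apply (is_RInt_derive (fun u => u ^ S n / INR (S n)) (fun u => u ^ n)).
    + intros x _. auto_derive; auto. change (match n with 0%nat => 1 | S _ => INR n + 1 end) with (INR (S n)).
      simpl pred. field; auto.
    + intros x _. apply (ex_derive_continuous (fun u => u ^ n)). auto_derive; auto.
  - unfold minus, plus, opp; simpl. rewrite pow1. change (match n with 0%nat => 1 | S _ => INR n + 1 end) with (INR (S n)). field; auto.
Qed.

Section Hadamard.
Variables (f : R -> R) (e : R).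
Hypothesis He : 0 < e.
Hypothesis Hf : forall t, near1 0 e t -> smooth1_at f t.

(** Hadamard's formula: f t - f 0 is t times the integral of f' (t u) over u in [0, 1]. Thus [I 0]
    is the quotient, and each differentiation under the integral brings out one more factor u, so
    that [I n] is its n-th derivative. *)
Let H n (p : R * R) := (snd p) ^ n * Derive_n f (S n) (fst p * snd p).
Let I n t := RInt (fun u => H n (t, u)) 0 1.

Lemma hadamard_dom t u : near1 0 e t -> 0 <= u <= 1 -> near1 0 e (t * u).
Proof.
  unfold near1. rewrite !Rminus_0_r. intros Ht Hu. rewrite Rabs_mult, (Rabs_pos_eq u) by lra.
  assert (Rabs t * u <= Rabs t * 1) by (apply Rmult_le_compat_l; [apply Rabs_pos|lra]). lra.
Qed.

Lemma hadamard_smooth n t u : near1 0 e t -> 0 <= u <= 1 -> smooth_at (H n) (t, u).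
Proof.
  intros Ht Hu. unfold H. apply smooth_at_mult. apply smooth_at_pow, smooth_at_snd.
  apply (smooth_at_comp1 (Derive_n f (S n)) (fun p => fst p * snd p)).
  - apply smooth1_at_Derive_n, Hf, hadamard_dom; auto.
  - apply smooth_at_mult. apply smooth_at_fst. apply smooth_at_snd.
Qed.

Lemma hadamard_ex_RInt n t : near1 0 e t -> ex_RInt (fun u => H n (t, u)) 0 1.
Proof.
  intros Ht. apply (ex_RInt_continuous (fun u => H n (t, u))). intros u Hu.
  rewrite Rmin_left, Rmax_right in Hu by lra.
  apply (ex_derive_continuous (fun u => H n (t, u))). eexists.
  eapply has_gradient_is_derive_y, smooth_at_D2, hadamard_smooth; auto.
Qed.

Lemma hadamard_pd n t u : near1 0 e t -> 0 <= u <= 1 -> pd true (H n) (t, u) = H (S n) (t, u).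
Proof.
  intros Ht Hu. unfold pd, H. simpl fst; simpl snd. apply is_derive_unique.
  replace (u ^ S n * Derive_n f (S (S n)) (t * u)) with (u ^ n * (u * Derive_n f (S (S n)) (t * u)))
    by (simpl; ring).
  apply (is_derive_scal (fun s => Derive_n f (S n) (s * u))).
  apply (is_derive_comp (Derive_n f (S n)) (fun s => s * u)).
  - apply smooth1_at_is_derive, smooth1_at_Derive_n, Hf, hadamard_dom; auto.
  - auto_derive; auto. ring.
Qed.

Lemma hadamard_derive n t : near1 0 e t -> is_derive (I n) t (I (S n) t).
Proof.
  intros Ht. unfold I.
  replace (RInt (fun u => H (S n) (t, u)) 0 1)
    with (RInt (fun u => Derive (fun s => H n (s, u)) t) 0 1).
  - apply (is_derive_RInt_param (fun t u => H n (t, u)) 0 1 t).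
    + generalize (near1_open _ _ _ Ht). apply filter_imp. intros s Hs u Hu.
      rewrite Rmin_left, Rmax_right in Hu by lra. eexists.
      eapply has_gradient_is_derive_x, smooth_at_D2, hadamard_smooth; auto.
    + intros u Hu. rewrite Rmin_left, Rmax_right in Hu by lra.
      apply continuity_2d_pt_filterlim.
      pose proof (smooth_at_continuous _ _ (smooth_at_pd _ _ true (hadamard_smooth n t u Ht Hu))) as K.
      exact K.
    + generalize (near1_open _ _ _ Ht). apply filter_imp. intros s Hs. apply hadamard_ex_RInt, Hs.
  - apply RInt_ext. intros u Hu. rewrite Rmin_left, Rmax_right in Hu by lra.
    apply (hadamard_pd n t u); auto; lra.
Qed.

Lemma hadamard_ftc t : near1 0 e t -> f t = f 0 + t * I 0 t.
Proof.
  intros Ht.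
  assert (is_RInt (fun u => t * H 0 (t, u)) 0 1 (minus (f (t * 1)) (f (t * 0)))) as K.
  { apply (is_RInt_derive (fun u => f (t * u))).
    - intros u Hu. rewrite Rmin_left, Rmax_right in Hu by lra.
      replace (t * H 0 (t, u)) with (t * Derive f (t * u)) by (change (H 0 (t, u)) with (1 * Derive f (t * u)); ring).
      apply (is_derive_comp f (fun u => t * u)).
      + apply smooth1_at_is_derive, Hf, hadamard_dom; auto.
      + auto_derive; auto. ring.
    - intros u Hu. rewrite Rmin_left, Rmax_right in Hu by lra.
      apply (continuous_scal_r t (fun u => H 0 (t, u))).
      apply (ex_derive_continuous (fun u => H 0 (t, u))). eexists.
      eapply has_gradient_is_derive_y, smooth_at_D2, hadamard_smooth; auto. }
  pose proof (is_RInt_unique (fun u => t * H 0 (t, u)) 0 1 _ K) as K'.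
  pose proof (RInt_scal (fun u => H 0 (t, u)) 0 1 t (hadamard_ex_RInt 0 t Ht)) as K2.
  change (RInt (fun u => t * H 0 (t, u)) 0 1 = t * I 0 t) in K2. rewrite K' in K2.
  rewrite Rmult_1_r, Rmult_0_r in K2. change (f t - f 0 = t * I 0 t) in K2. lra.
Qed.

Lemma hadamard_Derive_n n t : near1 0 e t -> Derive_n (I 0) n t = I n t.
Proof.
  revert t. induction n as [|n IH]; intros t Ht; auto. simpl.
  rewrite (Derive_ext_loc _ (I n)). apply is_derive_unique, hadamard_derive, Ht.
  generalize (near1_open _ _ _ Ht). apply filter_imp. exact IH.
Qed.

Lemma hadamard_at_0 n : I n 0 = Derive_n f (S n) 0 / INR (S n).
Proof.
  unfold I. apply is_RInt_unique.
  apply (is_RInt_ext (fun u => scal (Derive_n f (S n) 0) (u ^ n))).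
  - intros u _. unfold H. simpl fst; simpl snd. rewrite Rmult_0_l. unfold scal; simpl; unfold mult; simpl; ring.
  - apply (is_RInt_scal (fun u => u ^ n)), is_RInt_pow.
Qed.

Lemma hadamard_smooth1 t : near1 0 e t -> smooth1_at (I 0) t.
Proof.
  intros Ht. apply (chain_smooth1_at (near1 0 e) I). intros n x. apply hadamard_derive.
  apply near1_open, Ht.
Qed.
End Hadamard.

Theorem hadamard_on (f : R -> R) e : 0 < e -> (forall t, near1 0 e t -> smooth1_at f t) ->
  exists q : R -> R, (forall t, near1 0 e t -> smooth1_at q t) /\ (forall t, f t = f 0 + t * q t) /\
    (forall n, Derive_n q n 0 = Derive_n f (S n) 0 / INR (S n)).
Proof.
  intros He Hf.
  set (I0 := fun t => RInt (fun u => u ^ 0 * Derive_n f 1 (t * u)) 0 1).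
  (* Away from the interval the plain quotient is used, so that the identity f t = f 0 + t * q t
     holds for every t and later rewriting needs no neighbourhood. *)
  exists (fun t => if excluded_middle_informative (near1 0 e t) then I0 t else (f t - f 0) / t).
  assert (E : forall t, near1 0 e t ->
     locally t (fun t => I0 t = (if excluded_middle_informative (near1 0 e t) then I0 t else (f t - f 0) / t))).
  { intros t Ht. generalize (near1_open _ _ _ Ht). apply filter_imp. intros s Hs.
    destruct (excluded_middle_informative (near1 0 e s)); tauto. }
  split; [|split].
  - intros t Ht. apply smooth1_at_ext_loc with I0. apply E, Ht.
    apply (hadamard_smooth1 f e); auto.
  - intros t. destruct (excluded_middle_informative (near1 0 e t)) as [Ht|Ht].
    + apply (hadamard_ftc f e); auto.
    + field. intros ->. apply Ht, near1_0, He.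
  - intros n. rewrite <- (hadamard_at_0 f), <- (hadamard_Derive_n f e); auto using near1_0.
    symmetry. apply Derive_n_ext_loc, E, near1_0, He.
Qed.

Theorem hadamard (f : R -> R) : locally 0 (smooth1_at f) ->
  exists q : R -> R, locally 0 (smooth1_at q) /\ (forall t, f t = f 0 + t * q t) /\
    (forall n, Derive_n q n 0 = Derive_n f (S n) 0 / INR (S n)).
Proof.
  intros Hf. apply locally_near1 in Hf. destruct Hf as (e & He & Hf).
  destruct (hadamard_on f e He Hf) as (q & Hq & H). exists q. split; auto.
  apply locally_near1. exists e. auto.
Qed.

(** Horner form with n coefficients, hence of degree below n: removing the constant term and
    dividing by t shifts [c], which matches one application of Hadamard's lemma. *)
Fixpoint tpoly (c : nat -> R) (n : nat) (t : R) : R :=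
  match n with
  | O => 0
  | S m => c O + t * tpoly (fun k => c (S k)) m t
  end.

Theorem taylor_smooth_remainder n : forall f : R -> R, locally 0 (smooth1_at f) ->
  exists r : R -> R, locally 0 (smooth1_at r) /\
    forall t, f t = tpoly (fun k => Derive_n f k 0 / INR (fact k)) n t + t ^ n * r t.
Proof.
  induction n as [|n IH]; intros f Hf.
  - exists f. split; auto. intros t. simpl. ring.
  - destruct (hadamard f Hf) as (q & Hq & E & D). destruct (IH q Hq) as (r & Hr & Er).
    exists r. split; auto. intros t. rewrite E, Er at 1. simpl tpoly.
    assert (X : forall c d m t, (forall k, c k = d k) -> tpoly c m t = tpoly d m t).
    { intros c d m. revert c d. induction m as [|m IHm]; intros c d s Hcd; simpl; auto.
      rewrite Hcd, (IHm _ (fun k => d (S k))); auto. }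
    rewrite (X (fun k => Derive_n q k 0 / INR (fact k)) (fun k => Derive_n f (S k) 0 / INR (fact (S k)))).
    simpl. field.
    intros k. rewrite D. rewrite fact_simpl, mult_INR. field. split; [apply INR_fact_neq_0 | apply not_0_INR; lia].
Qed.

Lemma tpoly_minus n : forall c d t, tpoly c n t - tpoly d n t = tpoly (fun k => c k - d k) n t.
Proof.
  induction n as [|n IH]; intros c d t; simpl. ring. rewrite <- IH. ring.
Qed.

Lemma tpoly_bound n : forall c, exists C, 0 <= C /\ forall t, Rabs t <= 1 -> Rabs (tpoly c n t) <= C.
Proof.
  induction n as [|n IH]; intros c.
  - exists 0. split. lra. intros t _. simpl. rewrite Rabs_R0. lra.
  - destruct (IH (fun k => c (S k))) as (C & HC & H). exists (Rabs (c O) + C).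
    split. pose proof (Rabs_pos (c O)). lra. intros t Ht. simpl.
    eapply Rle_trans; [apply Rabs_triang|]. apply Rplus_le_compat_l. rewrite Rabs_mult.
    specialize (H t Ht). pose proof (Rabs_pos t).
    pose proof (Rabs_pos (tpoly (fun k => c (S k)) n t)).
    replace C with (1 * C) by ring. apply Rmult_le_compat; auto.
Qed.

Lemma tpoly_unique n : forall c C e, 0 < e ->
  (forall t, 0 < Rabs t < e -> Rabs (tpoly c n t) <= C * Rabs t ^ n) ->
  forall k, (k < n)%nat -> c k = 0.
Proof.
  induction n as [|n IH]; intros c C e He H k Hk. lia.
  assert (c0 : c O = 0).
  { destruct (Req_dec (c O) 0) as [|Hn]; auto. exfalso.
    destruct (tpoly_bound n (fun k => c (S k))) as (M & HM & B).
    set (A := Rabs (c O)). assert (0 < A) as HA by (apply Rabs_pos_lt, Hn).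
    set (C' := Rabs C + M + 1). assert (0 < C') as HC' by (unfold C'; pose proof (Rabs_pos C); lra).
    (* At this t the higher terms and the assumed bound together are at most t * C', hence at most A
       / 2, although they have to account for A. *)
    set (t := Rmin (Rmin 1 (e / 2)) (A / (2 * C'))).
    assert (Ht : 0 < t). { repeat apply Rmin_glb_lt; try lra. apply Rdiv_lt_0_compat; lra. }
    assert (Ht1 : t <= 1) by (unfold t; eapply Rle_trans; [apply Rmin_l|apply Rmin_l]).
    assert (Hte : t <= e / 2) by (unfold t; eapply Rle_trans; [apply Rmin_l|apply Rmin_r]).
    assert (HtA : t <= A / (2 * C')) by (unfold t; apply Rmin_r).
    assert (Rt : Rabs t = t) by (apply Rabs_pos_eq; lra).
    specialize (H t). rewrite Rt in H. specialize (H ltac:(lra)). simpl in H.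
    specialize (B t ltac:(lra)).
    assert (P1 : t ^ n <= 1). { rewrite <- (pow1 n). apply pow_incr. lra. }
    assert (P0 : 0 <= t ^ n) by (apply pow_le; lra).
    assert (A <= t * (Rabs C + M)).
    { unfold A. replace (c O) with ((c O + t * tpoly (fun k => c (S k)) n t) - t * tpoly (fun k => c (S k)) n t) by ring.
      eapply Rle_trans; [apply Rabs_triang|]. rewrite Rabs_Ropp, Rabs_mult, Rt.
      assert (C * (t * t ^ n) <= t * Rabs C).
      { pose proof (Rle_abs C). pose proof (Rabs_pos C).
        assert (0 <= t * t ^ n <= t) by (split; nra).
        apply Rle_trans with (Rabs C * (t * t ^ n)). apply Rmult_le_compat_r; lra.
        rewrite (Rmult_comm t (Rabs C)). apply Rmult_le_compat_l; lra. }
      assert (t * Rabs (tpoly (fun k => c (S k)) n t) <= t * M) by (apply Rmult_le_compat_l; lra).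
      lra. }
    assert (t * C' <= A / 2).
    { apply Rmult_le_compat_r with (r := C') in HtA; [|lra].
      replace (A / (2 * C') * C') with (A / 2) in HtA by (field; lra). exact HtA. }
    unfold C' in *. lra. }
  destruct k as [|k]; auto.
  apply (IH (fun k => c (S k)) C e He); [|lia].
  intros t Ht. specialize (H t Ht). simpl in H. rewrite c0, Rplus_0_l, Rabs_mult in H.
  apply Rmult_le_reg_l with (Rabs t). lra. eapply Rle_trans; [exact H|right; ring].
Qed.

Lemma continuous_bounded_near (f : R -> R) x : continuous f x -> exists C, locally x (fun t => Rabs (f t) <= C).
Proof.
  intros H. exists (Rabs (f x) + 1).
  assert (L : locally x (fun t => Rabs (f t - f x) < 1)).
  { apply (H (fun z => Rabs (z - f x) < 1)). exists (mkposreal _ Rlt_0_1). intros z Hz; exact Hz. }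
  revert L. apply filter_imp. intros t Ht.
  replace (f t) with ((f t - f x) + f x) by ring. eapply Rle_trans; [apply Rabs_triang|lra].
Qed.

(** Derivatives at 0 are read off from an O(t^n) estimate. Jets of composites can then be found by
    polynomial algebra instead of repeated differentiation. *)
Theorem derivatives_of_jet n (f : R -> R) (c : nat -> R) C :
  locally 0 (smooth1_at f) ->
  locally 0 (fun t => Rabs (f t - tpoly c n t) <= C * Rabs t ^ n) ->
  forall k, (k < n)%nat -> Derive_n f k 0 = c k * INR (fact k).
Proof.
  intros Hf B k Hk. destruct (taylor_smooth_remainder n f Hf) as (s & Hs & Es).
  destruct (continuous_bounded_near s 0) as (M & HM).
  { apply smooth1_at_continuous, (locally_at_point _ _ _ Hs). }
  pose proof (filter_and _ _ B HM) as L. apply locally_near1 in L.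
  destruct L as (e & He & L).
  assert (K : Derive_n f k 0 / INR (fact k) - c k = 0).
  { apply (tpoly_unique n (fun k => Derive_n f k 0 / INR (fact k) - c k) (C + M) e He); auto.
    intros t [_ Ht]. destruct (L t) as (L1 & L2). unfold near1. rewrite Rminus_0_r; auto.
    rewrite <- tpoly_minus. specialize (Es t).
    replace (tpoly (fun k => Derive_n f k 0 / INR (fact k)) n t - tpoly c n t)
      with ((f t - tpoly c n t) - t ^ n * s t) by lra.
    unfold Rminus at 1. eapply Rle_trans; [apply Rabs_triang|]. rewrite Rabs_Ropp, Rabs_mult, <- RPow_abs.
    rewrite Rmult_plus_distr_r. apply Rplus_le_compat; auto.
    rewrite Rmult_comm. apply Rmult_le_compat_r; auto. apply pow_le, Rabs_pos. }
  pose proof (INR_fact_neq_0 k). replace (c k) with (Derive_n f k 0 / INR (fact k)) by lra. field; auto.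
Qed.

(** * Borel's lemma and smooth functions of t^4 *)

Definition bounded (f : R -> R) : Prop := exists M, forall x, Rabs (f x) <= M.

(** Bounds over the whole line are required, because the series in Borel's lemma rescales its
    argument by arbitrarily large factors. *)
Fixpoint bounded_to_order (n : nat) (f : R -> R) : Prop :=
  match n with
  | O => bounded f
  | S m => bounded f /\ exists f', (forall x, is_derive f x (f' x)) /\ bounded_to_order m f'
  end.

Lemma bounded_to_order_S n : forall f, bounded_to_order (S n) f -> bounded_to_order n f.
Proof.
  induction n as [|n IH]; intros f (B & f' & D & H). exact B.
  split; auto. exists f'. split; auto.
Qed.

Lemma bounded_plus f g : bounded f -> bounded g -> bounded (fun x => f x + g x).
Proof.
  intros [M H] [N K]. exists (M + N). intros x. eapply Rle_trans; [apply Rabs_triang|].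
  specialize (H x). specialize (K x). lra.
Qed.

Lemma bounded_mult f g : bounded f -> bounded g -> bounded (fun x => f x * g x).
Proof.
  intros [M H] [N K]. exists (M * N). intros x. rewrite Rabs_mult.
  apply Rmult_le_compat; auto using Rabs_pos.
Qed.

Lemma bounded_to_order_plus n : forall f g, bounded_to_order n f -> bounded_to_order n g -> bounded_to_order n (fun x => f x + g x).
Proof.
  induction n as [|n IH]; intros f g Hf Hg.
  - apply bounded_plus; auto.
  - destruct Hf as (Bf & f' & Df & Hf), Hg as (Bg & g' & Dg & Hg). split.
    apply bounded_plus; auto. exists (fun x => f' x + g' x). split; auto.
    intros x. apply (is_derive_plus f g); auto.
Qed.

Lemma bounded_to_order_mult n : forall f g, bounded_to_order n f -> bounded_to_order n g -> bounded_to_order n (fun x => f x * g x).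
Proof.
  induction n as [|n IH]; intros f g Hf Hg.
  - apply bounded_mult; auto.
  - pose proof (bounded_to_order_S _ _ Hf) as Hf1. pose proof (bounded_to_order_S _ _ Hg) as Hg1.
    destruct Hf as (Bf & f' & Df & Hf), Hg as (Bg & g' & Dg & Hg). split.
    apply bounded_mult; auto. exists (fun x => f' x * g x + f x * g' x). split.
    + intros x. apply (is_derive_mult f g); auto. intros a b. apply Rmult_comm.
    + apply bounded_to_order_plus; apply IH; auto.
Qed.

Lemma bounded_to_order_const n : forall c, bounded_to_order n (fun _ => c).
Proof.
  assert (B : forall c, bounded (fun _ => c)) by (intros c; exists (Rabs c); intros; lra).
  induction n as [|n IH]; intros c. apply B.
  split. apply B. exists (fun _ => 0). split; auto. intros x. apply (is_derive_const c x).
Qed.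

Lemma bounded_sin : bounded sin.
Proof. exists 1. intros x. apply Rabs_le. pose proof (SIN_bound x). lra. Qed.
Lemma bounded_cos : bounded cos.
Proof. exists 1. intros x. apply Rabs_le. pose proof (COS_bound x). lra. Qed.

Lemma bounded_to_order_sin_cos n : bounded_to_order n sin /\ bounded_to_order n cos.
Proof.
  induction n as [|n [IS IC]]. split. apply bounded_sin. apply bounded_cos.
  split; (split; [apply bounded_sin || apply bounded_cos|]).
  - exists cos. split; auto. intros x. apply is_derive_sin.
  - exists (fun x => (-1) * sin x). split. intros x.
    replace (-1 * sin x) with (- sin x) by ring. apply is_derive_cos.
    apply bounded_to_order_mult; auto. apply bounded_to_order_const.
Qed.

Lemma bounded_to_order_sin_pow n k : bounded_to_order n (fun x => sin x ^ k).
Proof.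
  induction k as [|k IH]; simpl. apply bounded_to_order_const.
  apply (bounded_to_order_mult n sin (fun x => sin x ^ k)); auto. apply bounded_to_order_sin_cos.
Qed.

Lemma bounded_to_order_ext n : forall f g, (forall x, f x = g x) -> bounded_to_order n f -> bounded_to_order n g.
Proof.
  assert (X : forall f g, (forall x, f x = g x) -> bounded f -> bounded g).
  { intros f g E [M H]. exists M. intros x. rewrite <- E. apply H. }
  intros f g E. destruct n as [|n]. apply X, E.
  intros (B & f' & D & H). split. apply (X f); auto. exists f'. split; auto.
  intros x. apply (is_derive_ext f); auto.
Qed.

Lemma bounded_to_order_Derive f : (forall n, bounded_to_order n f) -> forall n, bounded_to_order n (Derive f).
Proof.
  intros H n. destruct (H (S n)) as (_ & f' & D & H'). apply (bounded_to_order_ext n f'); auto.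
  intros x. symmetry. apply is_derive_unique, D.
Qed.

Lemma bounded_to_order_Derive_n f j : (forall n, bounded_to_order n f) -> forall n, bounded_to_order n (Derive_n f j).
Proof. intros H. induction j as [|j IH]; auto. simpl. apply bounded_to_order_Derive, IH. Qed.

Lemma bounded_to_order_smooth f : (forall n, bounded_to_order n f) -> forall x, smooth1_at f x.
Proof.
  intros H x. apply (fun K => chain_smooth1_at (fun _ => True) (Derive_n f) K O x).
  - intros n t _. destruct (bounded_to_order_Derive_n f n H 1%nat) as (_ & f' & D & _).
    replace (Derive_n f (S n) t) with (f' t). apply D. symmetry. apply is_derive_unique, D.
  - apply filter_forall; auto.
Qed.

Lemma smooth1_at_sin x : smooth1_at sin x.
Proof. apply bounded_to_order_smooth. intros n. apply bounded_to_order_sin_cos. Qed.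

Lemma tpoly_monomial k : forall t, tpoly (fun j => if Nat.eqb j k then 1 else 0) (S k) t = t ^ k.
Proof.
  induction k as [|k IH]; intros t. simpl. ring.
  change (0 + t * tpoly (fun j => if Nat.eqb j k then 1 else 0) (S k) t = t ^ S k).
  rewrite IH. simpl. ring.
Qed.

Lemma locally_all (P : R -> Prop) x : (forall t, P t) -> locally x P.
Proof. intros H. apply filter_forall, H. Qed.

(** Write sin x = x q(x) with q 0 = 1; then sin x ^ k agrees with x ^ k up to O(x ^ (k + 1)). *)
Lemma Derive_n_sin_pow k j : (j <= k)%nat ->
  Derive_n (fun x => sin x ^ k) j 0 = if Nat.eqb j k then INR (fact k) else 0.
Proof.
  intros Hj. assert (Hs : locally 0 (smooth1_at sin)) by (apply locally_all, smooth1_at_sin).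
  destruct (hadamard sin Hs) as (q & Hq & E & D).
  assert (q0 : q 0 = 1).
  { specialize (D O). change (q 0 = Derive sin 0 / 1) in D.
    rewrite D, (is_derive_unique _ _ _ (is_derive_sin 0)), cos_0. field. }
  assert (Hqk : locally 0 (smooth1_at (fun t => q t ^ k))).
  { revert Hq. apply filter_imp. intros t Ht. apply smooth1_at_pow, Ht. }
  destruct (hadamard _ Hqk) as (r & Hr & Er & _).
  destruct (continuous_bounded_near r 0) as (C & HC).
  { apply smooth1_at_continuous, (locally_at_point _ _ _ Hr). }
  rewrite (derivatives_of_jet (S k) (fun x => sin x ^ k) (fun j => if Nat.eqb j k then 1 else 0) C); auto; try lia.
  - destruct (Nat.eqb_spec j k) as [->|]; ring.
  - apply locally_all. intros t. apply smooth1_at_pow, smooth1_at_sin.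
  - revert HC. apply filter_imp. intros t Ht. rewrite tpoly_monomial, E, sin_0, Rplus_0_l, Rpow_mult_distr.
    rewrite (Er t), q0, pow1, RPow_abs. replace (t ^ k * (1 + t * r t) - t ^ k) with (r t * t ^ S k) by (simpl; ring).
    rewrite Rabs_mult. apply Rmult_le_compat_r; auto using Rabs_pos.
Qed.

Section Borel.
Variable a : nat -> R.
Variable K : nat -> R.
Hypothesis HK : forall k, 0 <= K k /\ forall j x, (j < k)%nat -> Rabs (Derive_n (fun y => sin y ^ k) j x) <= K k.

(** Powers of a rescaled sine replace the usual cut-off monomials: sin (r x) ^ k / r ^ k has leading
    term x ^ k, and its derivative of order j is of size r ^ (j - k). For j < k a large r, chosen
    from c, makes this as small as desired. *)
Let rad (c : R) k := 1 + Rabs c * 2 ^ k * K k.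
Let term (c : R) k x := c / (INR (fact k) * rad c k ^ k) * sin (rad c k * x) ^ k.

Lemma borel_rad c k : 1 <= rad c k.
Proof.
  unfold rad. assert (0 <= Rabs c * 2 ^ k * K k); [|lra].
  apply Rmult_le_pos; [apply Rmult_le_pos|]. apply Rabs_pos. apply pow_le; lra. apply HK.
Qed.

Lemma borel_term_smooth c k x : smooth1_at (term c k) x.
Proof.
  unfold term. apply smooth1_at_mult. apply smooth1_at_const. apply smooth1_at_pow.
  apply (smooth1_at_comp sin). apply smooth1_at_sin. apply smooth1_at_mult.
  apply smooth1_at_const. apply smooth1_at_id.
Qed.

Lemma borel_term_Derive_n c k j x : Derive_n (term c k) j x =
  c / (INR (fact k) * rad c k ^ k) * (rad c k ^ j * Derive_n (fun y => sin y ^ k) j (rad c k * x)).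
Proof.
  unfold term. rewrite Derive_n_scal_l. f_equal.
  apply (Derive_n_comp_scal (fun y => sin y ^ k)). apply locally_all. intros t i _.
  apply (smooth1_at_smooth1_on (fun _ => True)); auto. intros s _. apply smooth1_at_pow, smooth1_at_sin.
Qed.

Lemma borel_term_at_0 c k j : (j <= k)%nat -> Derive_n (term c k) j 0 = if Nat.eqb j k then c else 0.
Proof.
  intros Hj. rewrite borel_term_Derive_n, Rmult_0_r, Derive_n_sin_pow by auto.
  destruct (Nat.eqb_spec j k) as [->|]; [|ring].
  field. split. apply pow_nonzero. pose proof (borel_rad c k). lra. apply INR_fact_neq_0.
Qed.

Lemma borel_term_bound c k j x : (j < k)%nat -> Rabs (Derive_n (term c k) j x) <= (/ 2) ^ k.
Proof.
  intros Hj. rewrite borel_term_Derive_n. pose proof (borel_rad c k) as Hr. set (r := rad c k) in *.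
  destruct (HK k) as [K0 KB]. specialize (KB j (r * x) Hj).
  rewrite !Rabs_mult. unfold Rdiv. rewrite Rabs_mult.
  assert (F : 1 <= INR (fact k)).
  { replace 1 with (INR 1) by reflexivity. apply le_INR. apply lt_O_fact. }
  assert (P : 0 < r ^ k) by (apply pow_lt; lra).
  assert (Pj : 0 < r ^ j) by (apply pow_lt; lra).
  rewrite (Rabs_pos_eq (/ (INR (fact k) * r ^ k))) by (left; apply Rinv_0_lt_compat, Rmult_lt_0_compat; lra).
  rewrite (Rabs_pos_eq (r ^ j)) by lra.
  (* Of the k - j spare factors r, one absorbs |c| * 2 ^ k * K k; the others are at least 1. *)
  assert (Q : r ^ k = r ^ j * (r * r ^ (k - S j))).
  { rewrite tech_pow_Rmult, <- pow_add. f_equal. lia. }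
  assert (Q1 : 1 <= r ^ (k - S j)) by (apply pow_R1_Rle; lra).
  set (D := Rabs (Derive_n _ _ _)) in *. assert (0 <= D) by apply Rabs_pos.
  assert (HrK : Rabs c * 2 ^ k * K k <= r) by (unfold r, rad; lra).
  rewrite pow_inv.
  assert (P2 : 0 < 2 ^ k) by (apply pow_lt; lra).
  apply Rmult_le_reg_r with (INR (fact k) * r ^ k). apply Rmult_lt_0_compat; lra.
  replace (Rabs c * / (INR (fact k) * r ^ k) * (r ^ j * D) * (INR (fact k) * r ^ k)) with (Rabs c * D * r ^ j)
    by (field; lra).
  rewrite Q. apply Rmult_le_reg_r with (2 ^ k); auto.
  replace (/ 2 ^ k * (INR (fact k) * (r ^ j * (r * r ^ (k - S j)))) * 2 ^ k)
    with ((INR (fact k) * r ^ (k - S j)) * r * r ^ j) by (field; lra).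
  replace (Rabs c * D * r ^ j * 2 ^ k) with ((Rabs c * 2 ^ k * D) * r ^ j) by ring.
  apply Rmult_le_compat_r. lra.
  apply Rle_trans with (Rabs c * 2 ^ k * K k).
  - apply Rmult_le_compat_l; auto. apply Rmult_le_pos. apply Rabs_pos. lra.
  - apply Rle_trans with (1 * r). lra. apply Rmult_le_compat_r. lra.
    replace 1 with (1 * 1) by ring. apply Rmult_le_compat; lra.
Qed.

(* Each new term corrects the derivative of order n at 0, leaving the lower ones unchanged. *)
Fixpoint borel_sum (n : nat) : R -> R :=
  match n with
  | O => fun _ => 0
  | S m => fun x => borel_sum m x + term (a m - Derive_n (borel_sum m) m 0) m x
  end.

Lemma borel_sum_smooth n x : smooth1_at (borel_sum n) x.
Proof.
  induction n as [|n IH]. apply smooth1_at_const. simpl. apply smooth1_at_plus; auto.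
  apply borel_term_smooth.
Qed.

Lemma borel_sum_Derive_n n j x : Derive_n (borel_sum (S n)) j x =
  Derive_n (borel_sum n) j x + Derive_n (term (a n - Derive_n (borel_sum n) n 0) n) j x.
Proof.
  simpl. apply Derive_n_plus; apply locally_all; intros t k _;
  apply (smooth1_at_smooth1_on (fun _ => True)); auto; intros s _.
  apply borel_sum_smooth. apply borel_term_smooth.
Qed.

Lemma borel_sum_at_0 n j : (j < n)%nat -> Derive_n (borel_sum n) j 0 = a j.
Proof.
  induction n as [|n IH]; intros Hj. lia.
  rewrite borel_sum_Derive_n, borel_term_at_0 by lia.
  destruct (Nat.eqb_spec j n) as [->|]. ring. rewrite IH by lia. ring.
Qed.

(** The right-hand side is the exact geometric sum of 2^(-i) for n <= i < n + p, so the induction on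
    p closes without loss. *)
Lemma borel_sum_tail j n p x : (j < n)%nat ->
  Rabs (Derive_n (borel_sum (n + p)) j x - Derive_n (borel_sum n) j x) <= 2 * (/ 2) ^ n - 2 * (/ 2) ^ (n + p).
Proof.
  intros Hj. induction p as [|p IH].
  - rewrite Nat.add_0_r, !Rminus_diag, Rabs_R0. lra.
  - rewrite Nat.add_succ_r, borel_sum_Derive_n.
    set (c := a (n + p)%nat - _).
    pose proof (borel_term_bound c (n + p) j x ltac:(lia)) as B.
    match goal with |- Rabs (?u + ?v - ?w) <= _ => replace (u + v - w) with ((u - w) + v) by ring end.
    eapply Rle_trans; [apply Rabs_triang|]. simpl pow. lra.
Qed.

Lemma borel_cauchy j : CVU_cauchy (fun n => Derive_n (borel_sum n) j) (fun _ => True).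
Proof.
  intros eps. destruct (pow_lt_1_zero (/ 2) ltac:(rewrite Rabs_pos_eq; lra) (eps / 4)) as (N & HN).
  { pose proof (cond_pos eps). lra. }
  exists (Nat.max N (S j)).
  assert (X : forall n m x, (Nat.max N (S j) <= n)%nat -> (n <= m)%nat ->
     Rabs (Derive_n (borel_sum m) j x - Derive_n (borel_sum n) j x) < eps).
  { intros n m x Hn Hm. replace m with (n + (m - n))%nat by lia.
    eapply Rle_lt_trans. apply borel_sum_tail; lia.
    specialize (HN n ltac:(lia)). rewrite Rabs_pos_eq in HN by (apply pow_le; lra).
    assert (0 < (/ 2) ^ (n + (m - n))) by (apply pow_lt; lra). pose proof (cond_pos eps). lra. }
  intros n m x _ Hn Hm. destruct (Nat.le_ge_cases n m) as [H|H].
  - rewrite Rabs_minus_sym. apply X; auto.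
  - apply X; auto.
Qed.

(** The partial sums converge uniformly together with their derivatives of every order, so limit and
    derivative commute; at 0 the derivatives of order j are constant from index j + 1 on. *)
Lemma borel_limit : exists D : nat -> R -> R,
  (forall n x, is_derive (D n) x (D (S n) x)) /\ forall n, D n 0 = a n.
Proof.
  exists (fun j x => real (Lim_seq (fun n => Derive_n (borel_sum n) j x))). split.
  - intros j x. apply (CVU_Derive (fun n => Derive_n (borel_sum n) j) (fun _ => True)); auto.
    + apply open_true.
    + intros u v w _ _ _; exact I.
    + apply CVU_dom_cauchy, borel_cauchy.
    + intros n y _. eexists. apply smooth1_at_is_derive, smooth1_at_Derive_n, borel_sum_smooth.
    + intros n y _. apply continuity_pt_filterlim. apply (smooth1_at_continuous (Derive (Derive_n (borel_sum n) j))).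
      apply smooth1_at_Derive, smooth1_at_Derive_n, borel_sum_smooth.
    + apply (CVU_dom_cauchy (fun n => Derive_n (borel_sum n) (S j))), borel_cauchy.
  - intros j. rewrite (Lim_seq_ext_loc _ (fun _ => a j)). rewrite Lim_seq_const. reflexivity.
    exists (S j). intros n Hn. apply borel_sum_at_0. lia.
Qed.
End Borel.

Theorem borel (a : nat -> R) : exists D : nat -> R -> R,
  (forall n x, is_derive (D n) x (D (S n) x)) /\ forall n, D n 0 = a n.
Proof.
  assert (H : forall k, exists C, 0 <= C /\ forall j x, (j < k)%nat -> Rabs (Derive_n (fun y => sin y ^ k) j x) <= C).
  { intros k.
    assert (X : forall m, exists C, 0 <= C /\ forall j x, (j < m)%nat -> Rabs (Derive_n (fun y => sin y ^ k) j x) <= C); [|apply X].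
    intros m. induction m as [|m (C & HC & IH)].
    - exists 0. split. lra. intros; lia.
    - destruct (bounded_to_order_Derive_n _ m (fun n => bounded_to_order_sin_pow n k) 0%nat) as [M HM].
      exists (C + Rabs M). split. pose proof (Rabs_pos M). lra.
      intros j x Hj. pose proof (Rle_abs M). pose proof (Rabs_pos M).
      destruct (Nat.eq_dec j m) as [->|]. specialize (HM x). lra.
      specialize (IH j x ltac:(lia)). lra. }
  apply functional_choice in H. destruct H as [K HK]. exact (borel_limit a K HK).
Qed.

(** By the mean value theorem the difference quotient at 0 is a value of h1 at an intermediate
    point, and this tends to h1 0. *)
Lemma is_derive_glue (h h1 : R -> R) :
  locally 0 (fun x => x <> 0 -> is_derive h x (h1 x)) ->
  continuous h 0 -> continuous h1 0 -> is_derive h 0 (h1 0).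
Proof.
  intros H Hc Hc1. apply is_derive_Reals. intros eps Heps.
  assert (L : locally 0 (fun x => Rabs (h1 x - h1 0) < eps)).
  { apply (Hc1 (fun z => Rabs (z - h1 0) < eps)). exists (mkposreal _ Heps). intros z Hz; exact Hz. }
  pose proof (filter_and _ _ H L) as HL. apply locally_near1 in HL. destruct HL as (d & Hd & HL).
  exists (mkposreal _ Hd). intros x Hx Hxd. simpl in Hxd. rewrite Rplus_0_l.
  assert (N : forall t, Rmin 0 x <= t <= Rmax 0 x -> near1 0 d t).
  { intros t Ht. unfold near1. rewrite Rminus_0_r. apply Rabs_def2 in Hxd. revert Ht. unfold Rmin, Rmax.
    destruct (Rle_dec 0 x); intros; apply Rabs_def1; lra. }
  destruct (MVT_gen h 0 x h1) as (xi & Hxi & E).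
  - intros t Ht. apply (HL t). apply N; lra. intros ->. revert Ht. unfold Rmin, Rmax.
    destruct (Rle_dec 0 x); lra.
  - intros t Ht. apply continuity_pt_filterlim. destruct (Req_dec t 0) as [->|Ht0]. exact Hc.
    apply (ex_derive_continuous h). eexists. apply (HL t); auto.
  - change (h x - h 0 = h1 xi * (x - 0)) in E. rewrite E.
    replace (h1 xi * (x - 0) / x - h1 0) with (h1 xi - h1 0) by (field; auto).
    apply (HL xi). auto.
Qed.

(** * Whitney's theorem on even functions and its iteration *)

Section Even.
(** [k n] stands for the n-th derivative of the sought F, taken at t^2: the derivative of F^(n)(t^2)
    is 2 t F^(n+1)(t^2), which is what [Hk] says. *)
Variables (e : R) (k : nat -> R -> R).
Hypothesis He : 0 < e.
Hypothesis Hsm : forall n t, near1 0 e t -> smooth1_at (k n) t.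
Hypothesis Hk : forall n t, near1 0 e t -> Derive (k n) t = 2 * t * k (S n) t.

Lemma sqrt_near x : 0 <= x -> x < e * e -> near1 0 e (sqrt x).
Proof.
  intros H0 H1. unfold near1. rewrite Rminus_0_r, Rabs_pos_eq by apply sqrt_pos.
  rewrite <- (sqrt_square e) by lra. apply sqrt_lt_1_alt. lra.
Qed.

(** For x >= 0 the derivatives of F must be k n (sqrt x). On x < 0 they are continued by a function
    whose derivatives at 0 are [k n 0], from Borel's lemma; the two halves then match at 0 in every
    order. *)
Lemma even_as_function_of_square : exists F, (forall x, near1 0 (e * e) x -> smooth1_at F x) /\
  forall t, 0 <= t -> k 0 t = F (t ^ 2).
Proof.
  destruct (borel (fun n => k n 0)) as (D & HD & D0).
  set (H := fun n x => if Rle_dec 0 x then k n (sqrt x) else D n x).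
  assert (Hpos : forall n x, 0 < x -> near1 0 (e * e) x -> is_derive (H n) x (H (S n) x)).
  { intros n x Hx Hxe. unfold near1 in Hxe. rewrite Rminus_0_r, Rabs_pos_eq in Hxe by lra.
    apply (is_derive_ext_loc (fun x => k n (sqrt x))).
    - generalize (locally_pos x Hx). apply filter_imp. intros y Hy. unfold H.
      destruct (Rle_dec 0 y); auto. lra.
    - unfold H. destruct (Rle_dec 0 x); [|lra].
      assert (0 < sqrt x) by (apply sqrt_lt_R0, Hx).
      replace (k (S n) (sqrt x)) with (/ (2 * sqrt x) * Derive (k n) (sqrt x)).
      apply (is_derive_comp (k n) sqrt). apply smooth1_at_is_derive, Hsm, sqrt_near; lra.
      apply is_derive_Reals, derivable_pt_lim_sqrt, Hx.
      rewrite Hk by (apply sqrt_near; lra). field. lra. }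
  assert (Hneg : forall n x, x < 0 -> is_derive (H n) x (H (S n) x)).
  { intros n x Hx. apply (is_derive_ext_loc (D n)).
    - apply locally_near1. exists (- x). split. lra. intros y Hy. unfold near1 in Hy. apply Rabs_def2 in Hy.
      unfold H. destruct (Rle_dec 0 y); auto. lra.
    - unfold H. destruct (Rle_dec 0 x); [lra|]. apply HD. }
  assert (Hc : forall n, continuous (H n) 0).
  { intros n. assert (H0 : H n 0 = k n 0).
    { unfold H. destruct (Rle_dec 0 0); [|lra]. rewrite sqrt_0. reflexivity. }
    unfold continuous. rewrite H0. intros P HP.
    assert (L1 : locally 0 (fun x => P (k n (sqrt x)))).
    { apply (continuous_comp sqrt (k n) 0). apply continuous_sqrt. rewrite sqrt_0.
      apply smooth1_at_continuous, Hsm, near1_0, He. rewrite sqrt_0. exact HP. }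
    assert (L2 : locally 0 (fun x => P (D n x))).
    { apply (ex_derive_continuous (D n) 0). eexists; apply HD. rewrite D0. exact HP. }
    change (locally 0 (fun x => P (H n x))).
    generalize (filter_and _ _ L1 L2). apply filter_imp. intros x [A B]. unfold H.
    destruct (Rle_dec 0 x); auto. }
  exists (H O). split.
  - intros x Hx. apply (chain_smooth1_at (near1 0 (e * e)) H); [|apply near1_open, Hx].
    intros n y Hy. destruct (Rtotal_order y 0) as [Hy0|[->|Hy0]]; auto.
    apply is_derive_glue; auto.
    generalize (near1_open _ _ _ Hy). apply filter_imp. intros z Hz Hz0.
    destruct (Rtotal_order z 0) as [Hz1|[Hz1|Hz1]]; auto. lra.
  - intros t Ht. unfold H. destruct (Rle_dec 0 (t ^ 2)) as [|n]. rewrite sqrt_pow2; auto.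
    exfalso. apply n. apply pow2_ge_0.
Qed.
End Even.

Theorem whitney_even (f : R -> R) : locally 0 (smooth1_at f) -> (forall t, f (- t) = f t) ->
  exists F, locally 0 (smooth1_at F) /\ forall t, f t = F (t ^ 2).
Proof.
  intros Hf Hev. apply locally_near1 in Hf. destruct Hf as (e & He & Hf).
  set (good := fun g : R -> R => (forall t, near1 0 e t -> smooth1_at g t) /\ forall t, near1 0 e t -> g (- t) = g t).
  assert (Nopp : forall t, near1 0 e t -> near1 0 e (- t)).
  { intros t. unfold near1. rewrite !Rminus_0_r, Rabs_Ropp. auto. }
  (* The operator g -> g' / (2 t): the derivative of an even function is odd, so it vanishes at 0
     and is divisible by t. Keeping [good g] as a premise inside the existential makes the operator
     total, so it can be chosen once and iterated. *)
  assert (X : forall g, exists g1, good g -> good g1 /\ forall t, near1 0 e t -> Derive g t = 2 * t * g1 t).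
  { intros g. destruct (excluded_middle_informative (good g)) as [[Gs Ge]|]; [|exists g; tauto].
    assert (Dodd : forall t, near1 0 e t -> Derive g (- t) = - Derive g t).
    { intros t Ht. assert (is_derive (fun s => g (- s)) t (- 1 * Derive g (- t))) as K.
      { apply (is_derive_comp g (fun s => - s)). apply smooth1_at_is_derive, Gs, Nopp, Ht.
        auto_derive; auto. }
      apply (is_derive_ext_loc _ g) in K. apply is_derive_unique in K. rewrite K. ring.
      generalize (near1_open _ _ _ Ht). apply filter_imp. exact Ge. }
    assert (D0 : Derive g 0 = 0).
    { pose proof (Dodd 0 (near1_0 e He)) as K. rewrite Ropp_0 in K. lra. }
    destruct (hadamard_on (Derive g) e He) as (q & Hq & Eq & _).
    { intros t Ht. apply smooth1_at_Derive, Gs, Ht. }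
    exists (fun t => / 2 * q t). intros _. split; [split|].
    - intros t Ht. apply smooth1_at_mult. apply smooth1_at_const. apply Hq, Ht.
    - intros t Ht. destruct (Req_dec t 0) as [->|Hn]. rewrite Ropp_0. reflexivity.
      pose proof (Dodd t Ht) as K. rewrite (Eq (- t)), (Eq t), D0 in K. f_equal.
      apply Rmult_eq_reg_l with t; auto. lra.
    - intros t Ht. rewrite (Eq t), D0. field. }
  apply functional_choice in X. destruct X as [T HT].
  set (k := fun n => Nat.iter n T f).
  assert (Hk : forall n, good (k n)).
  { induction n as [|n IH]. split. exact Hf. intros t _; apply Hev.
    exact (proj1 (HT _ IH)). }
  destruct (even_as_function_of_square e k He) as (F & HF & EF).
  - intros n. apply Hk.
  - intros n. exact (proj2 (HT _ (Hk n))).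
  - exists F. split. apply locally_near1. exists (e * e). split; auto. apply Rmult_lt_0_compat; auto.
    intros t. destruct (Rle_dec 0 t). apply EF; auto.
    rewrite <- Hev. change (k O (- t) = F (t ^ 2)). rewrite EF by lra. f_equal. ring.
Qed.

Lemma locally_0_opp (P : R -> Prop) : locally 0 P -> locally 0 (fun t => P (- t)).
Proof.
  intros H. apply locally_near1 in H. destruct H as (e & He & H). apply locally_near1. exists e. split; auto.
  intros q Hq. apply H. unfold near1 in *. rewrite Rminus_0_r in *. rewrite Rabs_Ropp. exact Hq.
Qed.

Lemma even_odd_decomposition (f : R -> R) : locally 0 (smooth1_at f) ->
  exists a b, locally 0 (smooth1_at a) /\ locally 0 (smooth1_at b) /\ forall t, f t = a (t ^ 2) + t * b (t ^ 2).
Proof.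
  intros Hf. pose proof (locally_0_opp _ Hf) as Hf'.
  assert (Hs : forall s, locally 0 (smooth1_at (fun t => / 2 * (f t + s * f (- t))))).
  { intros s. generalize (filter_and _ _ Hf Hf'). apply filter_imp. intros t [A B].
    apply smooth1_at_mult. apply smooth1_at_const. apply smooth1_at_plus; auto.
    apply smooth1_at_mult. apply smooth1_at_const. apply (smooth1_at_comp f); auto.
    apply smooth1_at_opp, smooth1_at_id. }
  destruct (whitney_even _ (Hs 1)) as (a & Ha & Ea).
  { intros t. rewrite Ropp_involutive. ring. }
  destruct (hadamard _ (Hs (-1))) as (q & Hq & Eq & _).
  (* Averaging q with its reflection makes evenness immediate, and t times the average is still the
     odd part of f because t q(t) is odd. *)
  destruct (whitney_even (fun t => / 2 * (q t + q (- t)))) as (b & Hb & Eb).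
  { generalize (filter_and _ _ Hq (locally_0_opp _ Hq)). apply filter_imp. intros t [A B].
    apply smooth1_at_mult. apply smooth1_at_const. apply smooth1_at_plus; auto.
    apply (smooth1_at_comp q); auto. apply smooth1_at_opp, smooth1_at_id. }
  { intros t. rewrite Ropp_involutive. ring. }
  exists a, b. split; [|split]; auto. intros t. rewrite <- Ea, <- Eb.
  pose proof (Eq t) as E1. pose proof (Eq (- t)) as E2. rewrite Ropp_involutive in E2.
  rewrite Ropp_0 in E1, E2. lra.
Qed.

Lemma locally_0_comp (P : R -> Prop) (g : R -> R) : continuous g 0 -> g 0 = 0 -> locally 0 P -> locally 0 (fun t => P (g t)).
Proof. intros Hg G0 H. apply Hg. rewrite G0. exact H. Qed.

(** Malgrange division for the map t -> t^4, obtained by splitting into even and odd parts twice. *)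
Theorem decomposition_mod_4 (f : R -> R) : locally 0 (smooth1_at f) ->
  exists b0 b1 b2 b3, locally 0 (smooth1_at b0) /\ locally 0 (smooth1_at b1) /\
    locally 0 (smooth1_at b2) /\ locally 0 (smooth1_at b3) /\
    forall t, f t = b0 (t ^ 4) + t * b1 (t ^ 4) + t ^ 2 * b2 (t ^ 4) + t ^ 3 * b3 (t ^ 4).
Proof.
  intros Hf. destruct (even_odd_decomposition f Hf) as (a & b & Ha & Hb & E).
  destruct (even_odd_decomposition a Ha) as (b0 & b2 & H0 & H2 & Ea).
  destruct (even_odd_decomposition b Hb) as (b1 & b3 & H1 & H3 & Eb).
  exists b0, b1, b2, b3. repeat split; auto. intros t. rewrite E, Ea, Eb.
  replace ((t ^ 2) ^ 2) with (t ^ 4) by ring. ring.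
Qed.

(** * A-equivalence *)

Definition smooth_map_at (F : R * R -> R * R) (p : R * R) : Prop :=
  smooth_at (fun q => fst (F q)) p /\ smooth_at (fun q => snd (F q)) p.

Lemma smooth_map_at_continuous F p : smooth_map_at F p -> continuous F p.
Proof.
  intros [H1 H2]. apply (continuous_ext (fun q => (fst (F q), snd (F q)))).
  intros q. symmetry. apply surjective_pairing.
  apply continuous_pair; apply smooth_at_continuous; assumption.
Qed.

Lemma smooth_map_at_comp F G p : smooth_map_at G p -> smooth_map_at F (G p) ->
  smooth_map_at (fun q => F (G q)) p.
Proof.
  intros [G1 G2] HF. rewrite (surjective_pairing (G p)) in HF. destruct HF as [F1 F2]. split.
  - apply smooth_at_ext_loc with (fun q => fst (F (fst (G q), snd (G q)))).
    apply filter_forall. intros q. rewrite <- surjective_pairing. reflexivity.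
    apply (smooth_at_comp (fun r => fst (F r)) (fun q => fst (G q)) (fun q => snd (G q))); auto.
  - apply smooth_at_ext_loc with (fun q => snd (F (fst (G q), snd (G q)))).
    apply filter_forall. intros q. rewrite <- surjective_pairing. reflexivity.
    apply (smooth_at_comp (fun r => snd (F r)) (fun q => fst (G q)) (fun q => snd (G q))); auto.
Qed.

(** Filter form of [diffeo_germ1]: each identity holds near its own base point, so germs compose
    without choosing a common radius. *)
Definition local_diffeo1 (psi psii : R -> R) : Prop :=
  psi 0 = 0 /\ psii 0 = 0 /\
  locally 0 (fun t => smooth1_at psi t /\ psii (psi t) = t) /\
  locally 0 (fun t => smooth1_at psii t /\ psi (psii t) = t).

Definition local_diffeo2 (p q : R * R) (Psi Psii : R * R -> R * R) : Prop :=
  Psi p = q /\ Psii q = p /\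
  locally p (fun x => smooth_map_at Psi x /\ Psii (Psi x) = x) /\
  locally q (fun y => smooth_map_at Psii y /\ Psi (Psii y) = y).

Lemma diffeo_germ1_iff psi psii : diffeo_germ1 psi psii <-> local_diffeo1 psi psii.
Proof.
  split.
  - intros (A & B & e & He & S1 & S2 & I1 & I2). split; [|split; [|split]]; auto; apply locally_near1; exists e; split; auto;
    intros t Ht; split; auto; [apply (smooth1_on_smooth1_at _ _ S1) | apply (smooth1_on_smooth1_at _ _ S2)];
    apply near1_open, Ht.
  - intros (A & B & L1 & L2). apply locally_near1 in L1, L2. destruct L1 as (e1 & He1 & L1), L2 as (e2 & He2 & L2).
    assert (N1 : forall t, near1 0 (Rmin e1 e2) t -> near1 0 e1 t)
      by (intros t Ht; eapply Rlt_le_trans; [exact Ht|apply Rmin_l]).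
    assert (N2 : forall t, near1 0 (Rmin e1 e2) t -> near1 0 e2 t)
      by (intros t Ht; eapply Rlt_le_trans; [exact Ht|apply Rmin_r]).
    split; [|split]; auto. exists (Rmin e1 e2). split. apply Rmin_glb_lt; auto.
    repeat split; try apply smooth1_at_smooth1_on; intros t Ht; (apply L1, N1, Ht) || (apply L2, N2, Ht).
Qed.

Lemma diffeo_germ2_iff p q Psi Psii : diffeo_germ2 p q Psi Psii <-> local_diffeo2 p q Psi Psii.
Proof.
  split.
  - intros (A & B & e & He & [S1 S1'] & [S2 S2'] & I1 & I2). split; [|split; [|split]]; auto; apply locally_near2; exists e; split; auto;
    intros t Ht; split; auto; split.
    apply (smooth2_on_smooth_at _ _ S1), near2_open, Ht.
    apply (smooth2_on_smooth_at _ _ S1'), near2_open, Ht.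
    apply (smooth2_on_smooth_at _ _ S2), near2_open, Ht.
    apply (smooth2_on_smooth_at _ _ S2'), near2_open, Ht.
  - intros (A & B & L1 & L2). apply locally_near2 in L1, L2. destruct L1 as (e1 & He1 & L1), L2 as (e2 & He2 & L2).
    assert (N1 : forall t, near2 p (Rmin e1 e2) t -> near2 p e1 t)
      by (intros t [H1 H2]; split; (eapply Rlt_le_trans; [eassumption|apply Rmin_l])).
    assert (N2 : forall t, near2 q (Rmin e1 e2) t -> near2 q e2 t)
      by (intros t [H1 H2]; split; (eapply Rlt_le_trans; [eassumption|apply Rmin_r])).
    split; [|split]; auto. exists (Rmin e1 e2). split. apply Rmin_glb_lt; auto.
    split; [split|split; [split|split]]; try apply smooth_at_smooth2_on; intros t Ht;
    (apply L1, N1, Ht) || (apply L2, N2, Ht).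
Qed.

Lemma A_equiv_iff g1 g2 : A_equiv g1 g2 <->
  exists psi psii Psi Psii, local_diffeo1 psi psii /\ local_diffeo2 (g1 0) (g2 0) Psi Psii /\
    locally 0 (fun t => Psi (g1 (psii t)) = g2 t).
Proof.
  split; intros (psi & psii & Psi & Psii & H1 & H2 & H3); exists psi, psii, Psi, Psii.
  - split; [|split]. apply diffeo_germ1_iff, H1. apply diffeo_germ2_iff, H2. apply locally_near1, H3.
  - split; [|split]. apply diffeo_germ1_iff, H1. apply diffeo_germ2_iff, H2. apply locally_near1, H3.
Qed.

Lemma locally_comp1 (f : R -> R) x (P : R -> Prop) : smooth1_at f x -> locally (f x) P -> locally x (fun t => P (f t)).
Proof. intros H HP. exact (smooth1_at_continuous f x H P HP). Qed.

Lemma locally_comp2 F p (P : R * R -> Prop) : smooth_map_at F p -> locally (F p) P -> locally p (fun t => P (F t)).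
Proof. intros H HP. exact (smooth_map_at_continuous F p H P HP). Qed.

Lemma local_diffeo1_id : local_diffeo1 (fun t => t) (fun t => t).
Proof.
  repeat split; apply locally_all; intros t; split; auto using smooth1_at_id.
Qed.

Lemma local_diffeo2_id p : local_diffeo2 p p (fun q => q) (fun q => q).
Proof.
  repeat split; apply filter_forall; intros q; repeat split; auto; apply smooth_at_fst || apply smooth_at_snd.
Qed.

Lemma A_equiv_reparam g1 g2 psi psii : local_diffeo1 psi psii ->
  locally 0 (fun t => g1 (psii t) = g2 t) -> A_equiv g1 g2.
Proof.
  intros H E. apply A_equiv_iff. exists psi, psii, (fun q => q), (fun q => q).
  split; [|split]; auto. pose proof (locally_at_point _ _ _ E) as E0. simpl in E0.
  destruct H as (_ & P0 & _). rewrite P0 in E0. rewrite E0. apply local_diffeo2_id.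
Qed.

Lemma A_equiv_target g1 g2 Psi Psii : local_diffeo2 (g1 0) (g2 0) Psi Psii ->
  locally 0 (fun t => Psi (g1 t) = g2 t) -> A_equiv g1 g2.
Proof.
  intros H E. apply A_equiv_iff. exists (fun t => t), (fun t => t), Psi, Psii.
  split; [|split]; auto. apply local_diffeo1_id.
Qed.

Lemma A_equiv_refl g : A_equiv g g.
Proof.
  apply (A_equiv_target g g (fun q => q) (fun q => q)). apply local_diffeo2_id.
  apply locally_all. reflexivity.
Qed.

Lemma A_equiv_trans g1 g2 g3 : A_equiv g1 g2 -> A_equiv g2 g3 -> A_equiv g1 g3.
Proof.
  intros H H'. apply A_equiv_iff in H, H'. apply A_equiv_iff.
  destruct H as (f & fi & F & Fi & (f0 & fi0 & fS & fiS) & (F0 & Fi0 & FS & FiS) & E).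
  destruct H' as (h & hi & H & Hi & (h0 & hi0 & hS & hiS) & (H0 & Hi0 & HS & HiS) & E').
  exists (fun t => h (f t)), (fun t => fi (hi t)), (fun q => H (F q)), (fun q => Fi (Hi q)).
  pose proof (proj1 (locally_at_point _ _ _ fS)) as cf. pose proof (proj1 (locally_at_point _ _ _ hiS)) as chi.
  pose proof (proj1 (locally_at_point _ _ _ FS)) as cF. pose proof (proj1 (locally_at_point _ _ _ HiS)) as cHi.
  split; [|split].
  - split; [|split; [|split]].
    + rewrite f0; auto.
    + rewrite hi0; auto.
    + rewrite <- f0 in hS. pose proof (locally_comp1 f 0 _ cf hS) as L.
      generalize (filter_and _ _ fS L). apply filter_imp. intros t ((A & B) & C & D). split.
      apply (smooth1_at_comp h f); auto. rewrite D. exact B.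
    + rewrite <- hi0 in fiS. pose proof (locally_comp1 hi 0 _ chi fiS) as L.
      generalize (filter_and _ _ hiS L). apply filter_imp. intros t ((A & B) & C & D). split.
      apply (smooth1_at_comp fi hi); auto. rewrite D. exact B.
  - split; [|split; [|split]].
    + rewrite F0; auto.
    + rewrite Hi0; auto.
    + rewrite <- F0 in HS. pose proof (locally_comp2 F _ _ cF HS) as L.
      generalize (filter_and _ _ FS L). apply filter_imp. intros t ((A & B) & C & D). split.
      apply (smooth_map_at_comp H F); auto. rewrite D. exact B.
    + rewrite <- Hi0 in FiS. pose proof (locally_comp2 Hi _ _ cHi FiS) as L.
      generalize (filter_and _ _ HiS L). apply filter_imp. intros t ((A & B) & C & D). split.
      apply (smooth_map_at_comp Fi Hi); auto. rewrite D. exact B.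
  - rewrite <- hi0 in E. pose proof (locally_comp1 hi 0 _ chi E) as L.
    generalize (filter_and _ _ E' L). apply filter_imp. intros t (A & B). rewrite B. exact A.
Qed.

(* Along the segment from 0 the error has derivative (Fx - a) x + (Fy - b) y, which is itself of first order. *)
Lemma second_order_expansion F : locally (0, 0) (smooth_at F) ->
  exists C, locally (0, 0) (fun q => Rabs (F q - (F (0, 0) + pd true F (0, 0) * fst q + pd false F (0, 0) * snd q))
    <= C * (Rabs (fst q) + Rabs (snd q)) ^ 2).
Proof.
  intros HF.
  assert (X : forall b, exists C, 0 <= C /\ locally (0, 0) (fun q => Rabs (pd b F q - pd b F (0, 0)) <= C * (Rabs (fst q) + Rabs (snd q)))).
  { intros b. pose proof (smooth_at_D2 _ _ (smooth_at_pd _ _ b (locally_at_point _ _ _ HF))) as D.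
    set (u := pd true (pd b F) (0, 0)) in *. set (v := pd false (pd b F) (0, 0)) in *.
    exists (Rabs u + Rabs v + 1). split. pose proof (Rabs_pos u). pose proof (Rabs_pos v). lra.
    destruct (D (mkposreal _ Rlt_0_1)) as [d Hd]. apply locally_near2. exists d. split. apply cond_pos.
    intros [x y] [Hx Hy]. specialize (Hd x y Hx Hy). simpl in Hd |- *. rewrite !Rminus_0_r in Hd.
    replace (pd b F (x, y) - pd b F (0, 0)) with ((pd b F (x, y) - pd b F (0, 0) - (u * x + v * y)) + (u * x + v * y)) by ring.
    eapply Rle_trans; [apply Rabs_triang|].
    assert (Rabs (u * x + v * y) <= Rabs u * Rabs x + Rabs v * Rabs y) by (rewrite <- !Rabs_mult; apply Rabs_triang).
    pose proof (Rabs_pos x). pose proof (Rabs_pos y). pose proof (Rabs_pos u). pose proof (Rabs_pos v).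
    assert (Rmax (Rabs x) (Rabs y) <= Rabs x + Rabs y) by (apply Rmax_lub; lra).
    assert (0 <= Rabs u * Rabs y) by (apply Rmult_le_pos; auto).
    assert (0 <= Rabs v * Rabs x) by (apply Rmult_le_pos; auto). lra. }
  destruct (X true) as (C1 & HC1 & L1). destruct (X false) as (C2 & HC2 & L2).
  pose proof (filter_and _ _ HF (filter_and _ _ L1 L2)) as L. apply locally_near2 in L. destruct L as (e & He & L).
  exists (C1 + C2). apply locally_near2. exists e. split; auto. intros [x y] [Hx Hy]. simpl in Hx, Hy. rewrite Rminus_0_r in Hx, Hy.
  set (a := pd true F (0, 0)) in *. set (b := pd false F (0, 0)) in *. simpl fst; simpl snd.
  assert (N : forall t, 0 <= t <= 1 -> near2 (0, 0) e (t * x, t * y)).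
  { intros t Ht. split; simpl; rewrite Rminus_0_r, Rabs_mult, (Rabs_pos_eq t) by lra;
    [apply Rle_lt_trans with (1 * Rabs x) | apply Rle_lt_trans with (1 * Rabs y)];
    try (apply Rmult_le_compat_r; [apply Rabs_pos|]); lra. }
  assert (Dk : forall t, 0 <= t <= 1 -> is_derive (fun t => F (t * x, t * y) - (a * (t * x) + b * (t * y))) t
    ((pd true F (t * x, t * y) - a) * x + (pd false F (t * x, t * y) - b) * y)).
  { intros t Ht. replace ((pd true F (t * x, t * y) - a) * x + (pd false F (t * x, t * y) - b) * y)
      with ((pd true F (t * x, t * y) * x + pd false F (t * x, t * y) * y) - (a * x + b * y)) by ring.
    apply (is_derive_minus (fun t => F (t * x, t * y)) (fun t => a * (t * x) + b * (t * y))).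
    - apply is_derive_Reals. apply (derivable_pt_lim_comp_2d (fun u v => F (u, v)) (fun t => t * x) (fun t => t * y)).
      apply (smooth_at_D2 F (t * x, t * y)), (L (t * x, t * y)), N, Ht.
      apply is_derive_Reals. auto_derive; auto; ring. apply is_derive_Reals. auto_derive; auto; ring.
    - auto_derive; auto; ring. }
  destruct (MVT_gen (fun t => F (t * x, t * y) - (a * (t * x) + b * (t * y))) 0 1
    (fun t => (pd true F (t * x, t * y) - a) * x + (pd false F (t * x, t * y) - b) * y)) as (xi & Hxi & E).
  - intros t Ht. rewrite Rmin_left, Rmax_right in Ht by lra. apply Dk; lra.
  - intros t Ht. rewrite Rmin_left, Rmax_right in Ht by lra. apply continuity_pt_filterlim.
    apply (ex_derive_continuous (fun t => F (t * x, t * y) - (a * (t * x) + b * (t * y)))). eexists. apply Dk; lra.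
  - rewrite Rmin_left, Rmax_right in Hxi by lra. cbv beta in E. rewrite !Rmult_0_l, !Rmult_1_l in E.
    destruct (L _ (N xi Hxi)) as (_ & B1 & B2). simpl fst in B1, B2; simpl snd in B1, B2.
    fold a in B1. fold b in B2.
    replace (F (x, y) - (F (0, 0) + a * x + b * y)) with
     ((pd true F (xi * x, xi * y) - a) * x + (pd false F (xi * x, xi * y) - b) * y) by lra.
    assert (T : Rabs (xi * x) + Rabs (xi * y) <= Rabs x + Rabs y).
    { rewrite !Rabs_mult, (Rabs_pos_eq xi) by lra.
      assert (xi * Rabs x <= 1 * Rabs x) by (apply Rmult_le_compat_r; [apply Rabs_pos|lra]).
      assert (xi * Rabs y <= 1 * Rabs y) by (apply Rmult_le_compat_r; [apply Rabs_pos|lra]). lra. }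
    eapply Rle_trans; [apply Rabs_triang|]. rewrite !Rabs_mult.
    set (n := Rabs x + Rabs y) in *.
    assert (Rabs x <= n) by (unfold n; pose proof (Rabs_pos y); lra).
    assert (Rabs y <= n) by (unfold n; pose proof (Rabs_pos x); lra).
    assert (0 <= n) by (pose proof (Rabs_pos x); lra).
    replace ((C1 + C2) * n ^ 2) with (C1 * n * n + C2 * n * n) by ring.
    apply Rplus_le_compat; apply Rmult_le_compat; auto using Rabs_pos.
    eapply Rle_trans; [exact B1|]. apply Rmult_le_compat_l; auto.
    eapply Rle_trans; [exact B2|]. apply Rmult_le_compat_l; auto.
Qed.

(** * Invariants of the 7-jet *)

(** By the chain rule for Psi after Psii the two Jacobian matrices multiply to the identity, and
    determinants are multiplicative. *)
Lemma local_diffeo2_jacobian p q Psi Psii : local_diffeo2 p q Psi Psii ->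
  pd true (fun r => fst (Psii r)) q * pd false (fun r => snd (Psii r)) q
  - pd false (fun r => fst (Psii r)) q * pd true (fun r => snd (Psii r)) q <> 0.
Proof.
  intros (_ & q0 & L1 & L2).
  destruct (proj1 (locally_at_point _ _ _ L1)) as [P1 P2]. destruct (proj1 (locally_at_point _ _ _ L2)) as [Q1 Q2].
  rewrite <- q0, (surjective_pairing (Psii q)) in P1, P2.
  pose proof (smooth_at_D2 _ _ P1) as DP1. pose proof (smooth_at_D2 _ _ P2) as DP2.
  pose proof (smooth_at_D2 _ _ Q1) as DQ1. pose proof (smooth_at_D2 _ _ Q2) as DQ2.
  set (a := pd true (fun r => fst (Psii r)) q) in *. set (b := pd false (fun r => fst (Psii r)) q) in *.
  set (c := pd true (fun r => snd (Psii r)) q) in *. set (d := pd false (fun r => snd (Psii r)) q) in *.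
  pose proof (has_gradient_comp (fun r => fst (Psi r)) (fun r => fst (Psii r)) (fun r => snd (Psii r)) q _ _ _ _ _ _ DP1 DQ1 DQ2) as E1.
  pose proof (has_gradient_comp (fun r => snd (Psi r)) (fun r => fst (Psii r)) (fun r => snd (Psii r)) q _ _ _ _ _ _ DP2 DQ1 DQ2) as E2.
  assert (F1 : has_gradient (fun r => 1 * fst r + 0 * snd r) q 1 0) by apply has_gradient_lin.
  assert (F2 : has_gradient (fun r => 0 * fst r + 1 * snd r) q 0 1) by apply has_gradient_lin.
  assert (Y1 : forall r : R * R, Psi (Psii r) = r -> fst (Psi (fst (Psii r), snd (Psii r))) = 1 * fst r + 0 * snd r).
  { intros r Hr. rewrite <- surjective_pairing, Hr. ring. }
  assert (Y2 : forall r : R * R, Psi (Psii r) = r -> snd (Psi (fst (Psii r), snd (Psii r))) = 0 * fst r + 1 * snd r).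
  { intros r Hr. rewrite <- surjective_pairing, Hr. ring. }
  apply (has_gradient_ext_loc _ (fun r => 1 * fst r + 0 * snd r)) in E1.
  2:{ revert L2. apply filter_imp. intros r [_ Hr]. apply (Y1 r Hr). }
  apply (has_gradient_ext_loc _ (fun r => 0 * fst r + 1 * snd r)) in E2.
  2:{ revert L2. apply filter_imp. intros r [_ Hr]. apply (Y2 r Hr). }
  apply has_gradient_unique in E1, E2, F1, F2.
  destruct E1 as [E1 E1'], E2 as [E2 E2'], F1 as [F1 F1'], F2 as [F2 F2'].
  apply (eq_trans (eq_sym E1)) in F1. apply (eq_trans (eq_sym E1')) in F1'.
  apply (eq_trans (eq_sym E2)) in F2. apply (eq_trans (eq_sym E2')) in F2'.
  set (s := pd true (fun r => fst (Psi r)) _) in *. set (t := pd false (fun r => fst (Psi r)) _) in *.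
  set (u := pd true (fun r => snd (Psi r)) _) in *. set (v := pd false (fun r => snd (Psi r)) _) in *.
  intros Z.
  assert (K : (s * v - t * u) * (a * d - b * c) = (s * a + t * c) * (u * b + v * d) - (s * b + t * d) * (u * a + v * c)) by ring.
  rewrite F1, F1', F2, F2', Z in K. lra.
Qed.

Lemma local_diffeo1_derivative psi psii : local_diffeo1 psi psii -> Derive psi 0 <> 0.
Proof.
  intros (p0 & _ & L1 & L2) Z.
  pose proof (smooth1_at_is_derive _ _ (proj1 (locally_at_point _ _ _ L1))) as D1.
  pose proof (smooth1_at_is_derive _ _ (proj1 (locally_at_point _ _ _ L2))) as D2.
  rewrite <- p0 in D2 at 1. pose proof (is_derive_comp psii psi 0 _ _ D2 D1) as D.
  apply (is_derive_ext_loc _ (fun t => t)) in D.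
  2:{ revert L1. apply filter_imp. intros t [_ H]. exact H. }
  apply is_derive_unique in D. rewrite Z in D. rewrite Derive_id in D.
  unfold scal in D; simpl in D; unfold mult in D; simpl in D. lra.
Qed.

Lemma smooth_curve_germ_iff g : smooth_curve_germ g <->
  locally 0 (smooth1_at (fun t => fst (g t))) /\ locally 0 (smooth1_at (fun t => snd (g t))).
Proof.
  split.
  - intros (e & He & S1 & S2). split; apply locally_near1; exists e; split; auto; intros t Ht;
    [apply (smooth1_on_smooth1_at _ _ S1) | apply (smooth1_on_smooth1_at _ _ S2)]; apply near1_open, Ht.
  - intros [L1 L2]. pose proof (filter_and _ _ L1 L2) as L. apply locally_near1 in L. destruct L as (e & He & L).
    exists e. split; auto. split; apply smooth1_at_smooth1_on; apply L.
Qed.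

Lemma continuous_curve (g : R -> R * R) x :
  continuous (fun t => fst (g t)) x -> continuous (fun t => snd (g t)) x -> continuous g x.
Proof.
  intros H1 H2 P [e HP].
  pose proof (H1 (fun z => ball (fst (g x)) e z) (locally_ball _ e)) as L1.
  pose proof (H2 (fun z => ball (snd (g x)) e z) (locally_ball _ e)) as L2.
  change (locally x (fun t => P (g t))). unfold filtermap in *.
  generalize (filter_and _ _ L1 L2). apply filter_imp. intros t [A B]. apply HP. split; assumption.
Qed.

(** Solving for g expresses it through h, whose jet is explicit. Continuity of g at 0 keeps g t
    where Psii inverts Psi. *)
Lemma A_equiv_pullback g h : smooth_curve_germ g -> A_equiv g h ->
  exists psi psii Psi Psii, local_diffeo1 psi psii /\ local_diffeo2 (g 0) (h 0) Psi Psii /\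
    locally 0 (fun t => g t = Psii (h (psi t))).
Proof.
  intros Hg H. apply A_equiv_iff in H. destruct H as (f & fi & F & Fi & Hf & HF & E).
  exists f, fi, F, Fi. split; [|split]; auto.
  destruct Hf as (f0 & fi0 & L1 & L2), HF as (F0 & Fi0 & M1 & M2).
  apply smooth_curve_germ_iff in Hg. destruct Hg as [G1 G2].
  assert (cg : continuous g 0).
  { apply continuous_curve; apply smooth1_at_continuous. apply (locally_at_point _ _ _ G1). apply (locally_at_point _ _ _ G2). }
  pose proof (cg _ M1) as K. change (locally 0 (fun t => smooth_map_at F (g t) /\ Fi (F (g t)) = g t)) in K.
  rewrite <- f0 in E. pose proof (locally_comp1 f 0 _ (proj1 (locally_at_point _ _ _ L1)) E) as E'.
  generalize (filter_and _ _ (filter_and _ _ K L1) E'). apply filter_imp.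
  intros t (((_ & A) & _ & B) & C). rewrite B in C. rewrite <- C. symmetry. exact A.
Qed.

Definition list_coef (l : list R) (k : nat) : R := nth k l 0.

Lemma locally_smooth1_mult f g : locally 0 (smooth1_at f) -> locally 0 (smooth1_at g) ->
  locally 0 (smooth1_at (fun t => f t * g t)).
Proof. intros A B. generalize (filter_and _ _ A B). apply filter_imp. intros t [C D]. apply smooth1_at_mult; auto. Qed.
Lemma locally_smooth1_plus f g : locally 0 (smooth1_at f) -> locally 0 (smooth1_at g) ->
  locally 0 (smooth1_at (fun t => f t + g t)).
Proof. intros A B. generalize (filter_and _ _ A B). apply filter_imp. intros t [C D]. apply smooth1_at_plus; auto. Qed.
Lemma locally_smooth1_pow f n : locally 0 (smooth1_at f) -> locally 0 (smooth1_at (fun t => f t ^ n)).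
Proof. apply filter_imp. intros t. apply smooth1_at_pow. Qed.
Lemma locally_smooth1_const c : locally 0 (smooth1_at (fun _ => c)).
Proof. apply locally_all. intros t. apply smooth1_at_const. Qed.
Lemma locally_smooth1_id : locally 0 (smooth1_at (fun t => t)).
Proof. apply locally_all. intros t. apply smooth1_at_id. Qed.
Lemma locally_smooth1_comp f g : g 0 = 0 -> locally 0 (smooth1_at f) -> locally 0 (smooth1_at g) ->
  locally 0 (smooth1_at (fun t => f (g t))).
Proof.
  intros g0 Hf Hg. rewrite <- g0 in Hf.
  pose proof (locally_comp1 g 0 _ (locally_at_point _ _ _ Hg) Hf) as L.
  generalize (filter_and _ _ Hg L). apply filter_imp. intros t [A B]. apply (smooth1_at_comp f g); auto.
Qed.
Lemma locally_smooth1_bounded f : locally 0 (smooth1_at f) -> exists C, locally 0 (fun t => Rabs (f t) <= C).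
Proof. intros H. apply continuous_bounded_near, smooth1_at_continuous, (locally_at_point _ _ _ H). Qed.

(** Only constants, the identity, sums, products and powers are treated, besides hypotheses; this is
    why differences of functions in the witnesses below are written with a factor -1. *)
Ltac smooth_near :=
  repeat match goal with
  | H : locally 0 (smooth1_at ?f) |- locally 0 (smooth1_at ?f) => exact H
  | H : locally 0 (smooth1_at ?f) |- locally 0 (smooth1_at (fun t => ?f t)) => exact H
  | |- locally 0 (smooth1_at (fun t => ?c)) => exact (locally_smooth1_const c)
  | |- locally 0 (smooth1_at (fun t => t)) => exact locally_smooth1_id
  | |- locally 0 (smooth1_at (fun t => @?f t + @?g t)) => apply (locally_smooth1_plus f g)
  | |- locally 0 (smooth1_at (fun t => @?f t * @?g t)) => apply (locally_smooth1_mult f g)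
  | |- locally 0 (smooth1_at (fun t => @?f t ^ ?n)) => apply (locally_smooth1_pow f n)
  end.

(* Since x ~ t^4 and y ~ t^5 along h, only the linear part of the target map is seen by the 7-jet. *)
Lemma jet_of_pulled_back_component F psi e z (f : R -> R) a b c d r :
  locally (0, 0) (smooth_at F) -> locally 0 (smooth1_at f) ->
  locally 0 (smooth1_at z) -> locally 0 (smooth1_at r) -> locally 0 (smooth1_at psi) ->
  (forall t, psi t = t * (a + t * (b + t * (c + t * (d + t * r t))))) ->
  locally 0 (fun t => f t = F (psi t ^ 4, psi t ^ 5 + e * psi t ^ 7 + psi t ^ 8 * z (psi t))) ->
  forall k, (k < 8)%nat ->
    Derive_n f k 0 = INR (fact k) * let al := pd true F (0, 0) in let be := pd false F (0, 0) in
      list_coef (F (0, 0) :: 0 :: 0 :: 0 :: al * a ^ 4 :: (al * (4 * a ^ 3 * b) + be * a ^ 5)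
        :: (al * (4 * a ^ 3 * c + 6 * a ^ 2 * b ^ 2) + be * (5 * a ^ 4 * b))
        :: (al * (4 * a ^ 3 * d + 12 * a ^ 2 * b * c + 4 * a * b ^ 3)
            + be * (5 * a ^ 4 * c + 10 * a ^ 3 * b ^ 2 + e * a ^ 7)) :: nil) k.
Proof.
  intros HF Hf Hz Hr Hpsi Epsi Ef k Hk.
  set (al := pd true F (0, 0)). set (be := pd false F (0, 0)). cbv zeta.
  assert (psi0 : psi 0 = 0) by (rewrite Epsi; ring).
  set (p3 := fun t => d + t * r t). set (p2 := fun t => c + t * p3 t).
  set (p1 := fun t => b + t * p2 t). set (p0 := fun t => a + t * p1 t).
  assert (H3 : locally 0 (smooth1_at p3)) by (unfold p3; smooth_near).
  assert (H2 : locally 0 (smooth1_at p2)) by (unfold p2; smooth_near).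
  assert (H1 : locally 0 (smooth1_at p1)) by (unfold p1; smooth_near).
  assert (H0 : locally 0 (smooth1_at p0)) by (unfold p0; smooth_near).
  assert (Hzp : locally 0 (smooth1_at (fun t => z (psi t)))) by (apply locally_smooth1_comp; auto).
  (* [EX] and [EY] are the exact quotients by t^8 of what the 7-jets of x and y leave out. The long
     factor after [e] is (p0 ^ 7 - a ^ 7) / (p0 - a), where p0 - a = t * p1. *)
  set (EX := fun t => 4 * a ^ 3 * r t + 12 * a ^ 2 * b * p3 t + 6 * a ^ 2 * p2 t ^ 2
     + 4 * a * (3 * b ^ 2 * p2 t + 3 * b * t * p2 t ^ 2 + t ^ 2 * p2 t ^ 3) + p1 t ^ 4).
  set (EY := fun t => (5 * a ^ 4 * p3 t + 10 * a ^ 3 * (2 * b * p2 t + t * p2 t ^ 2) + 10 * a ^ 2 * p1 t ^ 3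
       + 5 * a * t * p1 t ^ 4 + t ^ 2 * p1 t ^ 5)
     + e * (p1 t * (p0 t ^ 6 + a * p0 t ^ 5 + a ^ 2 * p0 t ^ 4 + a ^ 3 * p0 t ^ 3 + a ^ 4 * p0 t ^ 2 + a ^ 5 * p0 t + a ^ 6))
     + p0 t ^ 8 * z (psi t)).
  set (X := fun t => psi t ^ 4). set (Y := fun t => psi t ^ 5 + e * psi t ^ 7 + psi t ^ 8 * z (psi t)).
  assert (EqX : forall t, X t = a ^ 4 * t ^ 4 + 4 * a ^ 3 * b * t ^ 5 + (4 * a ^ 3 * c + 6 * a ^ 2 * b ^ 2) * t ^ 6
     + (4 * a ^ 3 * d + 12 * a ^ 2 * b * c + 4 * a * b ^ 3) * t ^ 7 + t ^ 8 * EX t).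
  { intros t. unfold X, EX, p1, p2, p3. rewrite Epsi. ring. }
  assert (EqY : forall t, Y t = a ^ 5 * t ^ 5 + 5 * a ^ 4 * b * t ^ 6
     + (5 * a ^ 4 * c + 10 * a ^ 3 * b ^ 2 + e * a ^ 7) * t ^ 7 + t ^ 8 * EY t).
  { intros t. unfold Y, EY. generalize (z (psi t)). intros w. unfold p0, p1, p2, p3. rewrite Epsi. ring. }
  assert (X4 : forall t, X t = t ^ 4 * p0 t ^ 4) by (intros t; unfold X, p0, p1, p2, p3; rewrite Epsi; ring).
  assert (Y4 : forall t, Y t = t ^ 4 * (t * p0 t ^ 5 + e * t ^ 3 * p0 t ^ 7 + t ^ 4 * p0 t ^ 8 * z (psi t))).
  { intros t. unfold Y. generalize (z (psi t)). intros w. unfold p0, p1, p2, p3. rewrite Epsi. ring. }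
  assert (HX : locally 0 (smooth1_at X)) by (unfold X; smooth_near).
  assert (HY : locally 0 (smooth1_at Y)) by (unfold Y; smooth_near).
  destruct (locally_smooth1_bounded (fun t => al * EX t + be * EY t)) as (C1 & B1).
  { unfold EX, EY. smooth_near. }
  destruct (locally_smooth1_bounded (fun t => p0 t ^ 4)) as (C2 & B2). smooth_near.
  destruct (locally_smooth1_bounded (fun t => t * p0 t ^ 5 + e * t ^ 3 * p0 t ^ 7 + t ^ 4 * p0 t ^ 8 * z (psi t))) as (C3 & B3).
  { smooth_near. }
  destruct (second_order_expansion F HF) as (C & HC). fold al be in HC.
  assert (LC : locally 0 (fun t => Rabs (F (X t, Y t) - (F (0, 0) + al * X t + be * Y t)) <= C * (Rabs (X t) + Rabs (Y t)) ^ 2)).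
  { assert (c2 : continuous (fun t => (X t, Y t)) 0).
    { apply continuous_curve; apply smooth1_at_continuous; [exact (locally_at_point _ _ _ HX)|exact (locally_at_point _ _ _ HY)]. }
    assert (XY0 : (X 0, Y 0) = (0, 0)) by (unfold X, Y; rewrite psi0; f_equal; ring).
    rewrite <- XY0 in HC at 1. exact (c2 _ HC). }
  rewrite (derivatives_of_jet 8 f (list_coef (F (0, 0) :: 0 :: 0 :: 0 :: al * a ^ 4 :: (al * (4 * a ^ 3 * b) + be * a ^ 5)
        :: (al * (4 * a ^ 3 * c + 6 * a ^ 2 * b ^ 2) + be * (5 * a ^ 4 * b))
        :: (al * (4 * a ^ 3 * d + 12 * a ^ 2 * b * c + 4 * a * b ^ 3)
            + be * (5 * a ^ 4 * c + 10 * a ^ 3 * b ^ 2 + e * a ^ 7)) :: nil)) (Rabs C * (C2 + C3) ^ 2 + C1)); auto.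
  - apply Rmult_comm.
  - generalize (filter_and _ _ (filter_and _ _ Ef LC) (filter_and _ _ B1 (filter_and _ _ B2 B3))). apply filter_imp.
    intros t ((E & L) & b1 & b2 & b3). rewrite E. fold (X t). fold (Y t).
    (* The error splits into the nonlinear part of F, bounded by a multiple of (|X| + |Y|)^2 with X
       and Y divisible by t^4, and the t^8 remainders of X and Y under the linear part. *)
    match goal with |- Rabs (_ - ?P) <= _ =>
      replace (F (X t, Y t) - P) with ((F (X t, Y t) - (F (0, 0) + al * X t + be * Y t)) + t ^ 8 * (al * EX t + be * EY t))
    end.
    2:{ rewrite EqX, EqY. unfold list_coef. simpl. ring. }
    eapply Rle_trans; [apply Rabs_triang|]. rewrite (Rabs_mult (t ^ 8)), <- RPow_abs.
    assert (T8 : 0 <= Rabs t ^ 8) by (apply pow_le, Rabs_pos).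
    assert (T4 : 0 <= Rabs t ^ 4) by (apply pow_le, Rabs_pos).
    rewrite Rmult_plus_distr_r. apply Rplus_le_compat; [|rewrite Rmult_comm; apply Rmult_le_compat_r; auto].
    eapply Rle_trans; [exact L|].
    assert (N : Rabs (X t) + Rabs (Y t) <= Rabs t ^ 4 * (C2 + C3)).
    { rewrite X4, Y4, !(Rabs_mult (t ^ 4)), <- !(RPow_abs t). rewrite Rmult_plus_distr_l.
      apply Rplus_le_compat; apply Rmult_le_compat_l; auto. }
    assert (N0 : 0 <= Rabs (X t) + Rabs (Y t)) by (pose proof (Rabs_pos (X t)); pose proof (Rabs_pos (Y t)); lra).
    apply Rle_trans with (Rabs C * (Rabs t ^ 4 * (C2 + C3)) ^ 2).
    + apply Rle_trans with (Rabs C * (Rabs (X t) + Rabs (Y t)) ^ 2).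
      apply Rmult_le_compat_r. apply pow2_ge_0. apply Rle_abs.
      apply Rmult_le_compat_l. apply Rabs_pos. apply pow_incr; auto.
    + right. ring.
Qed.

(** Only the 7-jet matters, so z is left arbitrary; the statement then applies to the cusps and also
    to the intermediate normal form, whose e is not yet known. *)
Theorem A_equiv_normal_form_invariants g h e z : smooth_curve_germ g ->
  locally 0 (smooth1_at z) -> locally 0 (fun t => h t = (t ^ 4, t ^ 5 + e * t ^ 7 + t ^ 8 * z t)) ->
  A_equiv g h ->
  dcurve g 1 0 = (0, 0) /\ dcurve g 2 0 = (0, 0) /\ dcurve g 3 0 = (0, 0) /\ coefA g <> 0 /\
  exists K, 0 < K /\ invariant45 g = K * e.
Proof.
  intros Hg Hz Eh HA. destruct (A_equiv_pullback g h Hg HA) as (psi & psii & F & G & Hpsi & HF & E).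
  pose proof (local_diffeo1_derivative _ _ Hpsi) as Dpsi.
  pose proof (local_diffeo2_jacobian _ _ _ _ HF) as J.
  destruct Hpsi as (psi0 & _ & L1 & _). destruct HF as (_ & _ & _ & L2).
  assert (h0 : h 0 = (0, 0)).
  { rewrite (locally_at_point _ _ _ Eh). f_equal; ring. }
  rewrite h0 in J, L2.
  assert (Spsi : locally 0 (smooth1_at psi)) by (revert L1; apply filter_imp; tauto).
  assert (SG1 : locally (0, 0) (smooth_at (fun q => fst (G q)))) by (revert L2; apply filter_imp; unfold smooth_map_at; tauto).
  assert (SG2 : locally (0, 0) (smooth_at (fun q => snd (G q)))) by (revert L2; apply filter_imp; unfold smooth_map_at; tauto).
  destruct (taylor_smooth_remainder 5 psi Spsi) as (r & Hr & Er).
  set (co := fun k => Derive_n psi k 0 / INR (fact k)) in Er.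
  set (a := co 1%nat). set (b := co 2%nat). set (c := co 3%nat). set (d := co 4%nat).
  assert (a0 : a <> 0).
  { unfold a, co. change (Derive psi 0 / 1 <> 0). unfold Rdiv. rewrite Rinv_1, Rmult_1_r. exact Dpsi. }
  assert (Epsi : forall t, psi t = t * (a + t * (b + t * (c + t * (d + t * r t))))).
  { intros t. rewrite Er. simpl. fold a b c d.
    replace (co 0%nat) with 0. ring. unfold co. simpl. rewrite psi0. field. }
  apply smooth_curve_germ_iff in Hg. destruct Hg as [Hg1 Hg2].
  rewrite <- psi0 in Eh. pose proof (locally_comp1 psi 0 _ (locally_at_point _ _ _ Spsi) Eh) as Eh'.
  assert (E1 : locally 0 (fun t => fst (g t) = fst (G (psi t ^ 4, psi t ^ 5 + e * psi t ^ 7 + psi t ^ 8 * z (psi t))))).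
  { generalize (filter_and _ _ E Eh'). apply filter_imp. intros t [A B]. rewrite A, B. reflexivity. }
  assert (E2 : locally 0 (fun t => snd (g t) = snd (G (psi t ^ 4, psi t ^ 5 + e * psi t ^ 7 + psi t ^ 8 * z (psi t))))).
  { generalize (filter_and _ _ E Eh'). apply filter_imp. intros t [A B]. rewrite A, B. reflexivity. }
  pose proof (jet_of_pulled_back_component (fun q => fst (G q)) psi e z (fun t => fst (g t)) a b c d r SG1 Hg1 Hz Hr Spsi Epsi E1) as J1.
  pose proof (jet_of_pulled_back_component (fun q => snd (G q)) psi e z (fun t => snd (g t)) a b c d r SG2 Hg2 Hz Hr Spsi Epsi E2) as J2.
  cbv zeta in J1, J2.
  set (al := pd true (fun q => fst (G q)) (0, 0)) in *. set (be := pd false (fun q => fst (G q)) (0, 0)) in *.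
  set (ga := pd true (fun q => snd (G q)) (0, 0)) in *. set (de := pd false (fun q => snd (G q)) (0, 0)) in *.
  assert (f4 : INR (fact 4) = 24) by (rewrite INR_IZR_INZ; reflexivity).
  assert (f5 : INR (fact 5) = 120) by (rewrite INR_IZR_INZ; reflexivity).
  assert (f6 : INR (fact 6) = 720) by (rewrite INR_IZR_INZ; reflexivity).
  assert (f7 : INR (fact 7) = 5040) by (rewrite INR_IZR_INZ; reflexivity).
  assert (A : coefA g = - 2880 * a ^ 9 * (al * de - be * ga)).
  { unfold coefA, det2, dcurve. cbn [fst snd]. rewrite !J1, !J2 by lia. rewrite f4, f5. unfold list_coef; cbn [nth]. ring. }
  split; [|split; [|split; [|split]]].
  - unfold dcurve. rewrite J1, J2 by lia. unfold list_coef; cbn [nth]. f_equal; ring.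
  - unfold dcurve. rewrite J1, J2 by lia. unfold list_coef; cbn [nth]. f_equal; ring.
  - unfold dcurve. rewrite J1, J2 by lia. unfold list_coef; cbn [nth]. f_equal; ring.
  - rewrite A. apply Rmult_integral_contrapositive_currified; auto.
    apply Rmult_integral_contrapositive_currified. lra. apply pow_nonzero, a0.
  (* The number is 60 (4! 5!)(4! 7!), the invariant of h itself when e = 1. The parameter change and
     the Jacobian enter through squares, whence positivity. *)
  - exists (20901888000 * ((a ^ 10) ^ 2 * (al * de - be * ga) ^ 2)). split.
    + apply Rmult_lt_0_compat. lra. apply Rmult_lt_0_compat; apply pow2_gt_0; auto. apply pow_nonzero, a0.
    (* Here b, c and d drop out. Cancelling c forces the ratio 105 : 60 between the terms AD and AC,
       and cancelling b^2 then forces -77. *)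
    + unfold invariant45. rewrite A. unfold coefB, coefC, coefD, det2, dcurve. cbn [fst snd]. rewrite !J1, !J2 by lia.
      rewrite f4, f5, f6, f7. unfold list_coef; cbn [nth]. ring.
Qed.

(** * Reduction to the normal form *)

Ltac smooth2 :=
  repeat match goal with
  | H : smooth_at ?f ?p |- smooth_at ?f ?p => exact H
  | |- smooth_at (fun q => ?c) _ => apply (smooth_at_const c)
  | |- smooth_at (fun q => fst q) _ => apply smooth_at_fst
  | |- smooth_at (fun q => snd q) _ => apply smooth_at_snd
  | |- smooth_at (fun q => @?f q + @?g q) _ => apply (smooth_at_plus f g)
  | |- smooth_at (fun q => @?f q - @?g q) _ => apply (smooth_at_minus f g)
  | |- smooth_at (fun q => @?f q * @?g q) _ => apply (smooth_at_mult f g)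
  | |- smooth_at (fun q => - @?f q) _ => apply (smooth_at_opp f)
  | |- smooth_at (fun q => @?f q ^ ?n) _ => apply (smooth_at_pow f)
  end.

Lemma local_diffeo2_global p q Psi Psii :
  (forall x, smooth_map_at Psi x) -> (forall x, smooth_map_at Psii x) ->
  (forall x, Psii (Psi x) = x) -> (forall x, Psi (Psii x) = x) -> Psi p = q -> local_diffeo2 p q Psi Psii.
Proof.
  intros A B C D E. split; [|split; [|split]]; auto. rewrite <- E. apply C.
  apply filter_forall; auto. apply filter_forall; auto.
Qed.

(** As A <> 0, the Taylor vectors of degrees 4 and 5 form a basis and become the axes. Degree 6 of y
    is a gap; adding c y to x prepares its removal, since c and 5/4 c are the linear coefficients in
    s^4 / t^4 and s^5 / t^5 for a single parameter s = t (1 + c/4 t + ...). *)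
Lemma affine_reduction g : smooth_curve_germ g ->
  dcurve g 1 0 = (0, 0) -> dcurve g 2 0 = (0, 0) -> dcurve g 3 0 = (0, 0) -> coefA g <> 0 ->
  exists c m1 m2, locally 0 (smooth1_at m1) /\ locally 0 (smooth1_at m2) /\
    A_equiv g (fun t => (t ^ 4 * (1 + c * t + t ^ 2 * m1 t), t ^ 5 * (1 + 5 / 4 * c * t + t ^ 2 * m2 t))).
Proof.
  intros Hg D1 D2 D3 HA. apply smooth_curve_germ_iff in Hg. destruct Hg as [Hg1 Hg2].
  destruct (taylor_smooth_remainder 7 _ Hg1) as (r1 & Hr1 & E1).
  destruct (taylor_smooth_remainder 7 _ Hg2) as (r2 & Hr2 & E2).
  unfold dcurve in D1, D2, D3. injection D1 as D11 D12. injection D2 as D21 D22. injection D3 as D31 D32.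
  assert (f4 : INR (fact 4) = 24) by (rewrite INR_IZR_INZ; reflexivity).
  assert (f5 : INR (fact 5) = 120) by (rewrite INR_IZR_INZ; reflexivity).
  assert (f6 : INR (fact 6) = 720) by (rewrite INR_IZR_INZ; reflexivity).
  set (x := fun k => Derive_n (fun s => fst (g s)) k 0) in *.
  set (y := fun k => Derive_n (fun s => snd (g s)) k 0) in *.
  set (p1 := x 4%nat / 24). set (p2 := y 4%nat / 24). set (q1 := x 5%nat / 120). set (q2 := y 5%nat / 120).
  set (s1 := x 6%nat / 720). set (s2 := y 6%nat / 720).
  assert (G1 : forall t, fst (g t) = fst (g 0) + p1 * t ^ 4 + q1 * t ^ 5 + s1 * t ^ 6 + t ^ 7 * r1 t).
  { intros t. rewrite E1. cbn [tpoly]. fold (x 1%nat) (x 2%nat) (x 3%nat) (x 4%nat) (x 5%nat) (x 6%nat).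
    rewrite f4, f5, f6.
    change (x 1%nat = 0) in D11. change (x 2%nat = 0) in D21. change (x 3%nat = 0) in D31.
    rewrite D11, D21, D31. unfold p1, q1, s1. simpl. field. }
  assert (G2 : forall t, snd (g t) = snd (g 0) + p2 * t ^ 4 + q2 * t ^ 5 + s2 * t ^ 6 + t ^ 7 * r2 t).
  { intros t. rewrite E2. cbn [tpoly]. fold (y 1%nat) (y 2%nat) (y 3%nat) (y 4%nat) (y 5%nat) (y 6%nat).
    rewrite f4, f5, f6.
    change (y 1%nat = 0) in D12. change (y 2%nat = 0) in D22. change (y 3%nat = 0) in D32.
    rewrite D12, D22, D32. unfold p2, q2, s2. simpl. field. }
  set (De := p1 * q2 - p2 * q1).
  assert (HDe : De <> 0).
  { intros Z. apply HA. change (x 5%nat * y 4%nat - y 5%nat * x 4%nat = 0).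
    replace (x 5%nat * y 4%nat - y 5%nat * x 4%nat) with (- 2880 * De) by (unfold De, p1, p2, q1, q2; field).
    rewrite Z. ring. }
  set (k := / De). assert (Hk : De * k = 1) by (unfold k; field; auto).
  (* Four fifths of the coefficient of t^6 in the coordinate [W] introduced below. *)
  set (c := 4 / 5 * ((p1 * s2 - p2 * s1) * k)).
  set (m2 := fun t => (p1 * r2 t + (-1) * p2 * r1 t) * k).
  set (m1 := fun t => (s1 * q2 - s2 * q1) * k + 5 / 4 * c ^ 2 + t * ((r1 t * q2 + (-1) * r2 t * q1) * k + c * m2 t)).
  exists c, m1, m2.
  assert (Hm2 : locally 0 (smooth1_at m2)) by (unfold m2; smooth_near).
  assert (Hm1 : locally 0 (smooth1_at m1)) by (unfold m1; smooth_near).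
  split; [|split]; auto.
  set (a := fst (g 0)) in *. set (b := snd (g 0)) in *.
  (* Cramer's rule: the first summand of [V] and [W] are the coordinates of z - g 0 along (p1, p2)
     and (q1, q2). *)
  set (W := fun z : R * R => (p1 * (snd z - b) - p2 * (fst z - a)) * k).
  set (V := fun z : R * R => ((fst z - a) * q2 - (snd z - b) * q1) * k + c * W z).
  apply (A_equiv_target _ _ (fun z => (V z, W z))
    (fun z => (a + (fst z - c * snd z) * p1 + snd z * q1, b + (fst z - c * snd z) * p2 + snd z * q2))).
  - apply local_diffeo2_global.
    + intros z. split; simpl; unfold V, W; smooth2.
    + intros z. split; simpl; smooth2.
    + intros [u v]. unfold V, W; cbn [fst snd]. f_equal.
      * transitivity (a + (u - a) * (De * k)); [unfold De; ring|rewrite Hk; ring].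
      * transitivity (b + (v - b) * (De * k)); [unfold De; ring|rewrite Hk; ring].
    + intros [u v]. unfold V, W; cbn [fst snd]. f_equal.
      * transitivity ((u - c * v) * (De * k) + c * (v * (De * k))); [unfold De; ring|rewrite Hk; ring].
      * transitivity (v * (De * k)); [unfold De; ring|rewrite Hk; ring].
    + unfold V, W. fold a b. f_equal; ring.
  - apply locally_all. intros t.
    assert (EW : W (g t) = t ^ 5 * (1 + 5 / 4 * c * t + t ^ 2 * m2 t)).
    { unfold W. rewrite G1, G2.
      transitivity (t ^ 5 * (De * k + 5 / 4 * c * t + t ^ 2 * m2 t)); [|rewrite Hk; ring].
      unfold De, m2, c. field. }
    rewrite <- EW. f_equal. unfold V. rewrite EW, G1, G2.
    transitivity (t ^ 4 * (De * k + c * t + t ^ 2 * m1 t)); [|rewrite Hk; ring].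
    unfold De, m1. field.
Qed.

Lemma locally_smooth1_inv f : f 0 <> 0 -> locally 0 (smooth1_at f) -> locally 0 (smooth1_at (fun t => / f t)).
Proof.
  intros H0 H. pose proof (Rabs_pos_lt _ H0) as Hp.
  pose proof (locally_comp1 f 0 (fun z => z <> 0) (locally_at_point _ _ _ H)) as L.
  assert (L0 : locally (f 0) (fun z => z <> 0)).
  { apply locally_near1. exists (Rabs (f 0)). split; auto. intros z Hz ->. unfold near1 in Hz.
    rewrite Rminus_0_l, Rabs_Ropp in Hz. lra. }
  generalize (filter_and _ _ H (L L0)). apply filter_imp. intros t [A B].
  apply (smooth1_at_comp Rinv f); auto. apply smooth1_at_inv, B.
Qed.

Lemma locally_smooth1_Rpower f e : 0 < f 0 -> locally 0 (smooth1_at f) ->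
  locally 0 (smooth1_at (fun t => Rpower (f t) e)).
Proof.
  intros H0 H. pose proof (locally_comp1 f 0 _ (locally_at_point _ _ _ H) (locally_pos _ H0)) as L.
  generalize (filter_and _ _ H L). apply filter_imp. intros t [A B].
  apply (smooth1_at_comp (fun z => Rpower z e) f); auto. apply smooth1_at_Rpower, B.
Qed.

Lemma Rpower_root n x : 0 < x -> Rpower x (/ INR (S n)) ^ S n = x.
Proof.
  intros Hx. rewrite <- Rpower_pow by apply exp_pos. rewrite Rpower_mult.
  rewrite Rinv_l by (apply not_0_INR; lia). apply Rpower_1, Hx.
Qed.

Lemma local_diffeo1_of_derivative tau : tau 0 = 0 -> locally 0 (smooth1_at tau) -> 0 < Derive tau 0 ->
  exists phi, local_diffeo1 tau phi.
Proof.
  intros t0 Ht Hd. destruct (inverse_function_1d tau 0 Ht Hd) as (phi & p0 & L1 & L2).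
  rewrite t0 in p0, L1. exists phi. split; [|split; [|split]]; auto.
  apply filter_and; auto.
Qed.

(** With s = t u^(1/4) the first component is exactly s^4. The second is s^5 w(s), where w has no
    linear term because u^(5/4) and v have the same one. *)
Lemma quartic_reparametrization c m1 m2 : locally 0 (smooth1_at m1) -> locally 0 (smooth1_at m2) ->
  exists e z, locally 0 (smooth1_at z) /\
    A_equiv (fun t => (t ^ 4 * (1 + c * t + t ^ 2 * m1 t), t ^ 5 * (1 + 5 / 4 * c * t + t ^ 2 * m2 t)))
            (fun t => (t ^ 4, t ^ 5 + e * t ^ 7 + t ^ 8 * z t)).
Proof.
  intros H1 H2. set (u := fun t => 1 + c * t + t ^ 2 * m1 t). set (v := fun t => 1 + 5 / 4 * c * t + t ^ 2 * m2 t).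
  assert (Hu : locally 0 (smooth1_at u)) by (unfold u; smooth_near).
  assert (Hv : locally 0 (smooth1_at v)) by (unfold v; smooth_near).
  assert (u0 : u 0 = 1) by (unfold u; ring). assert (v0 : v 0 = 1) by (unfold v; ring).
  set (rho := fun t => Rpower (u t) (/ INR 4)).
  assert (Hrho : locally 0 (smooth1_at rho)) by (apply locally_smooth1_Rpower; auto; lra).
  assert (Hup : locally 0 (fun t => 0 < u t)).
  { apply (locally_comp1 u 0 (fun z => 0 < z) (locally_at_point _ _ _ Hu)). apply locally_pos. lra. }
  assert (Erho : locally 0 (fun t => rho t ^ 4 = u t)).
  { revert Hup. apply filter_imp. intros t Ht. apply (Rpower_root 3), Ht. }
  assert (rho0 : rho 0 = 1).
  { unfold rho. rewrite u0. unfold Rpower. rewrite ln_1, Rmult_0_r. apply exp_0. }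
  pose proof (smooth1_at_is_derive _ _ (locally_at_point _ _ _ H1)) as Dm1.
  pose proof (smooth1_at_is_derive _ _ (locally_at_point _ _ _ H2)) as Dm2.
  pose proof (smooth1_at_is_derive _ _ (locally_at_point _ _ _ Hrho)) as Drho.
  assert (Du : is_derive u 0 c).
  { unfold u. auto_derive. eexists; exact Dm1. ring. }
  assert (Dv : is_derive v 0 (5 / 4 * c)).
  { unfold v. auto_derive. eexists; exact Dm2. field. }
  assert (Er1 : 4 * Derive rho 0 = c).
  { assert (is_derive (fun t => rho t ^ 4) 0 (4 * Derive rho 0)) as K.
    { auto_derive. eexists; exact Drho. change (Derive (fun x => rho x) 0) with (Derive rho 0). rewrite rho0. ring. }
    apply (is_derive_ext_loc _ u) in K; [|exact Erho]. apply is_derive_unique in K. rewrite <- K.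
    apply is_derive_unique, Du. }
  set (tau := fun t => t * rho t).
  assert (Htau : locally 0 (smooth1_at tau)) by (unfold tau; smooth_near).
  assert (tau0 : tau 0 = 0) by (unfold tau; ring).
  assert (Dtau : is_derive tau 0 1).
  { unfold tau. auto_derive. eexists; exact Drho. rewrite rho0. ring. }
  destruct (local_diffeo1_of_derivative tau tau0 Htau) as (phi & Hphi).
  { rewrite (is_derive_unique _ _ _ Dtau). lra. }
  pose proof Hphi as (_ & phi0 & L1 & L2).
  assert (Sphi : locally 0 (smooth1_at phi)) by (revert L2; apply filter_imp; tauto).
  assert (Hrphi : locally 0 (smooth1_at (fun s => rho (phi s)))) by (apply locally_smooth1_comp; auto).
  assert (Hirphi : locally 0 (smooth1_at (fun s => / rho (phi s)))).
  { apply (locally_smooth1_inv (fun s => rho (phi s))); auto. rewrite phi0, rho0. lra. }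
  assert (Hvphi : locally 0 (smooth1_at (fun s => v (phi s)))) by (apply locally_smooth1_comp; auto).
  set (w := fun s => v (phi s) * (/ rho (phi s)) ^ 5).
  assert (Hw : locally 0 (smooth1_at w)) by (unfold w; smooth_near).
  assert (w0 : w 0 = 1) by (unfold w; rewrite phi0, v0, rho0; field).
  pose proof (smooth1_at_is_derive _ _ (locally_at_point _ _ _ Hw)) as Dw.
  assert (rhopos : forall t, rho t <> 0) by (intros t; apply Rgt_not_eq, exp_pos).
  assert (Ew : locally 0 (fun t => rho t ^ 5 * w (tau t) = v t)).
  { revert L1. apply filter_imp. intros t [_ H]. unfold w. rewrite H. field. apply rhopos. }
  (* Differentiating rho^5 w(tau) = v at 0 gives 5 rho' + w' = 5/4 c, while 4 rho' = c. *)
  assert (Dw0 : Derive w 0 = 0).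
  { assert (is_derive (fun t => rho t ^ 5 * w (tau t)) 0 (5 * Derive rho 0 + Derive w 0)) as K.
    { auto_derive. repeat split. eexists; exact Drho. rewrite tau0. eexists; exact Dw. eexists; exact Dtau.
      change (Derive (fun x => rho x) 0) with (Derive rho 0). change (Derive (fun x => tau x) 0) with (Derive tau 0).
      change (Derive (fun x => w x)) with (Derive w).
      rewrite tau0, rho0, w0, (is_derive_unique _ _ _ Dtau). ring. }
    apply (is_derive_ext_loc _ v) in K; [|exact Ew]. apply is_derive_unique in K.
    apply is_derive_unique in Dv. lra. }
  destruct (taylor_smooth_remainder 3 w Hw) as (z & Hz & Ez).
  exists (Derive_n w 2 0 / 2), z. split; auto.
  apply (A_equiv_reparam _ _ tau phi Hphi).
  assert (Erphi : locally 0 (fun s => rho (phi s) ^ 4 = u (phi s))) by (apply (locally_0_comp (fun t => rho t ^ 4 = u t)); auto;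
    apply smooth1_at_continuous, (locally_at_point _ _ _ Sphi)).
  generalize (filter_and _ _ L2 Erphi). apply filter_imp. intros s [[_ A] B].
  fold (u (phi s)) (v (phi s)). rewrite <- B. f_equal.
  - replace (s ^ 4) with ((phi s * rho (phi s)) ^ 4) by (f_equal; exact A). ring.
  - transitivity (s ^ 5 * w s).
    + replace (s ^ 5) with ((phi s * rho (phi s)) ^ 5) by (f_equal; exact A). unfold w. field. apply rhopos.
    + rewrite Ez. cbn [tpoly]. change (Derive_n w 1 0) with (Derive w 0). change (Derive_n w 0 0) with (w 0).
      rewrite w0, Dw0. replace (INR (fact 2)) with 2 by (rewrite INR_IZR_INZ; reflexivity).
      replace (INR (fact 0)) with 1 by reflexivity. generalize (Derive_n w 2 0). intros w2.
      replace (INR (fact 1)) with 1 by reflexivity. field.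
Qed.

Definition cusp (sg t : R) : R * R := (t ^ 4, t ^ 5 + sg * t ^ 7).

(** Replacing t by la t and dividing the components by la^4 and la^5 turns e into e la^2: the
    modulus can be normalized, the sign cannot. *)
Lemma rescaling e sg z : 0 < sg * e -> sg ^ 2 = 1 -> locally 0 (smooth1_at z) ->
  exists z', locally 0 (smooth1_at z') /\
    A_equiv (fun t => (t ^ 4, t ^ 5 + e * t ^ 7 + t ^ 8 * z t))
            (fun t => (t ^ 4, t ^ 5 + sg * t ^ 7 + t ^ 8 * z' t)).
Proof.
  intros He Hs Hz. set (la := sqrt (/ (sg * e))).
  assert (Hla : 0 < la) by (apply sqrt_lt_R0, Rinv_0_lt_compat, He).
  assert (Ela : e * la ^ 2 = sg).
  { unfold la. rewrite pow2_sqrt by (left; apply Rinv_0_lt_compat, He).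
    assert (sg <> 0 /\ e <> 0) as [A B] by (split; intros ->; lra).
    rewrite Rinv_mult. apply Rmult_eq_reg_l with sg; auto. transitivity 1. field; auto. rewrite <- Hs. ring. }
  exists (fun t => la ^ 3 * z (la * t)).
  assert (Hzl : locally 0 (smooth1_at (fun t => z (la * t)))).
  { apply (locally_smooth1_comp z (fun t => la * t)); auto. ring. smooth_near. }
  split. smooth_near.
  apply A_equiv_trans with (fun t => ((la * t) ^ 4, (la * t) ^ 5 + e * (la * t) ^ 7 + (la * t) ^ 8 * z (la * t))).
  - apply (A_equiv_reparam _ _ (fun t => / la * t) (fun t => la * t)).
    + split; [|split; [|split]]; try ring; apply locally_all; intros t; split; try (field; lra);
      apply smooth1_at_mult; auto using smooth1_at_const, smooth1_at_id.
    + apply locally_all. intros t. reflexivity.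
  - apply (A_equiv_target _ _ (fun q => ((/ la) ^ 4 * fst q, (/ la) ^ 5 * snd q)) (fun q => (la ^ 4 * fst q, la ^ 5 * snd q))).
    + apply local_diffeo2_global.
      * intros q. split; simpl; smooth2.
      * intros q. split; simpl; smooth2.
      * intros [x y]. cbn [fst snd]. f_equal; field; lra.
      * intros [x y]. cbn [fst snd]. f_equal; field; lra.
      * cbn [fst snd]. f_equal; ring.
    + apply locally_all. intros t. cbn [fst snd]. rewrite <- Ela. f_equal; field; lra.
Qed.

(** * Removal of the terms of degree 8 and higher *)

Fixpoint geometric (n : nat) (m : R) : R := match n with O => 0 | S n => geometric n m + m ^ n end.

(** It exhibits the factor y in m ^ n - 1. In the application y is a multiple of t^4, so the
    corrections to t^8, ..., t^11 have degree at least 12. *)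
Lemma pow_via_geometric n m y : m = 1 + y -> m ^ n = 1 + y * geometric n m.
Proof.
  intros H. induction n as [|n IH]; simpl. ring.
  rewrite IH at 1. rewrite H at 1. rewrite IH. ring.
Qed.

(* The monomials of degrees 8, 9, 10 and 12 and above come from functions of (x, y).  Degree 11 does not; the map
   x/(1 - d x) moves the degree 9 and 11 coefficients at different rates, and d is chosen so that they match a multiple of x y. *)
Lemma degree_11_adjustment sg z : sg ^ 2 = 1 -> locally 0 (smooth1_at z) ->
  exists a8 a9 a10 h, locally 0 (smooth1_at h) /\
    A_equiv (fun t => (t ^ 4, t ^ 5 + sg * t ^ 7 + t ^ 8 * z t))
      (fun t => let x := t ^ 4 in let y := t ^ 5 + sg * t ^ 7 in
        (x, y + a8 * x ^ 2 + a9 * (x * y) + a10 * y ^ 2 + t ^ 12 * h t)).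
Proof.
  intros Hs Hz. destruct (taylor_smooth_remainder 4 z Hz) as (z4 & Hz4 & Ez).
  set (zc := fun k => Derive_n z k 0 / INR (fact k)) in Ez.
  set (z0 := zc 0%nat). set (z1 := zc 1%nat). set (z2 := zc 2%nat). set (z3 := zc 3%nat).
  (* Solution of z3 - 7/4 sg d = sg (z1 - 5/4 d) by means of sg^2 = 1: the new coefficients of t^11
     and t^9 must be in the ratio sg, as in x y = t^9 + sg t^11. *)
  set (d := 2 * sg * z3 - 2 * z1).
  (* The old parameter is s(r) = r m(r^4), so that s^4 = X / (1 + d X) with X = r^4; equivalently X
     = x / (1 - d x) for x = s^4. *)
  set (m := fun x => Rpower (1 + d * x) (- / INR 4)).
  assert (Hd : locally 0 (smooth1_at (fun x => 1 + d * x))) by smooth_near.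
  assert (Hm : locally 0 (smooth1_at m)) by (apply (locally_smooth1_Rpower (fun x => 1 + d * x)); [lra|auto]).
  assert (m0 : m 0 = 1).
  { unfold m. rewrite Rmult_0_r, Rplus_0_r. unfold Rpower. rewrite ln_1, Rmult_0_r. apply exp_0. }
  assert (Lpos : forall d, locally 0 (fun x => 0 < 1 + d * x)).
  { intros d'. apply (locally_comp1 (fun x => 1 + d' * x) 0 (fun z => 0 < z)).
    apply smooth1_at_plus. apply smooth1_at_const. apply smooth1_at_mult; auto using smooth1_at_const, smooth1_at_id.
    apply locally_pos. lra. }
  assert (Em : locally 0 (fun x => m x ^ 4 * (1 + d * x) = 1)).
  { generalize (Lpos d). apply filter_imp. intros x Hx. unfold m. rewrite Rpower_Ropp, pow_inv.
    rewrite (Rpower_root 3) by auto. field. lra. }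
  assert (Dm : Derive m 0 = - d / 4).
  { pose proof (smooth1_at_is_derive _ _ (locally_at_point _ _ _ Hm)) as K.
    assert (is_derive (fun x => m x ^ 4 * (1 + d * x)) 0 (4 * Derive m 0 + d)) as K2.
    { auto_derive. eexists; exact K. change (Derive (fun x => m x) 0) with (Derive m 0). rewrite m0. ring. }
    apply (is_derive_ext_loc _ (fun _ => 1)) in K2; [|exact Em]. apply is_derive_unique in K2.
    rewrite Derive_const in K2. lra. }
  destruct (hadamard m Hm) as (k & Hk & Ek & Dk). rewrite m0 in Ek.
  destruct (hadamard k Hk) as (m2 & Hm2 & Em2 & _).
  assert (k0 : k 0 = - d / 4).
  { specialize (Dk 0%nat). change (k 0 = Derive m 0 / 1) in Dk. rewrite Dk, Dm. field. }
  rewrite k0 in Em2.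
  assert (P4 : locally 0 (smooth1_at (fun r => r ^ 4))) by smooth_near.
  assert (P40 : 0 ^ 4 = 0) by ring.
  assert (Hm' : locally 0 (smooth1_at (fun r => m (r ^ 4)))) by (apply (locally_smooth1_comp m (fun r => r ^ 4)); auto).
  assert (Hk' : locally 0 (smooth1_at (fun r => k (r ^ 4)))) by (apply (locally_smooth1_comp k (fun r => r ^ 4)); auto).
  assert (Hm2' : locally 0 (smooth1_at (fun r => m2 (r ^ 4)))) by (apply (locally_smooth1_comp m2 (fun r => r ^ 4)); auto).
  set (s := fun r => r * m (r ^ 4)).
  assert (Hsm : locally 0 (smooth1_at s)) by (unfold s; smooth_near).
  assert (s0 : s 0 = 0) by (unfold s; ring).
  assert (Hz4s : locally 0 (smooth1_at (fun r => z4 (s r)))) by (apply locally_smooth1_comp; auto).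
  assert (Hgeo : forall n, locally 0 (smooth1_at (fun r => geometric n (m (r ^ 4))))).
  { induction n as [|n IH]; simpl; smooth_near. }
  (* Everything of degree at least 12, divided by r^12: the tails of m^5 and m^7 beyond first order
     in r^4, the corrections to the terms z0 to z3, the old remainder, and, subtracted, the part 2
     sg r^12 + r^14 of y^2 times z2. *)
  set (h := fun r => let x := r ^ 4 in
     5 * (r * m2 x) + r * (10 * k x ^ 2 + 10 * x * k x ^ 3 + 5 * x ^ 2 * k x ^ 4 + x ^ 3 * k x ^ 5)
     + sg * (7 * r ^ 3 * m2 x + r ^ 3 * (21 * k x ^ 2 + 35 * x * k x ^ 3 + 35 * x ^ 2 * k x ^ 4 + 21 * x ^ 3 * k x ^ 5
         + 7 * x ^ 4 * k x ^ 6 + x ^ 5 * k x ^ 7))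
     + (z0 * (k x * geometric 8 (m x)) + z1 * (r * (k x * geometric 9 (m x)))
       + z2 * (r ^ 2 * (k x * geometric 10 (m x))) + z3 * (r ^ 3 * (k x * geometric 11 (m x))))
     + m x ^ 12 * z4 (s r) + (-1) * z2 * (2 * sg + r ^ 2)).
  assert (Hh : locally 0 (smooth1_at h)).
  { unfold h. cbv zeta. smooth_near; apply Hgeo. }
  exists z0, (z1 - 5 / 4 * d), z2, h. split; auto.
  set (psi := fun t => t * Rpower (1 + - d * t ^ 4) (- / INR 4)).
  assert (Hpsi : locally 0 (smooth1_at psi)).
  { unfold psi. apply (locally_smooth1_mult (fun t => t)). smooth_near.
    apply (locally_smooth1_Rpower (fun t => 1 + - d * t ^ 4)). rewrite P40; lra. smooth_near. }
  assert (psi0 : psi 0 = 0) by (unfold psi; ring).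
  assert (Rinv4 : forall A, 0 < A -> Rpower A (- / INR 4) ^ 4 = / A).
  { intros A HA. rewrite Rpower_Ropp, pow_inv, (Rpower_root 3) by auto. reflexivity. }
  (* both compositions have the form t A^(-1/4) B^(-1/4) with A B = 1 *)
  assert (Comp : forall A B t, 0 < A -> 0 < B -> A * B = 1 -> (t * Rpower A (- / INR 4)) * Rpower B (- / INR 4) = t).
  { intros A B t HA HB HAB. rewrite Rmult_assoc, Rpower_mult_distr, HAB by auto.
    unfold Rpower. rewrite ln_1, Rmult_0_r, exp_0. ring. }
  assert (Dif : forall d, locally 0 (fun t =>
    (t * Rpower (1 + - d * t ^ 4) (- / INR 4)) * Rpower (1 + d * (t * Rpower (1 + - d * t ^ 4) (- / INR 4)) ^ 4) (- / INR 4) = t)).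
  { intros d'. pose proof (locally_0_comp _ (fun r => r ^ 4) (smooth1_at_continuous _ _ (locally_at_point _ _ _ P4)) P40 (Lpos (- d'))) as L.
    revert L. apply filter_imp. intros t Ht.
    assert (E : 1 + d' * (t * Rpower (1 + - d' * t ^ 4) (- / INR 4)) ^ 4 = / (1 + - d' * t ^ 4)).
    { rewrite Rpow_mult_distr, Rinv4 by auto. field. lra. }
    apply Comp; auto. rewrite E. apply Rinv_0_lt_compat, Ht. rewrite E. field. lra. }
  apply A_equiv_trans with (fun t => (s t ^ 4, s t ^ 5 + sg * s t ^ 7 + s t ^ 8 * z (s t))).
  - apply (A_equiv_reparam _ _ psi s).
    + split; [|split; [|split]]; auto; apply filter_and; auto.
      * apply (Dif d).
      * generalize (Dif (- d)). apply filter_imp. intros t Ht. rewrite Ropp_involutive in Ht. exact Ht.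
    + apply locally_all. reflexivity.
  - apply (A_equiv_target _ _ (fun q => (fst q * / (1 + - d * fst q), snd q)) (fun q => (fst q * / (1 + d * fst q), snd q))).
    + assert (Sm : forall d, locally (0, 0) (smooth_map_at (fun q => (fst q * / (1 + d * fst q), snd q)))).
      { intros d'. generalize (Lpos d'). intros L. apply locally_near1 in L. destruct L as (e & He & L).
        apply locally_near2. exists e. split; auto. intros q [Hq _]. specialize (L _ Hq). split; simpl; smooth2.
        apply (smooth_at_inv (fun q => 1 + d' * fst q)). lra. smooth2. }
      assert (In : forall d, locally (0, 0) (fun q =>
        (fst q * / (1 + - d * fst q)) * / (1 + d * (fst q * / (1 + - d * fst q))) = fst q)).
      { intros d'. generalize (Lpos (- d')). intros L. apply locally_near1 in L. destruct L as (e & He & L).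
        apply locally_near2. exists e. split; auto. intros [x y] [Hq _]. specialize (L _ Hq). cbn [fst snd] in *. field.
        split; lra. }
      assert (X0 : forall a : R, (0 * / (1 + a * 0), 0) = (0, 0)) by (intros a; f_equal; ring).
      rewrite s0. replace (0 ^ 4, 0 ^ 5 + sg * 0 ^ 7 + 0 ^ 8 * z 0) with (0, 0) by (f_equal; ring).
      cbv zeta. match goal with |- local_diffeo2 _ ?q _ _ => replace q with (0, 0) by (f_equal; ring) end.
      split; [|split; [|split]].
      * apply X0.
      * apply X0.
      * generalize (filter_and _ _ (Sm (- d)) (In d)). apply filter_imp. intros [x y] [A B]. split; auto.
        cbn [fst snd] in *. exact (f_equal (fun u : R => (u, y : R)) B).
      * generalize (filter_and _ _ (Sm d) (In (- d))). apply filter_imp. intros [x y] [A B]. split; auto.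
        cbn [fst snd] in *. rewrite Ropp_involutive in B. exact (f_equal (fun u : R => (u, y : R)) B).
    + assert (L : locally 0 (fun t => 0 < 1 + d * t ^ 4)) by (apply (locally_0_comp _ (fun r => r ^ 4) (smooth1_at_continuous _ _ (locally_at_point _ _ _ P4)) P40 (Lpos d))).
      revert L. apply filter_imp. intros t Ht. cbn [fst snd]. cbv zeta. f_equal.
      * unfold s. rewrite Rpow_mult_distr. unfold m. rewrite Rinv4 by auto. field. lra.
      * assert (Ek' : m (t ^ 4) = 1 + t ^ 4 * k (t ^ 4)) by apply Ek.
        rewrite Ez. cbn [tpoly]. fold z0 z1 z2 z3.
        unfold h. cbv zeta.
        pose proof (Em2 (t ^ 4)) as Em2'.
        set (K := k (t ^ 4)) in *. set (M := m (t ^ 4)) in *. set (N := m2 (t ^ 4)) in *.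
        assert (ES : s t = t * M) by reflexivity.
        set (Z := z4 (s t)). rewrite ES.
        pose proof (pow_via_geometric 8 M _ Ek') as P8. pose proof (pow_via_geometric 9 M _ Ek') as P9.
        pose proof (pow_via_geometric 10 M _ Ek') as P10. pose proof (pow_via_geometric 11 M _ Ek') as P11.
        set (g8 := geometric 8 M) in *. set (g9 := geometric 9 M) in *. set (g10 := geometric 10 M) in *. set (g11 := geometric 11 M) in *.
        transitivity (t ^ 5 * M ^ 5 + sg * t ^ 7 * M ^ 7 + z0 * t ^ 8 * M ^ 8 + z1 * t ^ 9 * M ^ 9
          + z2 * t ^ 10 * M ^ 10 + z3 * t ^ 11 * M ^ 11 + t ^ 12 * M ^ 12 * Z). ring.
        rewrite P8, P9, P10, P11.
        assert (Q5 : M ^ 5 = 1 + 5 * t ^ 4 * (- d / 4 + t ^ 4 * N) + t ^ 8 * (10 * K ^ 2 + 10 * t ^ 4 * K ^ 3 + 5 * (t ^ 4) ^ 2 * K ^ 4 + (t ^ 4) ^ 3 * K ^ 5)).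
        { rewrite Ek', <- Em2'. ring. }
        assert (Q7 : M ^ 7 = 1 + 7 * t ^ 4 * (- d / 4 + t ^ 4 * N) + t ^ 8 * (21 * K ^ 2 + 35 * t ^ 4 * K ^ 3
           + 35 * (t ^ 4) ^ 2 * K ^ 4 + 21 * (t ^ 4) ^ 3 * K ^ 5 + 7 * (t ^ 4) ^ 4 * K ^ 6 + (t ^ 4) ^ 5 * K ^ 7)).
        { rewrite Ek', <- Em2'. ring. }
        rewrite Q5, Q7. generalize (M ^ 12). intros M12. clearbody K N Z g8 g9 g10 g11.
        assert (S1 : z3 = sg * (d / 2 + z1)). { unfold d. transitivity (sg ^ 2 * z3). rewrite Hs; ring. field. }
        clearbody d. rewrite S1.
        (* The two sides agree only modulo sg^2 = 1; the discrepancy is the t^14 term of y^2. *)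
        match goal with |- ?a = ?b => assert (a - b = (sg ^ 2 - 1) * - (z2 * t ^ 14)) as Fin by field end.
        rewrite Hs in Fin. lra.
Qed.

(* The remainder t^12 h(t) is a function of the point: splitting h by residues mod 4 and solving
   t^12 h = c0 + c1 y + c2 y^2 + c3 y^3 with y = x t + sg x t^3 coefficientwise in 1, t, t^2, t^3. *)
Lemma remainder_as_function_of_point sg h : sg ^ 2 = 1 -> locally 0 (smooth1_at h) ->
  exists c0 d1 c2 c3, locally 0 (smooth1_at c0) /\ locally 0 (smooth1_at d1) /\
    locally 0 (smooth1_at c2) /\ locally 0 (smooth1_at c3) /\ c0 0 = 0 /\
    locally 0 (fun t => let x := t ^ 4 in let y := t ^ 5 + sg * t ^ 7 in
       t ^ 12 * h t = c0 x + x ^ 2 * d1 x * y + c2 x * y ^ 2 + c3 x * y ^ 3).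
Proof.
  intros Hs Hh. destruct (decomposition_mod_4 h Hh) as (b0 & b1 & b2 & b3 & H0 & H1 & H2 & H3 & E).
  assert (Hi1 : locally 0 (smooth1_at (fun x => / (1 + (-1) * x ^ 2)))).
  { apply (locally_smooth1_inv (fun x => 1 + (-1) * x ^ 2)). lra. smooth_near. }
  assert (Hi2 : locally 0 (smooth1_at (fun x => / (1 + x)))).
  { apply (locally_smooth1_inv (fun x => 1 + x)). lra. smooth_near. }
  (* Modulo sg^2 = 1 one has y = x (t + sg t^3), y^2 = x^2 (2 sg x + (1 + x) t^2) and y^3 = x^3 (sg
     (3 x + x^2) t + (1 + 3 x) t^3). The odd part is a 2 by 2 system of determinant 1 - x^2, the
     even part requires 1 / (1 + x), and both are invertible near 0. The factor x^3 of t^12 pays for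
     the one in y^3. *)
  set (c3 := fun x => (b3 x + (-1) * sg * b1 x) * / (1 + (-1) * x ^ 2)).
  set (d1 := fun x => b1 x + (-1) * sg * (3 * x + x ^ 2) * c3 x).
  set (c2 := fun x => x * b2 x * / (1 + x)).
  set (c0 := fun x => x ^ 3 * (b0 x + (-2) * sg * c2 x)).
  assert (K3 : locally 0 (smooth1_at c3)) by (unfold c3; smooth_near).
  assert (K1 : locally 0 (smooth1_at d1)) by (unfold d1; smooth_near).
  assert (K2 : locally 0 (smooth1_at c2)) by (unfold c2; smooth_near).
  assert (K0 : locally 0 (smooth1_at c0)) by (unfold c0; smooth_near).
  exists c0, d1, c2, c3. repeat (split; auto). unfold c0; ring.
  assert (L : locally 0 (fun x => Rabs x < 1)).
  { apply locally_near1. exists 1. split. lra. intros q. unfold near1. rewrite Rminus_0_r. auto. }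
  assert (P4 : locally 0 (smooth1_at (fun r => r ^ 4))) by smooth_near.
  pose proof (locally_0_comp _ (fun r => r ^ 4) (smooth1_at_continuous _ _ (locally_at_point _ _ _ P4)) ltac:(simpl; ring) L) as L'.
  revert L'. apply filter_imp. intros t Ht. cbv zeta.
  set (x := t ^ 4) in *. apply Rabs_def2 in Ht.
  assert (N1 : 1 + (-1) * x ^ 2 <> 0) by nra. assert (N2 : 1 + x <> 0) by lra.
  assert (Eb2 : x * b2 x = (1 + x) * c2 x) by (unfold c2; field; auto).
  assert (Eb1 : b1 x = d1 x + sg * (3 * x + x ^ 2) * c3 x) by (unfold d1; ring).
  assert (Eb3 : b3 x = sg * d1 x + (1 + 3 * x) * c3 x).
  { transitivity (sg * (b1 x + (-1) * sg * (3 * x + x ^ 2) * c3 x) + (1 + 3 * x) * c3 x); [|reflexivity].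
    transitivity (sg * b1 x + (-1) * sg ^ 2 * (3 * x + x ^ 2) * c3 x + (1 + 3 * x) * c3 x); [|ring].
    rewrite Hs. unfold c3. field. auto. }
  assert (Eb0 : x ^ 3 * b0 x = c0 x + 2 * sg * x ^ 3 * c2 x) by (unfold c0; ring).
  rewrite E. fold x.
  transitivity (x ^ 3 * b0 x + t * x ^ 3 * b1 x + t ^ 2 * x ^ 2 * (x * b2 x) + t ^ 3 * x ^ 3 * b3 x). unfold x; ring.
  rewrite Eb0, Eb1, Eb2, Eb3.
  generalize (c0 x) (d1 x) (c2 x) (c3 x). intros C0 D1 C2' C3.
  match goal with |- ?a = ?b => assert (a - b = (1 - sg ^ 2) * (C2' * t ^ 14 + 3 * t ^ 19 * C3 + sg * t ^ 21 * C3)) as Fin by (unfold x; ring) end.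
  rewrite Hs in Fin. lra.
Qed.

(** The second component equals G at the point (x, y) of the cusp, and G has y-derivative 1 at the
    origin. Inverting G in y therefore carries the curve to the cusp. *)
Lemma determinacy sg a8 a9 a10 h : sg ^ 2 = 1 -> locally 0 (smooth1_at h) ->
  A_equiv (fun t => let x := t ^ 4 in let y := t ^ 5 + sg * t ^ 7 in
        (x, y + a8 * x ^ 2 + a9 * (x * y) + a10 * y ^ 2 + t ^ 12 * h t)) (cusp sg).
Proof.
  intros Hs Hh. destruct (remainder_as_function_of_point sg h Hs Hh) as (c0 & d1 & c2 & c3 & K0 & K1 & K2 & K3 & c00 & E).
  set (G := fun q : R * R => snd q + a8 * fst q ^ 2 + a9 * (fst q * snd q) + a10 * snd q ^ 2
     + (c0 (fst q) + fst q ^ 2 * d1 (fst q) * snd q + c2 (fst q) * snd q ^ 2 + c3 (fst q) * snd q ^ 3)).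
  assert (HG : locally (0, 0) (smooth_at G)).
  { pose proof (filter_and _ _ (filter_and _ _ K0 K1) (filter_and _ _ K2 K3)) as L. apply locally_near1 in L.
    destruct L as (e & He & L). apply locally_near2. exists e. split; auto. intros q [Hq _].
    destruct (L _ Hq) as [[A B] [C D]].
    assert (S : forall f, smooth1_at f (fst q) -> smooth_at (fun q => f (fst q)) q).
    { intros f Hf. apply (smooth_at_comp1 f (fun q => fst q)); auto. apply smooth_at_fst. }
    apply S in A, B, C, D. unfold G. smooth2. }
  assert (G0 : G (0, 0) = 0) by (unfold G; cbn [fst snd]; rewrite c00; ring).
  assert (DG : pd false G (0, 0) = 1).
  { unfold pd, G. cbn [fst snd]. apply is_derive_unique. auto_derive; auto. ring. }
  assert (DG0 : 0 < pd false G (0, 0)) by lra.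
  destruct (inverse_in_second_variable G 0 0 HG DG0) as (Y & Y0 & L1 & L2).
  rewrite G0 in Y0, L1.
  assert (Z0 : cusp sg 0 = (0, 0)) by (unfold cusp; f_equal; ring).
  apply (A_equiv_target _ _ (fun q => (fst q, Y q)) (fun q => (fst q, G q))).
  - rewrite Z0. cbv zeta. match goal with |- local_diffeo2 ?q _ _ _ => replace q with (0, 0) by (f_equal; ring) end.
    split; [|split; [|split]]; cbn [fst snd].
    + rewrite Y0. reflexivity.
    + rewrite G0. reflexivity.
    + revert L1. apply filter_imp. intros [x y] [A B]. cbn [fst snd] in *. split.
      split; cbn [fst snd]. apply smooth_at_fst. exact A. exact (f_equal (fun u : R => (x : R, u)) B).
    + generalize (filter_and _ _ HG L2). apply filter_imp. intros [x y] [A B]. cbn [fst snd] in *. split.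
      split; cbn [fst snd]. apply smooth_at_fst. exact A. exact (f_equal (fun u : R => (x : R, u)) B).
  - assert (c2' : continuous (cusp sg) 0).
    { apply continuous_curve; apply smooth1_at_continuous; unfold cusp; cbn [fst snd].
      apply smooth1_at_pow, smooth1_at_id. apply smooth1_at_plus. apply smooth1_at_pow, smooth1_at_id.
      apply smooth1_at_mult. apply smooth1_at_const. apply smooth1_at_pow, smooth1_at_id. }
    rewrite <- Z0 in L2. pose proof (c2' _ L2) as L.
    change (locally 0 (fun t => Y (fst (cusp sg t), G (cusp sg t)) = snd (cusp sg t))) in L.
    generalize (filter_and _ _ L E). apply filter_imp. intros t [A B]. cbv zeta in B |- *. cbn [fst snd].
    unfold cusp in A |- *. cbn [fst snd] in A. f_equal.
    etransitivity; [|exact A]. f_equal. f_equal. unfold G. cbn [fst snd]. rewrite B. ring.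
Qed.

(** Both signs are treated at once: the algebra of the reduction uses only sg ^ 2 = 1. *)
Theorem A_equiv_cusp_iff sg g : sg ^ 2 = 1 -> smooth_curve_germ g ->
  (A_equiv g (cusp sg) <->
    (dcurve g 1 0 = (0, 0) /\ dcurve g 2 0 = (0, 0) /\ dcurve g 3 0 = (0, 0) /\
     coefA g <> 0 /\ 0 < sg * invariant45 g)).
Proof.
  intros Hs Hg. split.
  - intros H.
    destruct (A_equiv_normal_form_invariants g (cusp sg) sg (fun _ => 0) Hg) as (D1 & D2 & D3 & HA & K & HK & E); auto.
    + apply locally_smooth1_const.
    + apply locally_all. intros t. unfold cusp. f_equal. ring.
    + repeat (split; auto). rewrite E. replace (sg * (K * sg)) with (K * sg ^ 2) by ring. rewrite Hs. lra.
  - intros (D1 & D2 & D3 & HA & HI).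
    destruct (affine_reduction g Hg D1 D2 D3 HA) as (c & m1 & m2 & H1 & H2 & R1).
    destruct (quartic_reparametrization c m1 m2 H1 H2) as (e & z & Hz & R2).
    pose proof (A_equiv_trans _ _ _ R1 R2) as R12.
    (* The direct implication, applied to the intermediate normal form, yields the sign of e without
       following the invariant through the coordinate changes. *)
    destruct (A_equiv_normal_form_invariants g _ e z Hg Hz (locally_all _ 0 (fun t => eq_refl)) R12)
      as (_ & _ & _ & _ & K & HK & E).
    assert (He : 0 < sg * e).
    { rewrite E in HI. apply Rmult_lt_reg_l with K; auto. rewrite Rmult_0_r.
      replace (K * (sg * e)) with (sg * (K * e)) by ring. exact HI. }
    destruct (rescaling e sg z He Hs Hz) as (z' & Hz' & R3).
    destruct (degree_11_adjustment sg z' Hs Hz') as (a8 & a9 & a10 & h & Hh & R4).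
    eapply A_equiv_trans; [exact R12|]. eapply A_equiv_trans; [exact R3|].
    eapply A_equiv_trans; [exact R4|]. apply determinacy; auto.
Qed.

Lemma A_equiv_ext_r g h h' : (forall t, h t = h' t) -> A_equiv g h -> A_equiv g h'.
Proof.
  intros E H. apply A_equiv_trans with h; auto.
  apply (A_equiv_reparam h h' (fun t => t) (fun t => t) local_diffeo1_id). apply locally_all, E.
Qed.

Lemma cusp_plus_eq t : cusp_plus t = cusp 1 t.
Proof. unfold cusp_plus, cusp. f_equal. ring. Qed.

Lemma cusp_minus_eq t : cusp_minus t = cusp (-1) t.
Proof. unfold cusp_minus, cusp. f_equal. ring. Qed.

Lemma smooth_curve_germ_cusp_plus : smooth_curve_germ cusp_plus.
Proof.
  apply smooth_curve_germ_iff. unfold cusp_plus. cbn [fst snd]. split; smooth_near.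
Qed.

Theorem mainTheorem15 :
  (forall g : R -> R * R, smooth_curve_germ g ->
     (A_equiv g cusp_plus <->
        (dcurve g 1 0 = (0, 0) /\ dcurve g 2 0 = (0, 0) /\ dcurve g 3 0 = (0, 0) /\
         coefA g <> 0 /\ invariant45 g > 0))) /\
  (forall g : R -> R * R, smooth_curve_germ g ->
     (A_equiv g cusp_minus <->
        (dcurve g 1 0 = (0, 0) /\ dcurve g 2 0 = (0, 0) /\ dcurve g 3 0 = (0, 0) /\
         coefA g <> 0 /\ invariant45 g < 0))) /\
  ~ A_equiv cusp_plus cusp_minus.
Proof.
  assert (Plus : forall g : R -> R * R, smooth_curve_germ g ->
     (A_equiv g cusp_plus <->
        (dcurve g 1 0 = (0, 0) /\ dcurve g 2 0 = (0, 0) /\ dcurve g 3 0 = (0, 0) /\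
         coefA g <> 0 /\ invariant45 g > 0))).
  { intros g Hg. destruct (A_equiv_cusp_iff 1 g ltac:(ring) Hg) as [H K]. split.
    - intros HA. destruct H as (D1 & D2 & D3 & A & I).
      { revert HA. apply A_equiv_ext_r, cusp_plus_eq. }
      repeat (split; auto). lra.
    - intros (D1 & D2 & D3 & A & I). apply (A_equiv_ext_r g (cusp 1)).
      intros t; symmetry; apply cusp_plus_eq. apply K. repeat (split; auto). lra. }
  assert (Minus : forall g : R -> R * R, smooth_curve_germ g ->
     (A_equiv g cusp_minus <->
        (dcurve g 1 0 = (0, 0) /\ dcurve g 2 0 = (0, 0) /\ dcurve g 3 0 = (0, 0) /\
         coefA g <> 0 /\ invariant45 g < 0))).
  { intros g Hg. destruct (A_equiv_cusp_iff (-1) g ltac:(ring) Hg) as [H K]. split.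
    - intros HA. destruct H as (D1 & D2 & D3 & A & I).
      { revert HA. apply A_equiv_ext_r, cusp_minus_eq. }
      repeat (split; auto). lra.
    - intros (D1 & D2 & D3 & A & I). apply (A_equiv_ext_r g (cusp (-1))).
      intros t; symmetry; apply cusp_minus_eq. apply K. repeat (split; auto). lra. }
  split; [exact Plus|split; [exact Minus|]]. intros H.
  (* Reflexivity makes the invariant of [cusp_plus] positive; an equivalence with [cusp_minus] would
     make it negative. *)
  destruct (proj1 (Plus _ smooth_curve_germ_cusp_plus) (A_equiv_refl _)) as (_ & _ & _ & _ & P).
  destruct (proj1 (Minus _ smooth_curve_germ_cusp_plus) H) as (_ & _ & _ & _ & N). lra.
Qed.
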